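(* Let $A$ be a module-finite algebra over a commutative Noetherian ring $R$, and let $n\geq 0$ be an integer. The following are equivalent. (1) $A$ is $n$-Gorenstein. (2) For every $\mathfrak p\in\operatorname{Spec} R$ and every simple $A_{\mathfrak p}$-module $S$, \[ \operatorname{grade}_{A_{\mathfrak p}}S\geq\min\{n,\operatorname{fdim}_{A_{\mathfrak p}}I_{A_{\mathfrak p}}(S)\}. \] (3) For every $\mathfrak p\in\operatorname{Spec} R$ and every simple $A_{\mathfrak p}$-module $S$ with $\operatorname{grade}_{A_{\mathfrak p}}S<n$, \[ \operatorname{fdim}_{A_{\mathfrak p}}I_{A_{\mathfrak p}}(S)=\operatorname{grade}_{A_{\mathfrak p}}S. \]
   Context: All modules are left modules. A module-finite $R$-algebra is a (not necessarily commutative) associative unital ring $A$ with a ring homomorphism from $R$ to the center of $A$ making $A$ a finitely generated $R$-module; such $A$ is two-sided Noetherian. For $\mathfrak p\in\operatorname{Spec}R$, $A_{\mathfrak p}=R_{\mathfrak p}\otimes_R A$ is the central localization. $\operatorname{fdim}$ denotes flat dimension (possibly $\infty$). For a two-sided Noetherian ring $B$ and a finitely generated $B$-module $M$, $\operatorname{grade}_B M=\inf\{i\geq 0\mid \operatorname{Ext}_B^i(M,B)\neq 0\}$, with $\inf\emptyset=\infty$. For a simple $B$-module $S$, $I_B(S)$ is its injective envelope. For $n\ge 0$, $B$ is $n$-Gorenstein if, in a minimal injective coresolution $0\to B\to I^0(B)\to I^1(B)\to\cdots$ of the left module $B$, one has $\operatorname{fdim}_B I^\ell(B)\leq \ell$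 for every $0\leq \ell<n$. *)

(* Defs.v *)
From HB Require Import structures.
From mathcomp Require Import all_boot all_order all_algebra.
From mathcomp Require Import boolp classical_sets reals constructive_ereal.
From mathcomp Require Import ring.
Set Implicit Arguments.
Unset Strict Implicit.
Unset Printing Implicit Defensive.
Import Order.TTheory GRing.Theory Num.Theory.
Local Open Scope ring_scope.
Local Open Scope quotient_scope.

(* Zero rings must be allowed, since central localizations may vanish. Hence
   rings are [pzRingType]s. For the same reason algebras are not taken to be
   [algType]s, which in MathComp are non-trivial rings. *)

Record centralAlg (R : comPzRingType) := CentralAlg {
  alg_ring :> pzRingType;
  alg_map : {rmorphism R -> alg_ring};
  alg_mapC : forall (r : R) (a : alg_ring), alg_map r * a = a * alg_map r }.

Definition module_finite (R : comPzRingType) (A : centralAlg R) : Prop :=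
  exists (m : nat) (x : 'I_m -> A),
    forall a : A, exists c : 'I_m -> R, a = \sum_(i < m) alg_map A (c i) * x i.

(* MathComp's [prime_idealr] is restricted to [nzRingType]. *)
Record primeSpec (R : comPzRingType) := PrimeSpec {
  prime_pred :> {pred R};
  prime0 : 0 \in prime_pred;
  primeD : forall x y, x \in prime_pred -> y \in prime_pred ->
    x + y \in prime_pred;
  primeMl : forall r x, x \in prime_pred -> r * x \in prime_pred;
  prime1 : 1 \notin prime_pred;
  primeM : forall x y, x * y \in prime_pred ->
    x \in prime_pred \/ y \in prime_pred }.

Section CentralLocalization.
Variables (R : comPzRingType) (A : centralAlg R) (p : primeSpec R).

Definition denom := {s : R | s \notin p}.
Definition dval (s : denom) : R := sval s.

Lemma denomM_subproof (s t : denom) : dval s * dval t \notin p.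
Proof.
by apply/negP => /primeM[]; apply/negP; [apply: (valP s) | apply: (valP t)].
Qed.
Definition denomM (s t : denom) : denom :=
  exist (fun x => is_true (x \notin p)) _ (denomM_subproof s t).
Definition denom1 : denom := exist (fun x => is_true (x \notin p)) 1 (prime1 p).

Lemma dvalM s t : dval (denomM s t) = dval s * dval t. Proof. by []. Qed.
Lemma dval1 : dval denom1 = 1. Proof. by []. Qed.

Definition fracs : Type := A * denom.
HB.instance Definition _ := Choice.on fracs.

Local Notation "r *; a" := (alg_map A r * a) (at level 40).

Definition frac_equiv (x y : fracs) : bool :=
  `[< exists u : denom,
        dval u *; (dval y.2 *; x.1) = dval u *; (dval x.2 *; y.1) >].

Let scA r s (a : A) : r *; (s *; a) = (r * s) *; a.
Proof. by rewrite mulrA rmorphM. Qed.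
Let scAr r (a b : A) : a * (r *; b) = r *; (a * b).
Proof. by rewrite mulrA -alg_mapC mulrA. Qed.

Lemma frac_equiv_refl : reflexive frac_equiv.
Proof. by move=> x; apply/asboolP; exists denom1. Qed.

Lemma frac_equiv_sym : symmetric frac_equiv.
Proof.
by move=> x y; apply/asboolP/asboolP => -[u e]; exists u; rewrite e.
Qed.

Lemma frac_equiv_trans : transitive frac_equiv.
Proof.
move=> y x z /asboolP[u]; rewrite !scA => xy /asboolP[v]; rewrite !scA => yz.
apply/asboolP; exists (denomM (denomM u v) y.2); rewrite !scA !dvalM.
have -> : dval u * dval v * dval y.2 * dval z.2
  = (dval v * dval z.2) * (dval u * dval y.2) by ring.
rewrite -scA xy scA.
have -> : dval v * dval z.2 * (dval u * dval x.2)
  = (dval u * dval x.2) * (dval v * dval z.2) by ring.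
by rewrite -[LHS]scA yz scA; congr (_ *; _); ring.
Qed.

Canonical frac_equiv_equiv :=
  EquivRel frac_equiv frac_equiv_refl frac_equiv_sym frac_equiv_trans.

(* The ring of fractions of [A] at the central multiplicative set R \ p; it is
   identified with R_p (x)_R A in [tensor_central_loc_bij] below. *)
Definition central_loc : Type := {eq_quot frac_equiv}.
HB.instance Definition _ : EqQuotient _ frac_equiv central_loc :=
  EqQuotient.on central_loc.
HB.instance Definition _ := Choice.on central_loc.

Definition cfrac (a : A) (s : denom) : central_loc :=
  \pi_central_loc ((a, s) : fracs).

Lemma frac_eqP (a b : A) (s t : denom) :
  cfrac a s = cfrac b t <->
  exists u : denom, (dval u * dval t) *; a = (dval u * dval s) *; b.
Proof.
split=> [/eqmodP/asboolP[u] /= | [u e]].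
  by rewrite !scA; exists u.
by apply/eqmodP/asboolP; exists u; rewrite /= !scA.
Qed.

Lemma repr_frac x : cfrac (repr x).1 (repr x).2 = x.
Proof. by rewrite /cfrac -surjective_pairing reprK. Qed.

Lemma fracP (x : central_loc) : exists a s, x = cfrac a s.
Proof. by exists (repr x).1, (repr x).2; rewrite repr_frac. Qed.

Definition loc_add (x y : central_loc) : central_loc :=
  cfrac (dval (repr y).2 *; (repr x).1 + dval (repr x).2 *; (repr y).1)
       (denomM (repr x).2 (repr y).2).
Definition loc_mul (x y : central_loc) : central_loc :=
  cfrac ((repr x).1 * (repr y).1) (denomM (repr x).2 (repr y).2).
Definition loc_opp (x : central_loc) : central_loc :=
  cfrac (- (repr x).1) (repr x).2.

Lemma loc_addE a b s t : loc_add (cfrac a s) (cfrac b t) =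
  cfrac (dval t *; a + dval s *; b) (denomM s t).
Proof.
rewrite /loc_add.
move: (repr_frac (cfrac a s)) (repr_frac (cfrac b t)).
move: (repr (cfrac a s)) (repr (cfrac b t)) => [a' s'] [b' t'] /=.
move=> /frac_eqP[u ea] /frac_eqP[v eb].
apply/frac_eqP; exists (denomM u v); rewrite !dvalM !mulrDr !scA.
congr (_ + _).
  have -> : dval u * dval v * (dval s * dval t) * dval t'
    = (dval v * dval t * dval t') * (dval u * dval s) by ring.
  by rewrite -scA ea scA; congr (_ *; _); ring.
have -> : dval u * dval v * (dval s * dval t) * dval s'
  = (dval u * dval s * dval s') * (dval v * dval t) by ring.
by rewrite -scA eb scA; congr (_ *; _); ring.
Qed.

Lemma loc_mulE a b s t :
  loc_mul (cfrac a s) (cfrac b t) = cfrac (a * b) (denomM s t).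
Proof.
rewrite /loc_mul.
move: (repr_frac (cfrac a s)) (repr_frac (cfrac b t)).
move: (repr (cfrac a s)) (repr (cfrac b t)) => [a' s'] [b' t'] /=.
move=> /frac_eqP[u ea] /frac_eqP[v eb].
apply/frac_eqP; exists (denomM u v); rewrite !dvalM.
have -> : dval u * dval v * (dval s * dval t)
  = (dval v * dval t) * (dval u * dval s) by ring.
have -> r q (x y : A) : (r * q) *; (x * y) = (q *; x) * (r *; y).
  by rewrite scAr -scA [_ *; (x * y)]mulrA.
rewrite ea eb scAr -[_ *; a * b]mulrA !scA.
by congr (_ *; _); ring.
Qed.

Lemma loc_oppE a s : loc_opp (cfrac a s) = cfrac (- a) s.
Proof.
rewrite /loc_opp; move: (repr_frac (cfrac a s)).
move: (repr (cfrac a s)) => [a' s'] /=.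
by move=> /frac_eqP[u ea]; apply/frac_eqP; exists u; rewrite !mulrN ea.
Qed.

Lemma frac_ext (a b : A) (s t : denom) :
  dval t *; a = dval s *; b -> cfrac a s = cfrac b t.
Proof. by move=> e; apply/frac_eqP; exists denom1; rewrite dval1 !mul1r. Qed.

Lemma loc_addA : associative loc_add.
Proof.
move=> x y z; have [a [s ->]] := fracP x; have [b [t ->]] := fracP y.
have [c [u ->]] := fracP z; rewrite !loc_addE; apply: frac_ext.
rewrite !dvalM !mulrDr !scA -addrA.
by congr (_ *; _ + (_ *; _ + _ *; _)); ring.
Qed.

Lemma loc_addC : commutative loc_add.
Proof.
move=> x y; have [a [s ->]] := fracP x; have [b [t ->]] := fracP y.
rewrite !loc_addE; apply: frac_ext; rewrite addrC !dvalM.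
by congr (_ *; _); rewrite mulrC.
Qed.

Lemma loc_add0 : left_id (cfrac 0 denom1) loc_add.
Proof.
move=> x; have [a [s ->]] := fracP x; rewrite loc_addE; apply: frac_ext.
by rewrite mulr0 add0r scA !dvalM dval1 mulr1 mul1r.
Qed.

Lemma loc_addN : left_inverse (cfrac 0 denom1) loc_opp loc_add.
Proof.
move=> x; have [a [s ->]] := fracP x; rewrite loc_oppE loc_addE.
by apply: frac_ext; rewrite mulrN addNr !mulr0.
Qed.

HB.instance Definition _ :=
  GRing.isZmodule.Build central_loc loc_addA loc_addC loc_add0 loc_addN.

Lemma loc_mulA : associative loc_mul.
Proof.
move=> x y z; have [a [s ->]] := fracP x; have [b [t ->]] := fracP y.
have [c [u ->]] := fracP z; rewrite !loc_mulE; apply: frac_ext.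
by rewrite !dvalM !mulrA.
Qed.

Lemma loc_mul1 : left_id (cfrac 1 denom1) loc_mul.
Proof.
move=> x; have [a [s ->]] := fracP x; rewrite loc_mulE; apply: frac_ext.
by rewrite dvalM dval1 !mul1r.
Qed.

Lemma loc_mulr1 : right_id (cfrac 1 denom1) loc_mul.
Proof.
move=> x; have [a [s ->]] := fracP x; rewrite loc_mulE; apply: frac_ext.
by rewrite dvalM dval1 !mulr1.
Qed.

Lemma loc_mulDl : left_distributive loc_mul loc_add.
Proof.
move=> x y z; have [a [s ->]] := fracP x; have [b [t ->]] := fracP y.
have [c [u ->]] := fracP z; rewrite loc_addE !loc_mulE loc_addE.
apply: frac_ext; rewrite !dvalM mulrDl !mulrDr.
rewrite -[_ *; a * c]mulrA -[_ *; b * c]mulrA !scA.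
by congr (_ *; _ + _ *; _); ring.
Qed.

Lemma loc_mulDr : right_distributive loc_mul loc_add.
Proof.
move=> x y z; have [a [s ->]] := fracP x; have [b [t ->]] := fracP y.
have [c [u ->]] := fracP z; rewrite loc_addE !loc_mulE loc_addE.
apply: frac_ext; rewrite !dvalM [a * (_ + _)]mulrDr !scAr !mulrDr !scA.
by congr (_ *; _ + _ *; _); ring.
Qed.

HB.instance Definition _ := GRing.Zmodule_isPzRing.Build central_loc
  loc_mulA loc_mul1 loc_mulr1 loc_mulDl loc_mulDr.

Lemma fracD a b s t :
  cfrac a s + cfrac b t = cfrac (dval t *; a + dval s *; b) (denomM s t).
Proof. exact: loc_addE. Qed.

Lemma fracM a b s t : cfrac a s * cfrac b t = cfrac (a * b) (denomM s t).
Proof. exact: loc_mulE. Qed.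

Lemma frac0 s : cfrac 0 s = 0.
Proof. by apply: frac_ext; rewrite !mulr0. Qed.

Lemma frac_eq0 a s : cfrac a s = 0 <-> exists u : denom, dval u *; a = 0.
Proof.
rewrite -[0 in X in X <-> _](frac0 denom1) frac_eqP.
by split=> -[u]; rewrite ?mulr0 ?dval1 ?mulr1 => e; exists u;
  rewrite ?mulr0 ?dval1 ?mulr1.
Qed.

End CentralLocalization.

Section Tensor.
Variables (B : pzRingType).

(* A right [B]-module is a left module over the opposite ring [B^c]: for
   [x : N], the term [b *: x] is x.b. A formal sum of pure tensors is a
   sequence of pairs. *)
Section Def.
Variables (N : lmodType B^c) (M : lmodType B).

Inductive tensor_rel : seq (N * M) -> seq (N * M) -> Prop :=
| tr_refl s : tensor_rel s s
| tr_sym s t : tensor_rel s t -> tensor_rel t s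
| tr_trans s t u : tensor_rel s t -> tensor_rel t u -> tensor_rel s u
| tr_cat s s' t t' :
    tensor_rel s s' -> tensor_rel t t' -> tensor_rel (s ++ t) (s' ++ t')
| tr_catC s t : tensor_rel (s ++ t) (t ++ s)
| tr_0l y : tensor_rel [:: (0, y)] [::]
| tr_Dl x x' y : tensor_rel [:: (x + x', y)] [:: (x, y); (x', y)]
| tr_Dr x y y' : tensor_rel [:: (x, y + y')] [:: (x, y); (x, y')]
| tr_Z x (b : B) y : tensor_rel [:: ((b : B^c) *: x, y)] [:: (x, b *: y)].

Definition tensor_equiv (s t : seq (N * M)) : bool := `[< tensor_rel s t >].

Lemma tensor_equiv_refl : reflexive tensor_equiv.
Proof. by move=> s; apply/asboolP; apply: tr_refl. Qed.

Lemma tensor_equiv_sym : symmetric tensor_equiv.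
Proof. by move=> s t; apply/asboolP/asboolP; apply: tr_sym. Qed.

Lemma tensor_equiv_trans : transitive tensor_equiv.
Proof.
by move=> t s u /asboolP st /asboolP tu; apply/asboolP; apply: tr_trans tu.
Qed.

Canonical tensor_equiv_equiv :=
  EquivRel tensor_equiv tensor_equiv_refl tensor_equiv_sym tensor_equiv_trans.

Definition tensor : Type := {eq_quot tensor_equiv}.
HB.instance Definition _ : EqQuotient _ tensor_equiv tensor :=
  EqQuotient.on tensor.
HB.instance Definition _ := Choice.on tensor.

Definition tsum (s : seq (N * M)) : tensor := \pi_tensor s.

Lemma tsum_eqP s t : tsum s = tsum t <-> tensor_rel s t.
Proof. by split=> [/eqmodP/asboolP | st]; last exact/eqmodP/asboolP. Qed.

Lemma tsumK (x : tensor) : tsum (repr x) = x.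
Proof. exact: reprK. Qed.

Definition toppseq (s : seq (N * M)) := [seq (- x.1, x.2) | x <- s].

Lemma tensor_rel_opp s t :
  tensor_rel s t -> tensor_rel (toppseq s) (toppseq t).
Proof.
elim=> {s t} /=.
- by move=> s; apply: tr_refl.
- by move=> s t _; apply: tr_sym.
- by move=> s t u _ st _; apply: tr_trans st.
- by move=> s s' t t' _ h1 _ h2; rewrite /toppseq !map_cat; apply: tr_cat.
- by move=> s t; rewrite /toppseq !map_cat; apply: tr_catC.
- by move=> y; rewrite oppr0; apply: tr_0l.
- by move=> x x' y; rewrite opprD; apply: tr_Dl.
- by move=> x y y'; apply: tr_Dr.
- by move=> x b y; rewrite -scalerN; apply: tr_Z.
Qed.

Definition tadd (x y : tensor) : tensor := tsum (repr x ++ repr y).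
Definition topp (x : tensor) : tensor := tsum (toppseq (repr x)).

Lemma taddE s t : tadd (tsum s) (tsum t) = tsum (s ++ t).
Proof. by apply/tsum_eqP/tr_cat; apply/tsum_eqP; rewrite tsumK. Qed.

Lemma toppE s : topp (tsum s) = tsum (toppseq s).
Proof. by apply/tsum_eqP/tensor_rel_opp/tsum_eqP; rewrite tsumK. Qed.

Lemma taddA : associative tadd.
Proof.
move=> x y z; rewrite -(tsumK x) -(tsumK y) -(tsumK z).
by rewrite !taddE catA.
Qed.

Lemma taddC : commutative tadd.
Proof.
move=> x y; rewrite -(tsumK x) -(tsumK y) !taddE.
by apply/tsum_eqP/tr_catC.
Qed.

Lemma tadd0 : left_id (tsum [::]) tadd.
Proof. by move=> x; rewrite -(tsumK x) taddE. Qed.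

Lemma taddN : left_inverse (tsum [::]) topp tadd.
Proof.
move=> x; rewrite -(tsumK x) toppE; elim: (repr x) => [|[a b] s ih].
  by rewrite taddE.
have cons_tsum c u : tsum (c :: u) = tadd (tsum [:: c]) (tsum u).
  by rewrite taddE.
rewrite /= cons_tsum [tsum ((a, b) :: s)]cons_tsum taddA.
rewrite [tadd (tadd _ _) (tsum [:: (a, b)])]taddC !taddA -taddA ih.
rewrite taddE [tadd _ (tsum [::])]taddC tadd0; apply/tsum_eqP.
apply: (tr_trans (tr_sym (tr_Dl a (- a) b))).
by rewrite addrN; apply: tr_0l.
Qed.

HB.instance Definition _ :=
  GRing.isZmodule.Build tensor taddA taddC tadd0 taddN.

Definition tens (x : N) (y : M) : tensor := tsum [:: (x, y)].

Lemma tsumE s : tsum s = \sum_(x <- s) tens x.1 x.2.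
Proof.
elim: s => [|[a b] s ih]; first by rewrite big_nil.
by rewrite big_cons -ih /tens -[RHS]/(tadd _ _) taddE.
Qed.

Lemma tensP (x : tensor) :
  exists s : seq (N * M), x = \sum_(z <- s) tens z.1 z.2.
Proof. by exists (repr x); rewrite -tsumE tsumK. Qed.

Lemma tensDl x x' y : tens (x + x') y = tens x y + tens x' y.
Proof. by rewrite -[RHS]/(tadd _ _) taddE; apply/tsum_eqP/tr_Dl. Qed.

Lemma tensDr x y y' : tens x (y + y') = tens x y + tens x y'.
Proof. by rewrite -[RHS]/(tadd _ _) taddE; apply/tsum_eqP/tr_Dr. Qed.

Lemma tensZ x (b : B) y : tens ((b : B^c) *: x) y = tens x (b *: y).
Proof. exact/tsum_eqP/tr_Z. Qed.

Section Lift.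
Variables (G : zmodType) (f : N -> M -> G).
Hypothesis fDl : forall x x' y, f (x + x') y = f x y + f x' y.
Hypothesis fDr : forall x y y', f x (y + y') = f x y + f x y'.
Hypothesis fZ : forall x (b : B) y, f ((b : B^c) *: x) y = f x (b *: y).

Definition tensor_lift (x : tensor) : G := \sum_(z <- repr x) f z.1 z.2.

Lemma tensor_lift_sum s : tensor_lift (tsum s) = \sum_(z <- s) f z.1 z.2.
Proof.
rewrite /tensor_lift; have /tsum_eqP := tsumK (tsum s).
move: (repr _) => t; elim=> {s t} //=.
- by move=> s t u _ -> _ ->.
- by move=> s s' t t' _ e1 _ e2; rewrite !big_cat e1 e2.
- by move=> s t; rewrite !big_cat /= addrC.
- move=> y; rewrite big_seq1 big_nil /=.
  by apply: (addrI (f 0 y)); rewrite -fDl !addr0.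
- by move=> x x' y; rewrite !big_cons big_nil /= fDl !addr0.
- by move=> x y y'; rewrite !big_cons big_nil /= fDr !addr0.
- by move=> x b y; rewrite !big_seq1 /= fZ.
Qed.

Lemma tensor_lift_tens x y : tensor_lift (tens x y) = f x y.
Proof. by rewrite tensor_lift_sum big_seq1. Qed.

Lemma tensor_liftD x y : tensor_lift (x + y) = tensor_lift x + tensor_lift y.
Proof.
rewrite -{1}(tsumK x) -{1}(tsumK y) -[tsum _ + _]/(tadd _ _) taddE.
by rewrite tensor_lift_sum big_cat.
Qed.

End Lift.
End Def.

(* f (x)_B M *)
Definition tensor_map (N N' : lmodType B^c) (f : {linear N -> N'})
    (M : lmodType B) : tensor N M -> tensor N' M :=
  tensor_lift (fun x y => tens (f x) y).

Lemma tensor_map_tens (N N' : lmodType B^c) (f : {linear N -> N'})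
    (M : lmodType B) x y : @tensor_map N N' f M (tens x y) = tens (f x) y.
Proof.
apply: tensor_lift_tens => [a b c|a b c|a b c].
- by rewrite linearD tensDl.
- exact: tensDr.
- by rewrite linearZ tensZ.
Qed.

End Tensor.

Section CentralLocTensor.
Variables (R : comPzRingType) (A : centralAlg R) (p : primeSpec R).

Definition self_alg : centralAlg R := @CentralAlg R R idfun (@mulrC R).

(* R_p with its right R-module structure; [alg_mod] is A as an R-module. *)
Definition loc_rmod : Type := central_loc self_alg p.
HB.instance Definition _ := GRing.Zmodule.on loc_rmod.
Definition loc_rscale (r : R^c) (x : loc_rmod) : loc_rmod :=
  (x : central_loc self_alg p) * cfrac (r : self_alg) (denom1 p).

Fact loc_rscaleA r s x : loc_rscale r (loc_rscale s x) = loc_rscale (r * s) x.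
Proof.
rewrite /loc_rscale -mulrA fracM; congr (_ * _).
by apply: frac_ext; rewrite dvalM dval1 mul1r.
Qed.
Fact loc_rscale1 : left_id 1 loc_rscale.
Proof. by move=> x; apply: mulr1. Qed.
Fact loc_rscaleDr : right_distributive loc_rscale +%R.
Proof. by move=> r x y; rewrite /loc_rscale mulrDl. Qed.
Fact loc_rscaleDl x : {morph loc_rscale^~ x : r s / r + s}.
Proof.
move=> r s; rewrite /loc_rscale -mulrDr fracD; congr (_ * _).
by apply: frac_ext; rewrite dvalM !dval1 !rmorph1 !mul1r.
Qed.
HB.instance Definition _ := GRing.Zmodule_isLmodule.Build R^c loc_rmod
  loc_rscaleA loc_rscale1 loc_rscaleDr loc_rscaleDl.

Definition alg_mod : Type := A.
HB.instance Definition _ := GRing.Zmodule.on alg_mod.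
Definition alg_scale (r : R) (a : alg_mod) : alg_mod := alg_map A r * (a : A).
Fact alg_scaleA r s a : alg_scale r (alg_scale s a) = alg_scale (r * s) a.
Proof. by rewrite /alg_scale rmorphM mulrA. Qed.
Fact alg_scale1 : left_id 1 alg_scale.
Proof. by move=> x; rewrite /alg_scale rmorph1 mul1r. Qed.
Fact alg_scaleDr : right_distributive alg_scale +%R.
Proof. by move=> r x y; rewrite /alg_scale mulrDr. Qed.
Fact alg_scaleDl a : {morph alg_scale^~ a : r s / r + s}.
Proof. by move=> r s; rewrite /alg_scale rmorphD mulrDl. Qed.
HB.instance Definition _ := GRing.Zmodule_isLmodule.Build R alg_mod
  alg_scaleA alg_scale1 alg_scaleDr alg_scaleDl.

Local Notation Rp := loc_rmod.
Local Notation Ap := (central_loc A p).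

(* The ring map R_p -> A_p *)
Definition loc_map (x : Rp) : Ap :=
  cfrac (alg_map A (repr (x : central_loc self_alg p)).1)
       (repr (x : central_loc self_alg p)).2.

Lemma loc_mapE (r : self_alg) (s : denom p) :
  loc_map (cfrac r s) = cfrac (alg_map A r) s.
Proof.
rewrite /loc_map; move: (repr_frac (cfrac r s)).
move: (repr (cfrac r s)) => [r' s'] /= /frac_eqP[u /= e].
by apply/frac_eqP; exists u; rewrite -!rmorphM e.
Qed.

Lemma loc_mapD (x y : Rp) : loc_map (x + y) = loc_map x + loc_map y.
Proof.
have [r [s ->]] := fracP x; have [r' [s' ->]] := fracP y.
rewrite -[_ + _]/((_ : central_loc self_alg p) + _) fracD !loc_mapE fracD.
by rewrite rmorphD !rmorphM.
Qed.

Lemma loc_rscaleE (t : R) (r : self_alg) (s : denom p) :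
  (t : R^c) *: (cfrac r s : Rp) = cfrac (r * t : self_alg) s.
Proof.
rewrite -[LHS]/(cfrac r s * cfrac (t : self_alg) (denom1 p)) fracM.
by apply: frac_ext; rewrite dvalM dval1 mulr1.
Qed.

Definition loc_pair (x : Rp) (a : alg_mod) : Ap :=
  loc_map x * cfrac (a : A) (denom1 p).

Lemma loc_pairDl x y a : loc_pair (x + y) a = loc_pair x a + loc_pair y a.
Proof. by rewrite /loc_pair loc_mapD mulrDl. Qed.

Lemma loc_pairDr x a b : loc_pair x (a + b) = loc_pair x a + loc_pair x b.
Proof.
rewrite /loc_pair -mulrDr fracD; congr (_ * _).
by apply: frac_ext; rewrite dvalM !dval1 ?mul1r !rmorph1 !mul1r.
Qed.

Lemma loc_pairZ x (t : R) a :
  loc_pair ((t : R^c) *: x) a = loc_pair x (t *: a).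
Proof.
have [r [s ->]] := fracP x; rewrite /loc_pair.
rewrite loc_rscaleE !loc_mapE !fracM -[t *: a]/(alg_map A t * (a : A)).
by rewrite rmorphM mulrA.
Qed.

Definition tensor_to_loc : tensor Rp alg_mod -> Ap := tensor_lift loc_pair.

Lemma tensor_to_loc_tens (r : self_alg) (s : denom p) (a : A) :
  tensor_to_loc (tens (cfrac r s : Rp) (a : alg_mod)) =
  cfrac (alg_map A r * a) s.
Proof.
rewrite /tensor_to_loc tensor_lift_tens;
  [|exact: loc_pairDl|exact: loc_pairDr|exact: loc_pairZ].
rewrite /loc_pair loc_mapE fracM.
by apply: frac_ext; rewrite dvalM dval1 mulr1.
Qed.

Lemma tensor_to_locD x y :
  tensor_to_loc (x + y) = tensor_to_loc x + tensor_to_loc y.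
Proof.
exact: (tensor_liftD loc_pairDl loc_pairDr loc_pairZ).
Qed.

Lemma tens_fracZ (r t : self_alg) (s : denom p) (a : alg_mod) :
  tens (cfrac (r * t) s : Rp) a = tens (cfrac r s : Rp) (t *: a).
Proof. by rewrite -tensZ loc_rscaleE. Qed.

Lemma tens_pure (x : tensor Rp alg_mod) :
  exists (s : denom p) (a : alg_mod), x = tens (cfrac (1 : self_alg) s : Rp) a.
Proof.
have [l ->] := tensP x; elim: l => [|[y b] l [s [a e]]].
  exists (denom1 p), 0; rewrite big_nil.
  by apply: (addrI (tens (cfrac (1 : self_alg) (denom1 p) : Rp) (0 : alg_mod)));
    rewrite -tensDr !addr0.
rewrite big_cons e /=; have [r [t ->]] := fracP y.
exists (denomM s t), ((dval s * r) *: b + dval t *: a).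
rewrite tensDr -!tens_fracZ !mul1r; congr (tens _ _ + tens _ _).
  by apply: frac_ext; rewrite dvalM /= mulrCA mulrA mulrC mulrA.
by apply: frac_ext; rewrite dvalM /= mulr1.
Qed.

Lemma tensor_to_loc_inj : injective tensor_to_loc.
Proof.
have h x : tensor_to_loc x = 0 -> x = 0.
  have [s [a ->]] := tens_pure x.
  rewrite tensor_to_loc_tens rmorph1 mul1r => /frac_eq0[u ua].
  have -> : cfrac (1 : self_alg) s = cfrac (1 * dval u : self_alg) (denomM u s).
    by apply: frac_ext; rewrite dvalM /= mul1r mulr1 mulrC.
  rewrite tens_fracZ -[_ *: _]/(alg_map A (dval u) * a) ua.
  set q := (cfrac _ _ : Rp).
  by apply: (addrI (tens q (0 : alg_mod))); rewrite -tensDr !addr0.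
move=> x y e; apply/eqP; rewrite -subr_eq0; apply/eqP/h.
by apply: (addIr (tensor_to_loc y)); rewrite -tensor_to_locD subrK add0r.
Qed.

(* R_p (x)_R A = A_p, via r/s (x) a |-> (ra)/s. *)
Lemma tensor_central_loc_bij : bijective tensor_to_loc.
Proof.
pose g (z : Ap) : tensor Rp alg_mod :=
  tens (cfrac (1 : self_alg) (repr z).2 : Rp) ((repr z).1 : alg_mod).
have fg : cancel g tensor_to_loc.
  by move=> z; rewrite tensor_to_loc_tens rmorph1 mul1r repr_frac.
by exists g => // x; apply: tensor_to_loc_inj; rewrite fg.
Qed.

Lemma tensor_to_locM (r r' : self_alg) (s s' : denom p) (a a' : A) :
  tensor_to_loc (tens (cfrac r s : Rp) (a : alg_mod)) *
  tensor_to_loc (tens (cfrac r' s' : Rp) (a' : alg_mod)) =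
  tensor_to_loc
    (tens ((cfrac r s * cfrac r' s' : central_loc self_alg p) : Rp)
          ((a * a' : A) : alg_mod)).
Proof.
rewrite [cfrac r s * _]fracM !tensor_to_loc_tens fracM; congr cfrac.
by rewrite rmorphM -!mulrA; congr (_ * _); rewrite !mulrA alg_mapC.
Qed.

End CentralLocTensor.

Section Modules.
Variable B : pzRingType.
Implicit Types M N I : lmodType B.

Definition fin_gen M (S : {pred M}) : Prop :=
  exists (m : nat) (x : 'I_m -> M), (forall i, x i \in S) /\
    forall y, y \in S -> exists c : 'I_m -> B, y = \sum_(i < m) c i *: x i.

Definition simple_module M : Prop :=
  (exists x : M, x != 0) /\
  forall S : {pred M}, submod_closed S -> S =i pred1 0 \/ S =i predT.

Definition projective M : Prop :=
  forall (X Y : lmodType B) (g : {linear X -> Y}) (h : {linear M -> Y}),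
    (forall y, exists x, g x = y) ->
    exists k : {linear M -> X}, forall z, g (k z) = h z.

Definition injective_module M : Prop :=
  forall (X Y : lmodType B) (g : {linear X -> Y}) (h : {linear X -> M}),
    injective g ->
    exists k : {linear Y -> M}, forall x, k (g x) = h x.

Definition flat M : Prop :=
  forall (N N' : lmodType B^c) (f : {linear N -> N'}),
    injective f -> injective (@tensor_map B N N' f M).

(* The image of [f] is an essential submodule of [N]. *)
Definition essential_image M N (f : {linear M -> N}) : Prop :=
  forall S : {pred N}, submod_closed S ->
    (forall x, f x \in S -> f x = 0) -> forall y, y \in S -> y = 0.

Definition injective_envelope M I (f : {linear M -> I}) : Prop :=
  [/\ injective_module I, injective f & essential_image f].

Record left_resolution M := LeftResolution {
  lres :> nat -> lmodType B;
  lres_d : forall i, {linear lres i.+1 -> lres i};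
  lres_aug : {linear lres 0 -> M};
  lres_aug_surj : forall y, exists x, lres_aug x = y;
  lres_exact0 : forall x, lres_aug x = 0 <-> exists y, lres_d 0 y = x;
  lres_exact : forall i x, lres_d i x = 0 <-> exists y, lres_d i.+1 y = x }.

Record right_resolution M := RightResolution {
  rres :> nat -> lmodType B;
  rres_d : forall i, {linear rres i -> rres i.+1};
  rres_aug : {linear M -> rres 0};
  rres_aug_inj : injective rres_aug;
  rres_exact0 : forall x, rres_d 0 x = 0 <-> exists y, rres_aug y = x;
  rres_exact : forall i x, rres_d i.+1 x = 0 <-> exists y, rres_d i y = x }.

(* Minimality: I^0 is an injective envelope of M, and I^(l+1) is one of
   Im (I^l -> I^(l+1)). *)
Definition minimal_injective M (I : right_resolution M) : Prop :=
  [/\ forall l, injective_module (I l), essential_image (rres_aug I) &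
      forall l, essential_image (rres_d I l)].

(* Degree [i] cocycles and coboundaries of the complex Hom(P, N). *)
Definition Hom_cocycle M (P : left_resolution M) N i
    (f : {linear P i -> N}) : Prop :=
  forall x, f (lres_d P i x) = 0.

Definition Hom_coboundary M (P : left_resolution M) N i :
    {linear P i -> N} -> Prop :=
  match i with
  | 0 => fun f => forall x, f x = 0
  | j.+1 => fun f =>
      exists g : {linear P j -> N}, forall x, f x = g (lres_d P j x)
  end.

(* Ext^i(M, N) <> 0: the i-th cohomology of Hom(P, N) does not vanish. It does
   not depend on the projective resolution P of M. *)
Definition Ext_neq0 i M N : Prop :=
  exists P : left_resolution M, (forall j, projective (P j)) /\
    exists f : {linear P i -> N}, Hom_cocycle f /\ ~ Hom_coboundary f.

Definition has_flat_resolution M (d : nat) : Prop :=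
  exists P : left_resolution M, (forall j, flat (P j)) /\
    forall j, (d < j)%N -> forall x : P j, x = 0.

End Modules.

(* [\bar int] stands for the extended naturals; [inf_nat set0 = +oo]. *)
Definition inf_nat (P : nat -> Prop) : \bar int :=
  match pselect (exists k, `[< P k >]) with
  | left exP => ((ex_minn exP)%:Z)%:E
  | right _ => +oo%E
  end.

Lemma inf_nat_leP (P : nat -> Prop) (n : nat) :
  (inf_nat P <= (n%:Z)%:E)%E <-> exists2 k, (k <= n)%N & P k.
Proof.
rewrite /inf_nat; case: pselect => [exP | nP].
  case: ex_minnP => m /asboolP Pm min_m; rewrite lee_fin lez_nat.
  by split=> [mn|[k kn /asboolP/min_m mk]]; [exists m | exact: leq_trans kn].
by split=> // -[k _ Pk]; case: nP; exists k; apply/asboolP.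
Qed.

Definition fdim (B : pzRingType) (M : lmodType B) : \bar int :=
  inf_nat (has_flat_resolution M).

Definition grade (B : pzRingType) (M : lmodType B) : \bar int :=
  inf_nat (fun i => Ext_neq0 i M B^o).

(* A minimal injective coresolution exists and is unique up to isomorphism, so
   [exists] could be replaced by a universal quantifier. *)
Definition Gorenstein (n : nat) (B : pzRingType) : Prop :=
  exists I : right_resolution B^o, minimal_injective I /\
    forall l, (l < n)%N -> (fdim (I l) <= (l%:Z)%:E)%E.

Definition noetherian (R : comPzRingType) : Prop :=
  forall I : {pred R^o}, submod_closed I -> fin_gen I.

(* Main.v *)
(* An injective A-module is assembled from the injective hulls I(S) over A_p of
   the simple A_p-modules S, and I(S) occurs in the l-th term of the minimal
   injective coresolution of A exactly when Ext^l(S, A_p) is nonzero; so A is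
   n-Gorenstein iff fdim I(S) <= l whenever l < n and Ext^l(S, A_p) <> 0, i.e. iff
   fdim I(S) <= grade S whenever grade S < n. This is (2).

   For (3) it remains to see that grade S <= fdim I(S) always. If Ext^i(S, A_p)
   vanishes for all i <= d, dualizing a finite free resolution of S shows that its
   presentation matrix is a d-th syzygy of right modules, and fdim I(S) <= d
   would give Hom(S, I(S)) = 0.

   Since A and A_p are Noetherian on both sides, flat dimension and injectivity
   are expressed by solvability of finite systems of linear equations, which makes
   them easy to localize and compatible with unions of chains. The decomposition
   of injectives is replaced by Zorn's lemma: a maximal injective submodule of flat
   dimension <= l is a direct summand, and a nonzero complement would contain some
   I(S). *)

Require Import Defs.
From HB Require Import structures.
From mathcomp Require Import all_boot all_order all_algebra.
From mathcomp Require Import boolp classical_sets reals constructive_ereal.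
From mathcomp Require Import functions ring.
Set Implicit Arguments.
Unset Strict Implicit.
Unset Printing Implicit Defensive.
Import Order.TTheory GRing.Theory Num.Theory.
Local Open Scope ring_scope.

(** * Submodules, chains and finite generation *)

(** Simple modules and their envelopes live over the rings A_p, whereas an A-module has to be built
    from them. An A_p-module is therefore also read over A on the same carrier, which keeps it
    injective and does not raise its flat dimension. Conversely, localization preserves injectives,
    essential maps and bounds on flat dimension, so a minimal coresolution of A localizes to a
    minimal one.

    The complement in J of a maximal submodule as above need not contain a simple module; only its
    localization at a suitable p does. That simple module T0 is represented by a submodule P0 of J
    on which J -> J_p is injective. Through P0 one gets a partial map from I(T0) to J, and
    injectivity of J extends it.

    Ext is defined by projective resolutions, while the occurrence of I(S) in I^l means a nonzero
    map S -> I^l. The two agree because minimality makes all differentials of Hom(S, I) vanish for S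
    simple.

    Flatness, defined by tensor products, reaches matrices through duals: X is flat iff Hom_Z(X,
    Q/Z) is injective, and over a right Noetherian ring Baer's criterion makes the latter a
    condition on finite systems. *)

Section LinearOf.
Variables (B : pzRingType) (U V : lmodType B) (f : U -> V).

(** The proof of linearity is an argument, so that functions built inside a proof can be packaged as
    linear maps. *)
Definition linear_of (hf : linear f) : U -> V := f.

HB.instance Definition _ (hf : linear f) :=
  GRing.isLinear.Build B U V *:%R (linear_of hf) hf.

End LinearOf.

Section Submodules.
Variables (B : pzRingType) (M : lmodType B).
Implicit Types P Q : M -> Prop.

(** [Prop]-valued submodules are sets, as Zorn's lemma wants them; [to_pred] and [closed_submodP]
    connect them with the boolean submodules of the statement. *)
Definition submodP P :=
  P 0 /\ forall (a : B) x y, P x -> P y -> P (a *: x + y).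

Definition to_pred P : {pred M} := fun x => `[< P x >].

Lemma to_predE P x : (x \in to_pred P) = `[< P x >]. Proof. by []. Qed.

Lemma submodP_closed P : submodP P -> submod_closed (to_pred P).
Proof.
move=> [P0 PD]; split=> [|a x y]; first exact/asboolP.
by rewrite !to_predE => /asboolP Px /asboolP Py; apply/asboolP/PD.
Qed.

Lemma closed_submodP (S : {pred M}) :
  submod_closed S -> submodP (fun x => x \in S).
Proof. by case. Qed.

Section Closure.
Variables (P : M -> Prop) (hP : submodP P).

Lemma submod0 : P 0. Proof. by case: hP. Qed.

Lemma submodZD a x y : P x -> P y -> P (a *: x + y).
Proof. by case: hP => _; apply. Qed.

Lemma submodD x y : P x -> P y -> P (x + y).
Proof. by move=> Px Py; rewrite -(scale1r x); apply: submodZD. Qed.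

Lemma submodZ a x : P x -> P (a *: x).
Proof. by move=> Px; rewrite -[_ *: _]addr0; apply: submodZD submod0. Qed.

Lemma submodN x : P x -> P (- x).
Proof. by rewrite -scaleN1r; apply: submodZ. Qed.

Lemma submodB x y : P x -> P y -> P (x - y).
Proof. by move=> Px Py; apply/submodD/submodN. Qed.

Lemma submod_sum n (F : 'I_n -> M) : (forall i, P (F i)) -> P (\sum_i F i).
Proof. by move=> PF; elim/big_ind: _; [exact: submod0|exact: submodD|]. Qed.

Lemma submod_sumZ n (c : 'I_n -> B) (F : 'I_n -> M) :
  (forall i, P (F i)) -> P (\sum_i c i *: F i).
Proof. by move=> PF; apply: submod_sum => i; apply: submodZ. Qed.

End Closure.

Section Subtype.
Variables (S : {pred M}) (hS : submod_closed S).

Definition subm (_ : submod_closed S) : Type := {x : M | x \in S}.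
HB.instance Definition _ := [isSub of subm hS for @sval M (fun x => x \in S)].
HB.instance Definition _ := [Choice of subm hS by <:].
HB.instance Definition _ :=
  GRing.SubChoice_isSubLmodule.Build B M S (subm hS) hS.

End Subtype.

Definition submP P (hP : submodP P) : lmodType B := subm (submodP_closed hP).

Definition submP_val P (hP : submodP P) : {linear submP hP -> M} :=
  (val : subm (submodP_closed hP) -> M).

Section SubmP.
Variables (P : M -> Prop) (hP : submodP P).

Lemma submP_valP (x : submP hP) : P (submP_val hP x).
Proof. by case: x => x /= /asboolP. Qed.

Lemma submP_val_inj : injective (submP_val hP).
Proof. exact: val_inj. Qed.

Lemma submP_sur x : P x -> exists y, submP_val hP y = x.
Proof. by move=> /asboolP Px; exists (exist _ x Px). Qed.

Section Corestrict.
Variables (N : lmodType B) (f : {linear N -> M}) (fP : forall x, P (f x)).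

Definition submP_fun (x : N) : submP hP := exist _ (f x) (asboolT (fP x)).

Fact submP_fun_linear : linear submP_fun.
Proof. by move=> a x y; apply: submP_val_inj; rewrite linearP /= linearP. Qed.

Definition submP_corestr : {linear N -> submP hP} := linear_of submP_fun_linear.

Lemma submP_corestrE x : submP_val hP (submP_corestr x) = f x.
Proof. by []. Qed.

End Corestrict.
End SubmP.

Lemma submodP_I P Q : submodP P -> submodP Q -> submodP (fun x => P x /\ Q x).
Proof.
move=> hP hQ; split=> [|a x y [? ?] [? ?]]; first by split; apply: submod0.
by split; apply: submodZD.
Qed.

End Submodules.

Section LinearSubmodules.
Variables (B : pzRingType) (M N : lmodType B) (f : {linear M -> N}).

Lemma submodP_ker : submodP (fun x => f x = 0).
Proof.
by split=> [|a x y fx fy]; rewrite ?linear0 // linearP fx fy scaler0 addr0.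
Qed.

Lemma submodP_pre (P : N -> Prop) : submodP P -> submodP (fun x => P (f x)).
Proof.
move=> hP; split=> [|a x y Px Py]; rewrite ?linear0 ?linearP.
  exact: submod0 hP.
exact: submodZD.
Qed.

Lemma submodP_imP (P : M -> Prop) :
  submodP P -> submodP (fun y => exists2 x, P x & f x = y).
Proof.
move=> hP; split=> [|a _ _ [x Px <-] [y Py <-]].
  by exists 0; rewrite ?linear0 //; exact: submod0 hP.
by exists (a *: x + y); rewrite ?linearP //; apply: submodZD.
Qed.

Lemma submodP_im : submodP (fun y => exists x, f x = y).
Proof.
split=> [|a _ _ [x <-] [y <-]]; first by exists 0; rewrite linear0.
by exists (a *: x + y); rewrite linearP.
Qed.

Lemma linear_inj0 : (forall x, f x = 0 -> x = 0) -> injective f.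
Proof.
move=> f0 x y /eqP; rewrite -subr_eq0 -linearB => /eqP/f0/eqP.
by rewrite subr_eq0 => /eqP.
Qed.

Lemma linear_sumZ n (c : 'I_n -> B) (x : 'I_n -> M) :
  f (\sum_i c i *: x i) = \sum_i c i *: f (x i).
Proof. by rewrite linear_sum; apply: eq_bigr => i _; rewrite linearZ. Qed.

End LinearSubmodules.

Section ChainsAndMaximality.
Local Open Scope classical_set_scope.

(** [Zorn_bigcup] also takes the union of the empty chain. The empty set is therefore adjoined to
    the family, and [t0] shows that it is not maximal. *)
Lemma Zorn_above (T : Type) (P : set (set T)) (A0 : set T) (t0 : T) :
  A0 t0 -> P A0 ->
  (forall F : set (set T), F `<=` P -> F !=set0 -> total_on F subset ->
    P (\bigcup_(X in F) X)) ->
  exists A, [/\ P A, A0 `<=` A & forall B, P B -> A `<=` B -> B = A].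
Proof.
move=> A0t PA0 Pcup.
have [|A [[->|[PA A0A]] Amax]] :=
    @Zorn_bigcup T [set A | A = set0 \/ P A /\ A0 `<=` A].
- move=> F FP Ftot.
  have [[X [FX X0]]|noX] := pselect (exists X, F X /\ X <> set0).
    right; pose G := F `&` [set X | X <> set0].
    have -> : \bigcup_(X in F) X = \bigcup_(X in G) X.
      apply/seteqP; split=> t [Y FY Yt]; last by exists Y => //; case: FY.
      by exists Y => //; split=> // Y0; rewrite Y0 in Yt.
    split.
      apply: Pcup.
      - by move=> Y [FY Y0]; have [//|[]] := FP Y FY.
      - by exists X.
      - by move=> Y Z [FY _] [FZ _]; apply: Ftot.
    have [//|[_ A0X]] := FP X FX.
    by move=> t /A0X Xt; exists X.
  left; apply/seteqP; split=> // t [X FX Xt]; apply: noX; exists X; split=> //.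
  by move=> X0; rewrite X0 in Xt.
- have A0_gt0 : set0 `<` A0 by split=> // A0_sub; apply: (A0_sub t0).
  by case: (Amax A0 A0_gt0); right; split=> // t.
- exists A; split=> // C PC AC; apply/seteqP; split=> //.
  apply: contrapT => nCA; apply: (Amax C); first by split.
  by right; split=> //; apply: subset_trans AC.
Qed.

Lemma chain_finite (T : Type) (F : set (set T)) n (x : 'I_n -> T) :
  F !=set0 -> total_on F subset ->
  (forall i, exists2 X, F X & X (x i)) ->
  exists2 X, F X & forall i, X (x i).
Proof.
move=> [X0 FX0] Ftot; elim: n x => [|n ih] x Fx; first by exists X0 => // -[].
have [i|X FX Xx] := ih (fun i => x (lift ord0 i)); first exact: Fx.
have [Y FY Yx] := Fx ord0.
have [XY|YX] := Ftot X Y FX FY; [exists Y|exists X] => // i;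
  by case: (unliftP ord0 i) => [j ->|->]; auto.
Qed.

Lemma submodP_chain (B : pzRingType) (M : lmodType B) (F : set (set M)) :
  F !=set0 -> total_on F subset -> (forall X, F X -> submodP X) ->
  submodP (\bigcup_(X in F) X).
Proof.
move=> F0 Ftot Fs; split.
  by have [X FX] := F0; exists X => //; exact: submod0 (Fs X FX).
move=> a x y [X FX Xx] [Y FY Yy].
have [XY|YX] := Ftot X Y FX FY.
  by exists Y => //; apply: (submodZD (Fs _ FY)) => //; apply: XY.
by exists X => //; apply: (submodZD (Fs _ FX)) => //; apply: YX.
Qed.

End ChainsAndMaximality.

Section FinitelyGenerated.
Variable B : pzRingType.

Definition fgP (M : lmodType B) (P : M -> Prop) : Prop :=
  exists (m : nat) (x : 'I_m -> M), (forall i, P (x i)) /\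
    forall y, P y -> exists c : 'I_m -> B, y = \sum_(i < m) c i *: x i.

Lemma fgP_extension (M N : lmodType B) (f : {linear M -> N}) (Q : M -> Prop) :
  submodP Q -> fgP (fun y => exists2 x, Q x & f x = y) ->
  fgP (fun x => Q x /\ f x = 0) -> fgP Q.
Proof.
move=> hQ [m [y [Qy ygen]]] [k [z [Qz zgen]]].
have /choice[x xP] : forall i, exists x, Q x /\ f x = y i.
  by move=> i; have [x Qx fx] := Qy i; exists x.
exists (m + k)%N, (fun i : 'I_(m + k) =>
  match fintype.split i with inl a => x a | inr b => z b end).
split=> [i|w Qw].
  by case: fintype.split => [a|b]; [case: (xP a)|case: (Qz b)].
have [c fw] : exists c, f w = \sum_i c i *: y i by apply: ygen; exists w.
have [|d wd] := zgen (w - \sum_i c i *: x i).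
  split.
    apply: (submodB hQ) => //; apply: (submod_sumZ hQ) => i.
    by case: (xP i).
  rewrite linearB linear_sumZ /= fw; apply/eqP; rewrite subr_eq0; apply/eqP.
  by apply: eq_bigr => i _; have [_ ->] := xP i.
exists (fun i : 'I_(m + k) =>
  match fintype.split i with inl a => c a | inr b => d b end).
rewrite -[w](subrK (\sum_i c i *: x i)) wd addrC big_split_ord /=.
congr (_ + _); apply: eq_bigr => i _.
  by rewrite -[lshift k i]/(unsplit (inl i)) unsplitK.
by rewrite -[rshift m i]/(unsplit (inr i)) unsplitK.
Qed.

Lemma fgP_image (M N : lmodType B) (f : {linear M -> N}) (P : M -> Prop)
    (Q : N -> Prop) :
  fgP P -> (forall x, P x -> Q (f x)) ->
  (forall y, Q y -> exists2 x, P x & f x = y) -> fgP Q.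
Proof.
move=> [m [x [Px xgen]]] PQ QP; exists m, (fun i => f (x i)).
split=> [i|y /QP[w Pw <-]]; first exact: PQ.
by have [c ->] := xgen w Pw; exists c; rewrite linear_sumZ.
Qed.

Definition left_noetherian : Prop := forall I : {pred B^o}, submod_closed I -> fin_gen I.

Lemma left_noetherianP : left_noetherian -> forall P : B^o -> Prop, submodP P -> fgP P.
Proof.
move=> nB P hP; have [m [x [Px xgen]]] := nB _ (submodP_closed hP).
exists m, x; split=> [i|y Py]; first by have /asboolP := Px i.
by apply: xgen; apply/asboolP.
Qed.

Lemma fgP_rows n : left_noetherian -> forall P : 'rV[B]_n -> Prop, submodP P -> fgP P.
Proof.
move=> nB; elim: n => [|n ih] P hP.
  exists 0, (fun _ => 0); split=> [[]//|y _]; exists (fun _ => 0).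
  by rewrite big_ord0 [y]thinmx0.
have fl : linear (fun v : 'rV[B]_(1 + n) => v 0 (lshift n 0) : B^o).
  by move=> a u v; rewrite !mxE.
have gl : linear (fun v : 'rV[B]_n => (row_mx 0 v : 'rV[B]_(1 + n))).
  by move=> a u v; rewrite scale_row_mx add_row_mx scaler0 addr0.
pose f : {linear 'rV[B]_(1 + n) -> B^o} := linear_of fl.
pose g : {linear 'rV[B]_n -> 'rV[B]_(1 + n)} := linear_of gl.
apply: (fgP_extension (f := f)) => //; first exact/left_noetherianP/submodP_imP.
apply: (fgP_image (f := g) (ih _ (submodP_pre g hP))) => [v Pv|v [Pv fv]].
  by split=> //; rewrite /f /g /= /linear_of row_mxEl mxE.
have gv : g (rsubmx v) = v.
  rewrite -[RHS]hsubmxK /g /= /linear_of; congr row_mx.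
  by apply/matrixP => i j; rewrite [RHS]mxE mxE !ord1 -[LHS]fv.
by exists (rsubmx v); rewrite ?gv.
Qed.

Lemma row_syzygy m n (D : 'M[B]_(m, n)) : left_noetherian ->
  exists k (E : 'M[B]_(k, m)), E *m D = 0 /\
    forall v : 'rV_m, v *m D = 0 -> exists w : 'rV_k, v = w *m E.
Proof.
move=> nB; have hl : linear (fun v : 'rV[B]_m => v *m D).
  by move=> a u v; rewrite mulmxDl scalemxAl.
have [k [x [xD xgen]]] := fgP_rows nB (submodP_ker (linear_of hl)).
exists k, (\matrix_i x i); split.
  by apply/row_matrixP => i; rewrite row_mul rowK row0; apply: xD.
move=> v /xgen[c ->]; exists (\row_i c i); rewrite mulmx_sum_row.
by apply: eq_bigr => i _; rewrite rowK mxE.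
Qed.

Local Open Scope classical_set_scope.

(** The union of a chain is finitely generated, so one member already contains generators and equals
    it. The chain condition thus holds for an arbitrary family of submodules. *)
Lemma max_submod (M : lmodType B) (F : set (set M)) :
  (forall P : set M, submodP P -> fgP P) ->
  (forall P, F P -> submodP P) -> F !=set0 ->
  exists2 P, F P & forall Q, F Q -> P `<=` Q -> Q = P.
Proof.
move=> fgM Fs [P0 FP0].
have [|P [FP _ Pmax]] := @Zorn_above M F P0 0 (submod0 (Fs _ FP0)) FP0.
  move=> G GF G0 Gtot.
  have hG : submodP (\bigcup_(X in G) X).
    by apply: submodP_chain => // X /GF/Fs.
  have [m [x [Gx xgen]]] := fgM _ hG.
  have [X GX Xx] := chain_finite G0 Gtot Gx.
  suff -> : \bigcup_(X in G) X = X by apply: GF.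
  apply/seteqP; split=> [y /xgen[c ->]|y Xy]; last by exists X.
  by apply: submod_sumZ => //; apply/Fs/GF.
by exists P.
Qed.

End FinitelyGenerated.

Section ColumnExactness.
Variable B : pzRingType.

(** Exactness of B^k -> B^n -> B^m at the middle term, the matrices acting on columns as maps of
    free right modules. *)
Definition col_exact k n m (D' : 'M[B]_(n, k)) (D : 'M[B]_(m, n)) : Prop :=
  D *m D' = 0 /\
  forall c : 'cV_n, D *m c = 0 -> exists w : 'cV_k, c = D' *m w.

(** Transposition exchanges columns over B with rows over the opposite ring. *)
Lemma col_syzygy m n (D : 'M[B]_(m, n)) : left_noetherian B^c ->
  exists k (E : 'M[B]_(n, k)), col_exact E D.
Proof.
move=> /(@row_syzygy _ n m (D : 'M[B^c]_(m, n))^T) [k [E [ED Egen]]].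
exists k, (E^T : 'M[B^c]_(n, k)); split.
  apply: trmx_inj; rewrite trmx_mul_rev trmxK trmx0.
  exact: ED.
move=> c Dc; have [|w cw] := Egen (c : 'cV[B^c]_n)^T.
  have := congr1 trmx Dc; rewrite trmx_mul_rev trmx0; exact.
exists (w^T : 'cV[B^c]_k); apply: trmx_inj.
by rewrite trmx_mul_rev !trmxK.
Qed.

End ColumnExactness.

(** * Module-finite algebras are Noetherian on both sides *)

Section ModuleFinite.
Variables (R : comPzRingType) (A : centralAlg R).

Lemma fgP_alg : noetherian R -> module_finite A ->
  forall P : alg_mod A -> Prop, submodP P -> fgP P.
Proof.
move=> nR [m [x xgen]] P hP.
have fl : linear (fun v : 'rV[R]_m => \sum_i v 0 i *: (x i : alg_mod A)).
  move=> a u v; rewrite scaler_sumr -big_split /=; apply: eq_bigr => i _.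
  by rewrite !mxE scalerDl scalerA.
pose f : {linear 'rV[R]_m -> alg_mod A} := linear_of fl.
have := fgP_rows nR (submodP_pre f hP).
move=> /(fgP_image (f := f)); apply=> // y Py; have [c yc] := xgen y.
have fc : f (\row_i c i) = y.
  by rewrite yc; apply: eq_bigr => i _; rewrite mxE.
by exists (\row_i c i); rewrite ?fc.
Qed.

(** A left ideal is an R-submodule, and generators over R also generate over A. Centrality makes the
    same argument work for right ideals. *)
Lemma alg_lnoeth : noetherian R -> module_finite A -> left_noetherian A.
Proof.
move=> nR fA I hI.
have [|m [x [Ix xgen]]] := @fgP_alg nR fA (fun a => (a : A^o) \in I).
  split=> [|r a b aI bI]; first exact: submod0 (closed_submodP hI).
  exact: (submodZD (closed_submodP hI) (alg_map A r) aI bI).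
exists m, x; split=> // y /xgen[c ->]; exists (fun i => alg_map A (c i)).
by [].
Qed.

Lemma alg_rnoeth : noetherian R -> module_finite A -> left_noetherian A^c.
Proof.
move=> nR fA I hI.
have [|m [x [Ix xgen]]] := @fgP_alg nR fA (fun a => (a : (A^c)^o) \in I).
  split=> [|r a b aI bI]; first exact: submod0 (closed_submodP hI).
  rewrite -[r *: a]/(alg_map A r * (a : A)) alg_mapC.
  exact: (submodZD (closed_submodP hI) (alg_map A r : A^c) aI bI).
exists m, x; split=> // y /xgen[c ->]; exists (fun i => alg_map A (c i)).
by apply: eq_bigr => i _; rewrite -[LHS]/(alg_map A (c i) * (x i : A)) alg_mapC.
Qed.

End ModuleFinite.

(** * Baer's criterion *)

Section Injective.
Variable B : pzRingType.

(** A partial linear map from Y to M. Graphs make extension an inclusion of sets, so Zorn's lemma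
    applies directly. *)
Definition functional_graph (Y M : lmodType B) (G : Y * M -> Prop) : Prop :=
  submodP G /\ forall m, G (0, m) -> m = 0.

Definition baer (M : lmodType B) : Prop :=
  forall G : B^o * M -> Prop, functional_graph G ->
    exists x : M, forall (b : B) m, G (b, m) -> m = b *: x.

Lemma graph_linear (Y M : lmodType B) (G : Y * M -> Prop) a y m y' m' :
  functional_graph G -> G (y, m) -> G (y', m') -> G (a *: y + y', a *: m + m').
Proof. by move=> [hG _] Gym Gym'; apply: (submodZD hG a Gym Gym'). Qed.

Lemma graph_fun (Y M : lmodType B) (G : Y * M -> Prop) y m m' :
  functional_graph G -> G (y, m) -> G (y, m') -> m = m'.
Proof.
move=> hG Gm Gm'; have := graph_linear (-1) hG Gm Gm'.
rewrite !scaleN1r addNr => /(proj2 hG)/eqP.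
by rewrite addrC subr_eq0 eq_sym => /eqP.
Qed.

Lemma linear_graph_functional (X Y M : lmodType B) (g : {linear X -> Y})
    (h : {linear X -> M}) : (forall x, g x = 0 -> h x = 0) ->
  functional_graph (fun z : Y * M => exists x, g x = z.1 /\ h x = z.2).
Proof.
move=> gh; split; first split.
- by exists 0; rewrite !linear0.
- move=> a [y m] [y' m'] /= [x [<- <-]] [x' [<- <-]].
  by exists (a *: x + x'); rewrite !linearP.
- by move=> m /= [x [/gh -> ->]].
Qed.

(** The graph is a module embedded in Y by the first projection; the second projection extends along
    this embedding. *)
Lemma injective_graph_extends (Y M : lmodType B) (G : Y * M -> Prop) :
  injective_module M -> functional_graph G ->
  exists k : {linear Y -> M}, forall y m, G (y, m) -> k y = m.
Proof.
move=> injM hG; pose i := submP_val hG.1.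
pose g : {linear submP hG.1 -> Y} := (fst \o i : _ -> _).
pose h : {linear submP hG.1 -> M} := (snd \o i : _ -> _).
have [|k kg] := injM _ _ g h.
  apply: linear_inj0 => x gx0; apply: submP_val_inj; rewrite linear0.
  have := submP_valP x; rewrite -/i; move: gx0; rewrite /g /=.
  by case: (sval x) => u v /= -> /(hG.2) ->.
exists k => y m /(submP_sur hG.1)[x xE].
by have := kg x; rewrite /g /h /= (xE : sval x = _).
Qed.

Lemma injective_baer (M : lmodType B) : injective_module M -> baer M.
Proof.
move=> injM G /(injective_graph_extends injM)[k kG]; exists (k 1) => b m.
by move=> /kG <-; rewrite -{1}[b]mulr1; apply: (linearZ_LR k b 1).
Qed.

Local Open Scope classical_set_scope.

Lemma baer_graph_extends (Y M : lmodType B) (G : Y * M -> Prop) :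
  baer M -> functional_graph G ->
  exists k : {linear Y -> M}, forall y m, G (y, m) -> k y = m.
Proof.
move=> baerM hG; have G0 := submod0 hG.1.
have [|H [hH GH Hmax]] := @Zorn_above _ (@functional_graph Y M) G 0 G0 hG.
  move=> F hF F0 Ftot; split=> [|m [X FX]]; last exact: (hF X FX).2.
  by apply: submodP_chain => // X /hF[].
have Hdom y : exists m, H (y, m).
  (* The b with b y in the domain of [H] form a left ideal; the x that Baer's criterion gives for it
     is the value to assign to y. *)
  have [|x Hx] := baerM (fun z => H ((z.1 : B) *: y, z.2)).
    split; first split=> [|a [b m] [b' m'] /= Hb Hb'] /=.
    - by rewrite scale0r; apply: submod0 hH.1.
    - by rewrite scalerDl -scalerA; apply: (graph_linear a hH).
    - by move=> m /=; rewrite scale0r; apply: hH.2.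
  (* [K] extends [H] by y |-> x; it is single valued because [Hx] fixes the value at b y whenever b
     y is in the domain. *)
  pose K (z : Y * M) := exists u m (b : B),
    [/\ H (u, m), z.1 = u + b *: y & z.2 = m + b *: x].
  have hK : functional_graph K.
    split; first split.
    - by exists 0, 0, 0; rewrite !scale0r !addr0; split=> //; apply: submod0 hH.1.
    - move=> a [y1 m1] [y2 m2] [u [m [b [Hum /= -> ->]]]].
      move=> [u' [m' [b' [Hum' /= -> ->]]]].
      exists (a *: u + u'), (a *: m + m'), (a * b + b').
      split; first exact: graph_linear.
        by rewrite /= scalerDr scalerDl scalerA addrACA.
      by rewrite /= scalerDr scalerDl scalerA addrACA.
    - move=> m [u [m' [b [/= Hum e ->]]]].
      have uE : u = - b *: y.
        by apply/eqP; rewrite scaleNr -subr_eq0 opprK -e.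
      have -> : m' = - b *: x by apply: Hx; rewrite /= -uE.
      by rewrite scaleNr addNr.
  have KH : K = H.
    apply: Hmax => // -[u m] Hum; exists u, m, 0.
    by rewrite !scale0r !addr0.
  exists x; rewrite -KH; exists 0, 0, 1; rewrite !scale1r !add0r.
  by split=> //; apply: submod0 hH.1.
have [k kH] := choice Hdom.
have kl : linear k.
  by move=> a u v; apply: (graph_fun hH) (kH _) _; apply: graph_linear.
exists (linear_of kl) => y m /GH; apply: graph_fun hH _.
exact: kH.
Qed.

Lemma baer_injective (M : lmodType B) : baer M -> injective_module M.
Proof.
move=> baerM X Y g h injg.
have [|k kG] := baer_graph_extends baerM (linear_graph_functional (g := g) (h := h) _).
  by move=> x gx0; rewrite (injg x 0) ?linear0.
by exists k => x; apply: kG; exists x.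
Qed.

(* Baer's criterion for the submodule P and finitely generated left ideals: a map
   from the ideal generated by the a_i is a family of images m_i satisfying the
   relations of the a_i, and it extends to B when m_i = a_i x for some x. *)
Definition baer_fg (M : lmodType B) (P : M -> Prop) : Prop :=
  forall n (a : 'I_n -> B) (m : 'I_n -> M), (forall i, P (m i)) ->
    (forall c : 'I_n -> B, \sum_i c i * a i = 0 -> \sum_i c i *: m i = 0) ->
    exists2 x, P x & forall i, m i = a i *: x.

Lemma injective_baer_fg (M : lmodType B) :
  injective_module M -> baer_fg (fun _ : M => True).
Proof.
move=> /injective_baer baerM n a m _ am.
have [|x Hx] := baerM (fun z => exists c : 'I_n -> B,
  \sum_i c i * a i = z.1 /\ \sum_i c i *: m i = z.2).
  split; first split.
  - by exists (fun _ => 0); split; apply: big1 => i _; rewrite ?mul0r ?scale0r.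
  - move=> b [_ _] [_ _] [c [/= <- <-]] [c' [/= <- <-]].
    exists (fun i => b * c i + c' i); split=> /=.
      rewrite -[b *: _]/(b * _) mulr_sumr -big_split; apply: eq_bigr => i _.
      by rewrite mulrDl mulrA.
    rewrite scaler_sumr -big_split; apply: eq_bigr => i _.
    by rewrite scalerDl scalerA.
  - by move=> m0 [c [/= /am -> <-]].
exists x => // i; apply: Hx; exists (fun j => (j == i)%:R).
rewrite (bigD1 i) //= eqxx mul1r big1 ?addr0 => [|j /negPf ->]; last first.
  by rewrite mul0r.
rewrite (bigD1 i) //= eqxx scale1r big1 ?addr0 => [//|j /negPf ->].
by rewrite scale0r.
Qed.

Lemma baer_fg_injective (M : lmodType B) : left_noetherian B ->
  baer_fg (fun _ : M => True) -> injective_module M.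
Proof.
move=> nB bM; apply: baer_injective => G hG.
have [|n [a [aG agen]]] := left_noetherianP nB (P := fun b => exists m, G (b, m)).
  split=> [|b u v [m Gm] [m' Gm']]; first by exists 0; apply: submod0 hG.1.
  by exists (b *: m + m'); apply: graph_linear.
have [m mG] := choice aG.
have Gsum (c : 'I_n -> B) : G (\sum_i c i * a i, \sum_i c i *: m i).
  have := submod_sumZ hG.1 c mG.
  by rewrite [\sum_i _]surjective_pairing !raddf_sum.
have [//|c ac0|x _ mx] := bM n a m.
  by apply: hG.2; rewrite -ac0.
exists x => b m' Gb; have [|c bE] := agen b; first by exists m'.
rewrite (graph_fun hG Gb (m' := \sum_i c i *: m i)); last by rewrite bE; apply: Gsum.
by rewrite bE scaler_suml; apply: eq_bigr => i _; rewrite mx scalerA.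
Qed.

Lemma retract_injective (M N : lmodType B) (i : {linear M -> N})
    (r : {linear N -> M}) : cancel i r -> injective_module N ->
  injective_module M.
Proof.
move=> ri injN X Y g h injg.
have [k kg] := injN _ _ g (i \o h : {linear X -> N}) injg.
by exists (r \o k : {linear Y -> M}) => x /=; rewrite kg /= ri.
Qed.

Lemma injective_retraction (M N : lmodType B) (i : {linear M -> N}) :
  injective_module M -> injective i -> exists r : {linear N -> M}, cancel i r.
Proof.
by move=> injM /(injM _ _ i idfun)[r ri]; exists r.
Qed.

(** Testing the cyclic submodule B y suffices. The elementwise form is the one that survives unions
    of chains and localization. *)
Lemma essential_imageP (M N : lmodType B) (f : {linear M -> N}) :
  essential_image f <->
  forall y, y <> 0 -> exists b x, f x = b *: y /\ b *: y <> 0.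
Proof.
split=> [ess y y0|ess S hS Sf y Sy].
  apply: contrapT => nb; apply: y0.
  have hS : submodP (fun z => exists b : B, b *: y = z).
    split=> [|a _ _ [b <-] [b' <-]]; first by exists 0; rewrite scale0r.
    by exists (a * b + b'); rewrite scalerDl scalerA.
  apply: (ess _ (submodP_closed hS)).
    move=> x /asboolP[b bE]; apply: contrapT => fx0; apply: nb.
    by exists b, x; rewrite bE.
  by apply/asboolP; exists 1; rewrite scale1r.
apply: contrapT => y0; have [b [x [fx]]] := ess y y0; apply.
rewrite -fx; apply: Sf; rewrite fx.
exact: (submodZ (closed_submodP hS) b Sy).
Qed.

End Injective.

(** * The group Q/Z *)

Definition additive_fun (U V : zmodType) (f : U -> V) : Prop :=
  forall x y, f (x + y) = f x + f y.

Section AdditiveFun.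
Variables (U V : zmodType) (f : U -> V) (fD : additive_fun f).

Lemma additive_fun0 : f 0 = 0.
Proof. by apply: (addrI (f 0)); rewrite -fD !addr0. Qed.

Lemma additive_funN x : f (- x) = - f x.
Proof. by apply: (addrI (f x)); rewrite -fD !subrr additive_fun0. Qed.

Lemma additive_funB x y : f (x - y) = f x - f y.
Proof. by rewrite fD additive_funN. Qed.

Lemma additive_fun_sum n (F : 'I_n -> U) : f (\sum_i F i) = \sum_i f (F i).
Proof. exact: (big_morph f fD additive_fun0). Qed.

End AdditiveFun.

Definition ints : {pred rat} := fun q => q \is a Num.int.

Fact ints_zmod_closed : zmod_closed ints.
Proof. by split=> [|x y]; [exact: rpred0|exact: rpredB]. Qed.

HB.instance Definition _ := GRing.isZmodClosed.Build rat ints ints_zmod_closed.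

Definition qz : zmodType := Quotient.quot ints.

Definition qz_of (q : rat) : qz := \pi_(Quotient.quot ints)%qT q.

Lemma qz_ofD : additive_fun qz_of.
Proof. by move=> x y; rewrite /qz_of raddfD. Qed.

Lemma qz_of_eq0 q : qz_of q = 0 <-> q \is a Num.int.
Proof.
rewrite -[q in X in _ <-> is_true X](subr0 q) -[_ \is a _]/(q - 0 \in ints).
rewrite Quotient.idealrBE; split=> [e|/eqP e].
  by apply/eqP; rewrite [LHS]e; symmetry; apply: (additive_fun0 qz_ofD).
by rewrite [LHS]e; apply: (additive_fun0 qz_ofD).
Qed.

Lemma qz_ofP x : exists q, x = qz_of q.
Proof. by exists (repr x); rewrite /qz_of reprK. Qed.

Lemma qz_ofMz q (k : int) : qz_of (q *~ k) = qz_of q *~ k.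
Proof. by rewrite /qz_of raddfMz. Qed.

Definition subgroupP (V : zmodType) (P : V -> Prop) : Prop :=
  P 0 /\ forall x y, P x -> P y -> P (x - y).

Section SubgroupP.
Variables (V : zmodType) (P : V -> Prop) (hP : subgroupP P).

Lemma subgroupN x : P x -> P (- x).
Proof. by rewrite -sub0r; apply: (hP.2); apply: hP.1. Qed.

Lemma subgroupD x y : P x -> P y -> P (x + y).
Proof. by move=> Px /subgroupN Py; rewrite -[y]opprK; apply: hP.2. Qed.

Lemma subgroupMz x (k : int) : P x -> P (x *~ k).
Proof.
move=> Px; have Pn n : P (x *+ n).
  elim: n => [|n ih]; first by rewrite mulr0n; apply: hP.1.
  by rewrite mulrS; apply: subgroupD.
by case: k => n; [exact: Pn|apply: subgroupN; exact: Pn].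
Qed.

End SubgroupP.

(** The generator d is the least positive element, or 0 for the zero subgroup, a case that the
    divisions by d below treat apart. *)
Lemma int_subgroup (P : int -> Prop) : subgroupP P ->
  exists d : nat, P d%:Z /\ forall k, P k -> exists j, k = j * d%:Z.
Proof.
move=> hP.
have [[k0 [k0_neq0 Pk0]]|P0] := pselect (exists k, k != 0 /\ P k); last first.
  exists 0; split=> [|k Pk]; first exact: hP.1.
  exists 0; rewrite mul0r; apply: contrapT => /eqP k0.
  by apply: P0; exists k.
have exd : exists d : nat, (0 < d)%N && `[< P d%:Z >].
  exists `|k0|%N; rewrite absz_gt0 k0_neq0 /=; apply/asboolP.
  by rewrite abszE; case: (ger0P k0) => _ //; apply: subgroupN.
case: (ex_minnP exd) => d /andP[d_gt0 /asboolP Pd] dmin.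
exists d; split=> // k Pk; exists (k %/ d)%Z.
have dz : d%:Z != 0 by rewrite eqz_nat -lt0n.
rewrite {1}(divz_eq k d); suff -> : (k %% d)%Z = 0 by rewrite addr0.
have r_ge0 := modz_ge0 k dz; have := ltz_pmod k (d_gt0 : 0 < d%:Z).
have [r rE] : exists r : nat, (k %% d)%Z = r.
  by exists `|(k %% d)%Z|%N; rewrite gez0_abs.
rewrite rE ltz_nat => rd; congr (Posz _); apply/eqP; rewrite -leqn0 leqNgt.
apply/negP => r_gt0; have := dmin r; rewrite r_gt0 /= leqNgt rd.
move=> /(_ _)/negP; apply=> //; apply/asboolP.
rewrite -rE; have -> : (k %% d)%Z = k - (k %/ d)%Z * d.
  by rewrite {2}(divz_eq k d) addrC addKr.
by apply: hP.2 => //; rewrite mulrC -mulrzz; apply: subgroupMz.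
Qed.

(** Q/Z is divisible: the image of the generator d of an ideal can be divided by d. *)
Lemma qz_baer : @baer int (zmodule qz).
Proof.
move=> G hG.
have [|d [[m0 Gd] dgen]] := @int_subgroup (fun k => exists m, G (k, m)).
  split=> [|k k' [m Gk] [m' Gk']]; first by exists 0; apply: (submod0 hG.1).
  by exists (m - m'); apply: (submodB hG.1 Gk Gk').
have [q m0E] := qz_ofP (m0 : qz).
have dx : d%:Z *: (qz_of (q / d%:R) : zmodule qz) = m0.
  have [d0|d_gt0] := posnP d.
    by move: Gd; rewrite {1 2}d0 scale0r => /(hG.2) ->.
  rewrite scalezrE -qz_ofMz -mulrzr -[(Posz d)%:~R]/(d%:R) divfK //.
  by rewrite pnatr_eq0 -lt0n.
exists (qz_of (q / d%:R) : zmodule qz) => b m Gb.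
have [|j bE] := dgen b; first by exists m.
rewrite bE -scalerA dx; apply: (graph_fun hG Gb).
by rewrite bE; apply: (submodZ hG.1 j Gd).
Qed.

Lemma qz_extends (V : zmodType) (G : V * qz -> Prop) :
  subgroupP G -> (forall q, G (0, q) -> q = 0) ->
  exists2 k : V -> qz, additive_fun k & forall x q, G (x, q) -> k x = q.
Proof.
move=> hG G0.
have [|k kG] := @baer_graph_extends int (zmodule V) (zmodule qz) G qz_baer.
  split=> //; split=> [|a [x q] [x' q'] Gx Gx']; first exact: hG.1.
  apply: (subgroupD hG _ Gx').
  have := subgroupMz hG a Gx; congr (G _).
  rewrite [LHS]surjective_pairing; congr (_, _).
    exact: (raddfMz (fst : _ -> _)).
  exact: (raddfMz (snd : _ -> _)).
by exists k => // x y; rewrite raddfD.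
Qed.

Lemma qz_separates (V : zmodType) (P : V -> Prop) (x : V) :
  subgroupP P -> ~ P x ->
  exists k : V -> qz, [/\ additive_fun k, forall y, P y -> k y = 0 & k x <> 0].
Proof.
move=> hP nPx.
(* The class of q becomes the image of x: q is 1/d if d > 1 is the order of x modulo P, and 1/2 if
   no nonzero multiple of x lies in P. *)
have [q [q_nint qP]] : exists q : rat,
    q \isn't a Num.int /\ forall k : int, P (x *~ k) -> q *~ k \is a Num.int.
  have [|d [Pd dgen]] := @int_subgroup (fun k => P (x *~ k)).
    split=> [|k k' Pk Pk']; first by rewrite mulr0z; apply: hP.1.
    by rewrite mulrzBr; apply: hP.2.
  have [d0|d_gt0] := posnP d.
    exists (2%:R^-1); split=> // k /dgen[j ->].
    by rewrite d0 mulr0 mulr0z; apply: rpred0.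
  have d_neq0 : d%:R != 0 :> rat by rewrite pnatr_eq0 -lt0n.
  exists (d%:R^-1); split.
    have d_gt1 : (1 < d)%N.
      rewrite ltn_neqAle d_gt0 andbT; apply/eqP => d1; apply: nPx.
      by rewrite -d1 mulr1z in Pd.
    apply/negP => /intrP[z zE].
    have z_gt0 : (0 < z%:~R :> rat) by rewrite -zE invr_gt0 ltr0n.
    have z_lt1 : (z%:~R < 1 :> rat) by rewrite -zE invf_lt1 ?ltr1n ?ltr0n.
    move: z_gt0 z_lt1; rewrite ltr0z -[1 in X in _ -> X -> _]/(1%:~R) ltr_int.
    by case: z {zE} => // -[|n].
  move=> k /dgen[j ->]; rewrite mulrC mulrzA -[_ *~ d]mulrzr.
  by rewrite -[(Posz d)%:~R]/(d%:R) mulVf.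
have [||k kD kG] := @qz_extends V (fun z => exists y j,
  [/\ P y, z.1 = y + x *~ j & z.2 = qz_of q *~ j]).
- split; first by exists 0, 0; rewrite !mulr0z addr0; split=> //; apply: hP.1.
  move=> [u1 q1] [u2 q2] [y [j [Py /= -> ->]]] [y' [j' [Py' /= -> ->]]].
  exists (y - y'), (j - j'); rewrite !mulrzBr opprD addrACA.
  by split=> //; apply: hP.2.
- move=> r [y [j [Py /= /esym/eqP]]]; rewrite addrC addr_eq0 => /eqP xj ->.
  by rewrite -qz_ofMz; apply/qz_of_eq0/qP; rewrite xj; apply: subgroupN.
exists k; split=> // [y Py|].
  by apply: kG; exists y, 0; rewrite !mulr0z addr0.
rewrite (kG x (qz_of q)); last first.
  by exists 0, 1; rewrite !mulr1z add0r; split=> //; apply: hP.1.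
by move=> /qz_of_eq0 q_int; rewrite q_int in q_nint.
Qed.

(** * Injective hulls and minimal injective resolutions *)

Record right_action (D : pzRingType) (V : zmodType) := RightAction {
  ract :> D -> V -> V;
  ractDr : forall a, additive_fun (ract a);
  ractDl : forall a b v, ract (a + b) v = ract a v + ract b v;
  ract1 : forall v, ract 1 v = v;
  ractM : forall a b v, ract (a * b) v = ract b (ract a v) }.

Section CharacterModule.
Variables (D : pzRingType) (V : zmodType) (r : right_action D V) (T : Type).

Definition chars : {pred T -> V -> qz} :=
  fun F => `[< forall t, additive_fun (F t) >].

Fact chars_zmod_closed : zmod_closed chars.
Proof.
split=> [|F G /asboolP FD /asboolP GD]; apply/asboolP => t x y.
  by rewrite -[LHS]/(0 : qz) -[RHS]/(0 + 0 : qz) addr0.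
rewrite -[LHS]/(F t (x + y) - G t (x + y)) FD GD opprD addrACA.
by [].
Qed.

(* Functions T -> Hom_Z(V, Q/Z) with (a F)(t, v) = F(t, v.a); the action [r] is
   a parameter so that it serves both for the Q/Z-dual of a left module and for
   products of copies of Hom_Z(D, Q/Z). *)
Definition charmod (_ : right_action D V) : Type :=
  {F : T -> V -> qz | F \in chars}.
Local Notation chr := (charmod r).
HB.instance Definition _ :=
  [isSub of chr for @sval (T -> V -> qz) (fun x => x \in chars)].
HB.instance Definition _ := [Choice of chr by <:].
HB.instance Definition _ :=
  GRing.SubChoice_isSubZmodule.Build (T -> V -> qz) chars chr chars_zmod_closed.

Definition chr_app (F : chr) (t : T) (v : V) : qz := sval F t v.

Lemma chr_appD (F : chr) t : additive_fun (chr_app F t).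
Proof. by have /asboolP FD := valP F; apply: FD. Qed.

Lemma chr_ext (F G : chr) : (forall t v, chr_app F t v = chr_app G t v) -> F = G.
Proof. by move=> FG; apply/val_inj/funext => t; apply/funext => v; apply: FG. Qed.

Lemma chr_app0 t v : chr_app 0 t v = 0. Proof. by []. Qed.

Lemma chr_app_add (F G : chr) t v :
  chr_app (F + G) t v = chr_app F t v + chr_app G t v.
Proof. by []. Qed.

Lemma chr_app_sum n (F : 'I_n -> chr) t v :
  chr_app (\sum_i F i) t v = \sum_i chr_app (F i) t v.
Proof. exact: (big_morph (fun F => chr_app F t v)). Qed.

Definition mkchr (F : T -> V -> qz) (FD : forall t, additive_fun (F t)) : chr :=
  exist _ F (asboolT FD).

Fact chr_scale_subproof (a : D) (F : chr) t :
  additive_fun (fun v => chr_app F t (r a v)).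
Proof. by move=> x y; rewrite ractDr chr_appD. Qed.

Definition chr_scale a F : chr := mkchr (chr_scale_subproof a F).

Fact chr_scaleA a b F : chr_scale a (chr_scale b F) = chr_scale (a * b) F.
Proof. by apply: chr_ext => t v; rewrite /chr_app /= ractM. Qed.

Fact chr_scale1 : left_id 1 chr_scale.
Proof. by move=> F; apply: chr_ext => t v; rewrite /chr_app /= ract1. Qed.

Fact chr_scaleDr : right_distributive chr_scale +%R.
Proof. by move=> a F G; apply: chr_ext. Qed.

Fact chr_scaleDl F : {morph chr_scale^~ F : a b / a + b}.
Proof.
move=> a b; apply: chr_ext => t v; rewrite chr_app_add /chr_scale /chr_app /=.
by rewrite ractDl; apply: chr_appD.
Qed.

HB.instance Definition _ := GRing.Zmodule_isLmodule.Build D chr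
  chr_scaleA chr_scale1 chr_scaleDr chr_scaleDl.

Lemma chr_appZ a (F : chr) t v : chr_app (a *: F) t v = chr_app F t (r a v).
Proof. by []. Qed.

End CharacterModule.

Arguments mkchr {D V r T F}.

Section RegularAction.
Variable B : pzRingType.

Fact rmul_ractDr (a : B) : additive_fun (fun v : B => v * a).
Proof. by move=> x y; rewrite mulrDl. Qed.

Definition rmul_ract : right_action B B :=
  @RightAction B B (fun a v => v * a) rmul_ractDr (fun a b v => mulrDr v a b)
    (@mulr1 B) (fun a b v => mulrA v a b).

(** A linear map into the module of functions T -> Hom_Z(B, Q/Z) amounts to a family of characters
    of its source, obtained by evaluation at 1; these extend because Q/Z is injective. *)
Lemma coinduced_injective (T : Type) :
  injective_module (charmod T rmul_ract : lmodType B).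
Proof.
move=> X Y g h injg.
have ext t : exists2 k : Y -> qz, additive_fun k &
    forall x, k (g x) = chr_app (h x) t 1.
  have [||k kD kG] := @qz_extends Y
      (fun z => exists x, g x = z.1 /\ chr_app (h x) t 1 = z.2).
  - split; first by exists 0; rewrite !linear0.
    move=> [y q] [y' q'] [x [/= <- <-]] [x' [/= <- <-]]; exists (x - x').
    by rewrite !linearB.
  - by move=> q [x [/= gx0 <-]]; rewrite (injg x 0) ?linear0.
  by exists k => // x; apply: kG; exists x.
have /choice[k kP] : forall t, exists k : Y -> qz, additive_fun k /\
    forall x, k (g x) = chr_app (h x) t 1.
  by move=> t; have [k] := ext t; exists k.
have KD y t : additive_fun (fun v : B => k t (v *: y)).
  by move=> u v; rewrite scalerDl (kP t).1.
have Kl : linear (fun y => mkchr (KD y) : charmod T rmul_ract).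
  move=> a y y'; apply: chr_ext => t v.
  by rewrite chr_app_add chr_appZ /chr_app /= scalerDr (kP t).1 scalerA.
exists (linear_of Kl) => x; apply: chr_ext => t v.
rewrite {1}/chr_app /= -linearZ (kP t).2 linearZ chr_appZ /=.
by rewrite mul1r.
Qed.

(** A map with kernel P embeds M/P without forming the quotient. The index set consists of all
    characters of M vanishing on P, which detect every point outside P. *)
Lemma enough_injectives (M : lmodType B) (P : M -> Prop) : submodP P ->
  exists (J : lmodType B) (f : {linear M -> J}),
    injective_module J /\ forall x, f x = 0 <-> P x.
Proof.
move=> hP; pose T := {k : M -> qz | additive_fun k /\ forall x, P x -> k x = 0}.
have fD x (t : T) : additive_fun (fun v : B => sval t (v *: x)).
  by case: t => k [kD ?] u v /=; rewrite scalerDl kD.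
have fl : linear (fun x => mkchr (fD x) : charmod T rmul_ract).
  move=> a x y; apply: chr_ext => t v; rewrite chr_app_add chr_appZ /chr_app /=.
  by case: t => k [kD ?] /=; rewrite scalerDr kD scalerA.
exists (charmod T rmul_ract), (linear_of fl); split=> [|x].
  exact: coinduced_injective.
split=> [fx0|Px]; last first.
  by apply: chr_ext => -[k [kD kP]] v; apply: kP; apply: submodZ.
apply: contrapT => nPx.
have [|k [kD kP kx]] := @qz_separates M P x _ nPx.
  by split=> [|u v]; [exact: submod0 hP|exact: submodB].
have := congr1 (fun F => chr_app F (exist _ k (conj kD kP) : T) 1) fx0.
by rewrite chr_app0 /chr_app /= scale1r.
Qed.

End RegularAction.

Section InjectiveHull.
Variable B : pzRingType.
Local Open Scope classical_set_scope.

(* Inside an injective J containing W, take E maximal among the essential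
   extensions of W and C maximal with C meeting E trivially; extending the
   projection of E + C onto E gives an endomorphism of J whose kernel is C and
   whose image is an essential extension of W, hence E. *)
Lemma injective_hull (M : lmodType B) (P : M -> Prop) : submodP P ->
  exists (E : lmodType B) (f : {linear M -> E}),
    [/\ injective_module E, forall x, f x = 0 <-> P x & essential_image f].
Proof.
move=> /enough_injectives[J [f0 [injJ f0P]]].
pose W (y : J) := exists x, f0 x = y; have hW : submodP W := submodP_im f0.
pose ess (E : set J) := [/\ submodP E, W `<=` E &
  forall y, E y -> y <> 0 -> exists2 b : B, W (b *: y) & b *: y <> 0].
have [||E [[hE WE Eess] _ Emax]] := @Zorn_above J ess W 0 (submod0 hW).
- by split=> // y Wy y0; exists 1; rewrite scale1r.
- move=> F Fess F0 Ftot; split=> [|y Wy|y [X FX Xy]].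
  + by apply: submodP_chain => // X /Fess[].
  + by have [X FX] := F0; exists X => //; have [_ WX _] := Fess X FX; apply: WX.
  + by have [_ _ Xess] := Fess X FX; apply: Xess.
pose indep (C : set J) := submodP C /\ forall y, C y -> E y -> y = 0.
have [||C [[hC CE] _ Cmax]] := @Zorn_above J indep (set1 0) 0 erefl.
- split=> [|y ->//]; split=> // a x y -> ->.
  by rewrite scaler0 addr0.
- move=> F Find F0 Ftot; split=> [|y [X FX Xy]].
  + by apply: submodP_chain => // X /Find[].
  + by have [_ XE] := Find X FX; apply: XE.
have [|psi psiP] := @injective_graph_extends _ J J
    (fun z => exists e c, [/\ E e, C c, z.1 = e + c & z.2 = e]) injJ.
  split; first split.
  - by exists 0, 0; split; rewrite ?addr0 //; [apply: submod0 hE|apply: submod0 hC].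
  - move=> a [y1 m1] [y2 m2] [e [c [Ee Cc /= -> ->]]].
    move=> [e' [c' [Ee' Cc' /= -> ->]]]; exists (a *: e + e'), (a *: c + c').
    split=> //; [exact: (submodZD hE)|exact: (submodZD hC)|].
    by rewrite /= scalerDr addrACA.
  - move=> m [e [c [Ee Cc /= /esym/eqP]]]; rewrite addr_eq0 => /eqP ec ->.
    by apply: CE => //; rewrite ec; apply: submodN.
have psiE e : E e -> psi e = e.
  move=> Ee; apply: psiP; exists e, 0; rewrite addr0.
  by split=> //; apply: submod0 hC.
have psiC c : C c -> psi c = 0.
  move=> Cc; apply: psiP; exists 0, c; rewrite add0r.
  by split=> //; apply: submod0 hE.
have imE : (fun y => exists u, psi u = y) = E.
  apply: Emax; last by move=> e Ee; exists e; apply: psiE.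
  split=> [|y Wy|_ [u <-] psiu0].
  - exact: submodP_im.
  - by exists y; apply/psiE/WE.
  (* As psi u is nonzero, u is not in [C], so [C] + B u meets [E] in some nonzero e by maximality of
     [C]; applying psi to e then gives b psi u = e. *)
  have [e [b [c [Ee Cc cE e0]]]] : exists e b c,
      [/\ E e, C c, e = c + b *: u & e <> 0].
    apply: contrapT => none; apply: psiu0; apply: psiC.
    suff <- : (fun y => exists c b, C c /\ y = c + b *: u) = C.
      by exists 0, 1; rewrite scale1r add0r; split=> //; apply: submod0 hC.
    apply: Cmax; last by move=> c Cc; exists c, 0; rewrite scale0r addr0.
    split; first split.
    - by exists 0, 0; rewrite scale0r addr0; split=> //; apply: submod0 hC.
    - move=> a _ _ [c [b [Cc ->]]] [c' [b' [Cc' ->]]].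
      exists (a *: c + c'), (a * b + b'); split; first exact: (submodZD hC).
      by rewrite scalerDr scalerDl scalerA addrACA.
    - move=> y [c [b [Cc yE]]] Ey; apply: contrapT => y0; apply: none.
      by exists y, b, c.
  have psie : b *: psi u = e.
    by rewrite -(psiE e Ee) cE linearD (psiC c Cc) add0r linearZ.
  have [b' Wb' b'0] := Eess e Ee e0.
  by exists (b' * b); rewrite -scalerA psie.
have WfE x : E (f0 x) by apply: WE; exists x.
pose f := submP_corestr hE WfE.
have psiEE u : E (psi u) by rewrite -imE; exists u.
exists (submP hE), f; split.
- apply: (@retract_injective _ _ J (submP_val hE) (submP_corestr hE psiEE)) => //.
  move=> x; apply: submP_val_inj; rewrite submP_corestrE.
  by apply: psiE; apply: submP_valP.
- move=> x; rewrite -f0P; split=> [fx0|f0x].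
    by rewrite -(submP_corestrE hE WfE) -/f fx0 linear0.
  by apply: (submP_val_inj (hP := hE)); rewrite submP_corestrE linear0.
- apply/essential_imageP => y y0.
  have [||b [x xE] b0] := Eess (submP_val hE y); first exact: submP_valP.
    by move=> vy0; apply: y0; apply: submP_val_inj; rewrite linear0.
  exists b, x; split.
    by apply: (submP_val_inj (hP := hE)); rewrite submP_corestrE xE linearZ.
  by move=> by0; apply: b0; rewrite -linearZ by0 linear0.
Qed.

Lemma injective_envelope_exists (M : lmodType B) :
  exists (E : lmodType B) (f : {linear M -> E}), injective_envelope f.
Proof.
have [|E [f [injE f0 ess]]] := @injective_hull M (fun x => x = 0).
  by split=> // a x y -> ->; rewrite scaler0 addr0.
by exists E, f; split=> //; apply: linear_inj0 => x /f0.
Qed.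

End InjectiveHull.

Section MinimalResolution.
Variables (B : pzRingType) (M : lmodType B).

(** The state of the recursion that builds the coresolution: the next map embeds the cokernel of
    [coaug_map] in a hull. The modules vary, so they are bundled with the map. *)
Record coaug := Coaug {
  coaug_src : lmodType B;
  coaug_inj : lmodType B;
  coaug_map : {linear coaug_src -> coaug_inj} }.

Definition hull_spec (N : lmodType B) (P : N -> Prop)
    (E : {E : lmodType B & {linear N -> E}}) : Prop :=
  [/\ injective_module (projT1 E), forall x, projT2 E x = 0 <-> P x &
      essential_image (projT2 E)].

Fact hull_ex (N : lmodType B) (P : N -> Prop) : submodP P ->
  exists E, @hull_spec N P E.
Proof. by move=> /injective_hull[E [f fP]]; exists (existT _ E f). Qed.

Definition hull (N : lmodType B) (P : N -> Prop) (hP : submodP P) :=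
  sval (cid (hull_ex hP)).

Lemma hullP (N : lmodType B) (P : N -> Prop) (hP : submodP P) :
  hull_spec P (hull hP).
Proof. exact: (svalP (cid (hull_ex hP))). Qed.

Definition coaug_next (s : coaug) : coaug :=
  Coaug (projT2 (hull (submodP_im (coaug_map s)))).

Fact submodP_eq0 : submodP (fun x : M => x = 0).
Proof. by split=> // a x y -> ->; rewrite scaler0 addr0. Qed.

Fixpoint coaug_seq (i : nat) : coaug :=
  if i is j.+1 then coaug_next (coaug_seq j)
  else Coaug (projT2 (hull submodP_eq0)).

Definition minres_d i :
    {linear coaug_inj (coaug_seq i) -> coaug_inj (coaug_seq i.+1)} :=
  coaug_map (coaug_seq i.+1).

Lemma minimal_resolution_exists : exists I : right_resolution M,
  minimal_injective I.
Proof.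
have hs i : hull_spec _ _ := hullP (submodP_im (coaug_map (coaug_seq i))).
have h0 := hullP submodP_eq0.
have aug_inj : injective (coaug_map (coaug_seq 0)).
  by apply: linear_inj0 => x; case: h0 => _ /(_ x)[].
have ex0 x : minres_d 0 x = 0 <-> exists y, coaug_map (coaug_seq 0) y = x.
  by have [_ e _] := hs 0; apply: e.
have exS i x : minres_d i.+1 x = 0 <-> exists y, minres_d i y = x.
  by have [_ e _] := hs i.+1; apply: e.
exists (@RightResolution B M (fun i => coaug_inj (coaug_seq i)) minres_d
  (coaug_map (coaug_seq 0)) aug_inj ex0 exS); split=> [[|l]| |l] /=.
- by case: h0.
- by case: (hs l).
- by case: h0.
- by case: (hs l).
Qed.

End MinimalResolution.

(** * Flatness and vanishing of Tor by matrices *)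

Section MatrixAction.
Variables (B : pzRingType) (X : lmodType B).

(** This is D (x)_B X, for D seen as a map B^n -> B^m of right modules. *)
Definition mxact m n (D : 'M[B]_(m, n)) (x : 'I_n -> X) : 'I_m -> X :=
  fun i => \sum_j D i j *: x j.

Lemma mxact_mul m n k (D : 'M[B]_(m, n)) (E : 'M[B]_(n, k)) x i :
  mxact (D *m E) x i = mxact D (mxact E x) i.
Proof.
rewrite /mxact (eq_bigr (fun j => \sum_l (D i l * E l j) *: x j)); last first.
  by move=> j _; rewrite mxE scaler_suml.
rewrite exchange_big; apply: eq_bigr => l _; rewrite scaler_sumr.
by apply: eq_bigr => j _; rewrite scalerA.
Qed.

Lemma mxact0 m n (x : 'I_n -> X) i : mxact (0 : 'M[B]_(m, n)) x i = 0.
Proof. by rewrite /mxact big1 // => j _; rewrite mxE scale0r. Qed.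

Lemma mxactB m n (D : 'M[B]_(m, n)) x y i :
  mxact D (fun j => x j - y j) i = mxact D x i - mxact D y i.
Proof.
by rewrite /mxact -sumrB; apply: eq_bigr => j _; rewrite scalerBr.
Qed.

Lemma mxact_eq m n (D : 'M[B]_(m, n)) x y i :
  (forall j, x j = y j) -> mxact D x i = mxact D y i.
Proof. by move=> xy; apply: eq_bigr => j _; rewrite xy. Qed.

Lemma mxact_cst0 m n (D : 'M[B]_(m, n)) (x : 'I_n -> X) i :
  (forall j, x j = 0) -> mxact D x i = 0.
Proof. by move=> x0; apply: big1 => j _; rewrite x0 scaler0. Qed.

End MatrixAction.

Lemma mxact_linear (B : pzRingType) (X Y : lmodType B) (f : {linear X -> Y})
    m n (D : 'M[B]_(m, n)) x i :
  f (mxact D x i) = mxact D (fun j => f (x j)) i.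
Proof. exact: linear_sumZ. Qed.

Section TorVanishing.
Variable B : pzRingType.

(* [D] is the d-th map, counted from the right end, of a chain of matrices that
   is exact on columns, i.e. a d-th syzygy of a finitely presented right
   module. *)
Fixpoint syz (d : nat) : forall m n, 'M[B]_(m, n) -> Prop :=
  if d is d'.+1 then fun n k D' =>
    exists m (D : 'M[B]_(m, n)), syz d' D /\ col_exact D' D
  else fun _ _ _ => True.

(* Vanishing of Tor_(d+1)(N, K) for all finitely presented right modules N (over
   a right Noetherian ring), K being a submodule of X. *)
Definition tor_vanish (X : lmodType B) (d : nat) (K : X -> Prop) : Prop :=
  forall m n k (D : 'M[B]_(m, n)) (D' : 'M[B]_(n, k)), syz d D -> col_exact D' D ->
  forall x : 'I_n -> X, (forall j, K (x j)) -> (forall i, mxact D x i = 0) ->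
  exists2 y : 'I_k -> X, forall j, K (y j) & forall j, x j = mxact D' y j.

(** Dimension shift along 0 -> ker f -> F -> im f -> 0 with F flat: Tor_(d+1) of the kernel is
    Tor_(d+2) of the image. *)
Lemma tor_vanish_shift (F X : lmodType B) (f : {linear F -> X}) d :
  left_noetherian B^c -> tor_vanish 0 (fun _ : F => True) ->
  tor_vanish d (fun x => f x = 0) <-> tor_vanish d.+1 (fun y => exists x, f x = y).
Proof.
move=> nB tvF; split=> tv.
  move=> n k l D' D'' [m [D [syzD [DD' Dgen]]]] ex' x /choice[u fu] D'x.
  have [||w fw D'u] := tv _ _ _ D D' syzD (conj DD' Dgen) (mxact D' u).
  - move=> j; rewrite mxact_linear -(D'x j).
    by apply: mxact_eq => i; rewrite fu.
  - by move=> i; rewrite -mxact_mul DD' mxact0.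
  have [//|i|v _ uw] := tvF _ _ _ D' D'' I ex' (fun j => u j - w j).
    by rewrite mxactB D'u subrr.
  exists (fun j => f (v j)) => j; first by exists (v j).
  rewrite -mxact_linear -uw linearB fw subr0.
  exact/esym/fu.
move=> m n k D D' syzD ex x fx Dx.
have [//|u _ xu] := tvF _ _ _ D D' I ex x _ Dx.
(* A further syzygy [D''] makes the hypothesis on the image of f applicable to [D'], itself a
   (d+1)-st syzygy; right Noetherianity provides it. *)
have [l [D'' ex']] := col_syzygy D' nB.
have [|i|w /choice[v vw] fuw] :=
    tv _ _ _ D' D'' (ex_intro _ m (ex_intro _ D (conj syzD ex))) ex' (fun j => f (u j)).
- by move=> j; exists (u j).
- by rewrite -mxact_linear -xu.
exists (fun j => u j - mxact D'' v j) => j.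
  rewrite linearB mxact_linear fuw; apply/eqP; rewrite subr_eq0; apply/eqP.
  by apply: mxact_eq => i; rewrite vw.
by rewrite mxactB -mxact_mul ex'.1 mxact0 subr0.
Qed.

Lemma tor_vanish_image (F X : lmodType B) (f : {linear F -> X}) d (K : F -> Prop) :
  injective f -> tor_vanish d K -> tor_vanish d (fun y => exists2 x, K x & f x = y).
Proof.
move=> injf tvK m n k D D' syzD ex x xK Dx.
have /choice[u uP] : forall j, exists u, K u /\ f u = x j.
  by move=> j; have [u Ku fu] := xK j; exists u.
have [|i|v Kv uv] := tvK _ _ _ D D' syzD ex u.
- by move=> j; case: (uP j).
- apply: injf; rewrite linear0 mxact_linear -[RHS](Dx i).
  by apply: mxact_eq => j; case: (uP j).
exists (fun j => f (v j)) => j; first by exists (v j).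
by rewrite -mxact_linear -uv; case: (uP j).
Qed.

Lemma tor_vanish_retract (M N : lmodType B) (i : {linear M -> N})
    (r : {linear N -> M}) d : cancel i r ->
  tor_vanish d (fun _ : N => True) -> tor_vanish d (fun _ : M => True).
Proof.
move=> ri tvN m n k D D' syzD ex x _ Dx.
have [//|j|y _ ixy] := tvN _ _ _ D D' syzD ex (fun j => i (x j)).
  by rewrite -mxact_linear Dx linear0.
exists (fun j => r (y j)) => // j.
by rewrite -mxact_linear -ixy ri.
Qed.

Lemma tor_vanish_ext (X : lmodType B) d (K K' : X -> Prop) :
  (forall x, K x <-> K' x) -> tor_vanish d K -> tor_vanish d K'.
Proof.
move=> KK' tvK m n k D D' syzD ex x K'x Dx.
have [|y Ky xy] := tvK _ _ _ D D' syzD ex x _ Dx; first by move=> j; apply/KK'.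
by exists y => // j; apply/KK'.
Qed.

Lemma tor_vanish_subtype (X : lmodType B) d (K : X -> Prop) (hK : submodP K) :
  tor_vanish d (fun _ : submP hK => True) <-> tor_vanish d K.
Proof.
split=> tv.
  apply: (tor_vanish_ext _ (tor_vanish_image (submP_val_inj (hP := hK)) tv)).
  move=> x; split=> [[y _ <-]|/(submP_sur hK)[y yx]]; first exact: submP_valP.
  by exists y.
move=> m n k D D' syzD ex x _ Dx.
have [j|i|y Ky xy] := tv _ _ _ D D' syzD ex (fun j => submP_val hK (x j)).
- exact: submP_valP.
- by rewrite -mxact_linear Dx linear0.
have /choice[z zy] := fun j => submP_sur hK (Ky j).
exists z => // j; apply: (submP_val_inj (hP := hK)).
by rewrite xy mxact_linear; apply: mxact_eq.
Qed.

End TorVanishing.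

Section TensorAdditivity.
Variables (B : pzRingType) (N N' : lmodType B^c) (X : lmodType B).

Lemma tensor_mapD (f : {linear N -> N'}) :
  additive_fun (@tensor_map B N N' f X).
Proof.
move=> x y; apply: tensor_liftD => [a b c|a b c|a b c].
- by rewrite linearD tensDl.
- exact: tensDr.
- by rewrite linearZ tensZ.
Qed.

Lemma additive_tensor_ext (G : zmodType) (f g : tensor N X -> G) :
  additive_fun f -> additive_fun g ->
  (forall x y, f (tens x y) = g (tens x y)) -> forall t, f t = g t.
Proof.
move=> fD gD fg t; have [s ->] := tensP t.
elim: s => [|z s ih]; first by rewrite big_nil !additive_fun0.
by rewrite big_cons fD gD fg ih.
Qed.

End TensorAdditivity.

(** * Character modules and the matrix criterion for flatness *)

Section Duality.
Variables (B : pzRingType) (X : lmodType B).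

Fact scale_ractDr (a : B^c) : additive_fun (fun v : X => (a : B) *: v).
Proof. by move=> x y; rewrite scalerDr. Qed.

Fact scale_ractDl (a b : B^c) (v : X) :
  ((a + b : B^c) : B) *: v = (a : B) *: v + (b : B) *: v.
Proof. exact: scalerDl. Qed.

Fact scale_ract1 (v : X) : ((1 : B^c) : B) *: v = v.
Proof. exact: scale1r. Qed.

Fact scale_ractM (a b : B^c) (v : X) :
  ((a * b : B^c) : B) *: v = (b : B) *: ((a : B) *: v).
Proof. by rewrite scalerA. Qed.

Definition scale_ract : right_action B^c X :=
  RightAction scale_ractDr scale_ractDl scale_ract1 scale_ractM.

Definition dual : lmodType B^c := charmod unit scale_ract.

Definition dual_app (F : dual) : X -> qz := chr_app F tt.

Lemma dual_appD (F : dual) : additive_fun (dual_app F).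
Proof. exact: chr_appD. Qed.

Definition mkdual (k : X -> qz) (kD : additive_fun k) : dual :=
  @mkchr _ _ scale_ract unit (fun _ => k) (fun _ => kD).

Lemma dual_ext (F G : dual) : (forall x, dual_app F x = dual_app G x) -> F = G.
Proof. by move=> FG; apply: chr_ext => -[]; apply: FG. Qed.

Lemma dual_app_add (F G : dual) x :
  dual_app (F + G) x = dual_app F x + dual_app G x.
Proof. by []. Qed.

Lemma dual_appZ (b : B) (F : dual) x :
  dual_app ((b : B^c) *: F) x = dual_app F (b *: x).
Proof. by []. Qed.

Lemma dual_app_sum n (F : 'I_n -> dual) x :
  dual_app (\sum_i F i) x = \sum_i dual_app (F i) x.
Proof. exact: chr_app_sum. Qed.

Section Balanced.
Variables (N : lmodType B^c) (h : {linear N -> dual}).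

(** One direction of the adjunction between maps from N to the dual of X and characters of N (x) X;
    [curry_dual] is the other. *)
Definition dual_pairing : tensor N X -> qz :=
  tensor_lift (fun n x => dual_app (h n) x).

Fact balanced_Dl a b c :
  dual_app (h (a + b)) c = dual_app (h a) c + dual_app (h b) c.
Proof. by rewrite linearD. Qed.

Fact balanced_Dr a b c :
  dual_app (h a) (b + c) = dual_app (h a) b + dual_app (h a) c.
Proof. exact: dual_appD. Qed.

Fact balanced_Z a (b : B) c :
  dual_app (h ((b : B^c) *: a)) c = dual_app (h a) (b *: c).
Proof. by rewrite linearZ. Qed.

Lemma dual_pairing_tens n x : dual_pairing (tens n x) = dual_app (h n) x.
Proof.
exact: (tensor_lift_tens balanced_Dl balanced_Dr balanced_Z).
Qed.

Lemma dual_pairingD : additive_fun dual_pairing.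
Proof.
by move=> x y; apply: (tensor_liftD balanced_Dl balanced_Dr balanced_Z).
Qed.

End Balanced.

Section Curry.
Variables (N : lmodType B^c) (K : tensor N X -> qz) (KD : additive_fun K).

Fact curry_subproof n : additive_fun (fun x => K (tens n x)).
Proof. by move=> x y; rewrite tensDr KD. Qed.

Fact curry_linear : linear (fun n => mkdual (curry_subproof n)).
Proof.
move=> b m n; apply: dual_ext => x; rewrite dual_app_add dual_appZ.
by rewrite /dual_app /chr_app /= tensDl KD -tensZ.
Qed.

Definition curry_dual : {linear N -> dual} := linear_of curry_linear.

Lemma curry_dualE n x : dual_app (curry_dual n) x = K (tens n x).
Proof. by []. Qed.

End Curry.

(** By adjunction, extending h along g means extending a character along g (x) X, which is injective
    by flatness. *)
Lemma flat_dual_injective : flat X -> injective_module dual.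
Proof.
move=> flatX N N' g h injg.
have [||K KD KG] := @qz_extends (tensor N' X)
    (fun z => exists t, tensor_map g t = z.1 /\ dual_pairing h t = z.2).
- split=> [|[u q] [u' q'] [t [/= <- <-]] [t' [/= <- <-]]].
    by exists 0; rewrite (additive_fun0 (dual_pairingD h)) (additive_fun0 (tensor_mapD g)).
  exists (t - t'); rewrite (additive_funB (dual_pairingD h)).
  by rewrite (additive_funB (tensor_mapD g)).
- move=> q [t [/= t0 <-]]; rewrite (flatX _ _ g injg t 0).
    exact: additive_fun0 (dual_pairingD h).
  by rewrite t0 (additive_fun0 (tensor_mapD g)).
exists (curry_dual KD) => n; apply: dual_ext => x.
rewrite curry_dualE; apply: KG; exists (tens n x).
by rewrite tensor_map_tens dual_pairing_tens.
Qed.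

(** A character K with K t <> 0 corresponds to a map from N to the dual, which extends along f. So K
    factors through f (x) X and cannot detect an element t of its kernel. *)
Lemma dual_injective_flat : injective_module dual -> flat X.
Proof.
move=> injD N N' f injf.
suff ker0 (t : tensor N X) : tensor_map f t = 0 -> t = 0.
  move=> s t st; apply/eqP; rewrite -subr_eq0; apply/eqP/ker0.
  by rewrite (additive_funB (tensor_mapD f)) st subrr.
move=> ft0; apply: contrapT => t0.
have [|//|K [KD _ Kt]] := @qz_separates (tensor N X) (fun s => s = 0) t.
  by split=> // x y -> ->; rewrite subrr.
have [k kf] := injD _ _ f (curry_dual KD) injf.
apply: Kt; transitivity (dual_pairing k (tensor_map f t)); last first.
  by rewrite ft0 (additive_fun0 (dual_pairingD k)).
apply: (@additive_tensor_ext _ _ _ _ K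
  (fun s => dual_pairing k (tensor_map f s))) => // [x y|n x].
  by rewrite (tensor_mapD f) (dual_pairingD k).
by rewrite tensor_map_tens dual_pairing_tens kf curry_dualE.
Qed.

(** If x is not of the form D' y, some character K of X^n kills all D' y but not x. Then v |-> (z
    |-> K (v z)) maps columns to the dual and vanishes on the kernel of D, so it factors as psi
    after D with psi defined on B^m. Hence K x is the sum over j of psi e_j at (D x)_j, which is
    0. *)
Lemma dual_injective_tor_vanish :
  injective_module dual -> tor_vanish 0 (fun _ : X => True).
Proof.
move=> injD m n k D D' _ [DD' Dgen] x _ Dx; apply: contrapT => nox.
have [||K [KD KP Kx]] := @qz_separates ('I_n -> X)
    (fun u => exists y, forall j, u j = mxact D' y j) x.
- split=> [|u v [y uy] [z vz]].
    by exists (fun _ => 0) => j; rewrite mxact_cst0.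
  exists (fun j => y j - z j) => j.
  by rewrite mxactB -uy -vz.
- by move=> [y xy]; apply: nox; exists y.
have hD (v : 'cV[B]_n) : additive_fun (fun z : X => K (fun i => v i 0 *: z)).
  move=> y z; rewrite -KD; congr K; apply/funext => i.
  by rewrite scalerDr.
have hl : linear (fun v : 'cV[B^c]_n => mkdual (hD v)).
  move=> b u v; apply: dual_ext => z; rewrite dual_app_add dual_appZ.
  rewrite /dual_app /chr_app /= -KD; congr K; apply/funext => i.
  by rewrite !mxE scalerDl -scalerA.
have gl : linear (fun v : 'cV[B^c]_n => (D *m (v : 'cV[B]_n) : 'cV[B^c]_m)).
  move=> b u v; apply/matrixP => i j; rewrite !mxE.
  rewrite -[b * _]/((_ : B) * (b : B)) mulr_suml -big_split; apply: eq_bigr => l _.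
  by rewrite !mxE mulrDr -mulrA.
have [|psi psiP] := @injective_graph_extends _ _ _ _ injD
    (linear_graph_functional (g := linear_of gl) (h := linear_of hl) _).
  move=> v /Dgen[w vw]; apply: dual_ext => z.
  rewrite [LHS](_ : _ = K (fun i => (v : 'cV[B]_n) i 0 *: z)) //.
  apply: KP; exists (fun j => w j 0 *: z) => j.
  by rewrite vw mxE scaler_suml; apply: eq_bigr => l _; rewrite scalerA.
apply: Kx.
have -> : x = \sum_i (fun j => (delta_mx i 0 : 'cV[B]_n) j 0 *: x i).
  apply/funext => j; rewrite fct_sumE (bigD1 j) //= mxE !eqxx scale1r.
  by rewrite big1 ?addr0 // => i /negPf ij; rewrite mxE eq_sym ij scale0r.
rewrite (additive_fun_sum KD).
transitivity (\sum_i \sum_j dual_app (psi (delta_mx j 0)) (D j i *: x i)).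
  apply: eq_bigr => i _.
  transitivity (dual_app (psi (linear_of gl (delta_mx i 0))) (x i)).
    by rewrite (psiP _ (linear_of hl (delta_mx i 0))) //; exists (delta_mx i 0).
  have -> : linear_of gl (delta_mx i 0) =
      \sum_j (D j i : B^c) *: (delta_mx j 0 : 'cV[B^c]_m).
    apply/matrixP => a b; rewrite ord1 summxE /linear_of -colE mxE.
    rewrite (bigD1 a) //= !mxE !eqxx big1 ?addr0.
      by rewrite -[RHS]/(1 * D a i) mul1r.
    by move=> c /negPf ca; rewrite !mxE eq_sym ca mulr0.
  rewrite linear_sum dual_app_sum; apply: eq_bigr => j _.
  by rewrite linearZ dual_appZ.
rewrite exchange_big big1 // => j _.
transitivity (dual_app (psi (delta_mx j 0)) (mxact D x j)).
  by rewrite (additive_fun_sum (@dual_appD _)).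
by rewrite Dx (additive_fun0 (@dual_appD _)).
Qed.

(** Baer's criterion for the right ideal generated by the a_i. The columns of [E] generate the
    relations among the a_i, so Tor-vanishing makes sum a_i x_i |-> sum h_i(x_i) well defined; an
    extension of this character to X is the element sought. *)
Lemma tor_vanish_dual_injective : left_noetherian B^c ->
  tor_vanish 0 (fun _ : X => True) -> injective_module dual.
Proof.
move=> nB tv; apply: baer_fg_injective => // n a h _ ah.
have [k [E ex]] := col_syzygy (\row_i (a i : B)) nB.
have [||K KD KG] := @qz_extends X (fun z => exists x : 'I_n -> X,
    \sum_i (a i : B) *: x i = z.1 /\ \sum_i dual_app (h i) (x i) = z.2).
- split=> [|[u q] [u' q'] [x [/= <- <-]] [x' [/= <- <-]]].
    exists (fun=> 0); split; apply: big1 => i _; rewrite ?scaler0 //.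
    exact: additive_fun0 (@dual_appD _).
  exists (fun i => x i - x' i); rewrite -!sumrB; split.
    by apply: eq_bigr => i _; rewrite scalerBr.
  by apply: eq_bigr => i _; rewrite (additive_funB (@dual_appD _)).
- move=> q [x [/= ax0 <-]].
  have [//|i|y _ xy] := tv _ _ _ _ E I ex x.
    by rewrite -[RHS]ax0; apply: eq_bigr => j _; rewrite mxE.
  transitivity (\sum_i \sum_j dual_app ((E i j : B^c) *: h i) (y j)).
    apply: eq_bigr => i _; rewrite xy (additive_fun_sum (@dual_appD _)).
    by apply: eq_bigr => j _; rewrite dual_appZ.
  rewrite exchange_big big1 // => j _; rewrite -dual_app_sum ah //.
  have /matrixP/(_ 0 j) := ex.1; rewrite !mxE => aE0; rewrite -[RHS]aE0.
  by apply: eq_bigr => i _; rewrite mxE.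
exists (mkdual KD) => // i; apply: dual_ext => x; rewrite dual_appZ.
symmetry; apply: KG; exists (fun j => if j == i then x else 0); split=> /=.
  rewrite (bigD1 i) //= eqxx big1 ?addr0 // => j /negPf ->.
  exact: scaler0.
rewrite (bigD1 i) //= eqxx big1 ?addr0 // => j /negPf ->.
exact: additive_fun0 (@dual_appD _).
Qed.

Lemma flat_tor_vanish : left_noetherian B^c ->
  flat X <-> tor_vanish 0 (fun _ : X => True).
Proof.
move=> nB; split=> [/flat_dual_injective/dual_injective_tor_vanish//|].
by move=> /(tor_vanish_dual_injective nB)/dual_injective_flat.
Qed.

End Duality.

Section FreeModule.
Variables (B : pzRingType) (X : lmodType B).

Definition finsupp (w : X -> B^o) : Prop :=
  exists s : seq X, forall x, x \notin s -> w x = 0.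

Fact finsupp_submod : submodP finsupp.
Proof.
split=> [|a v w [s vs] [t wt]]; first by exists [::].
exists (s ++ t) => x; rewrite mem_cat negb_or => /andP[xs xt].
by rewrite -[LHS]/(a * v x + w x) vs // wt // mulr0 addr0.
Qed.

Definition free_module : lmodType B := submP finsupp_submod.

Definition coef (w : free_module) : X -> B := submP_val finsupp_submod w.

Lemma coefP (a : B) (v w : free_module) x : coef (a *: v + w) x = a * coef v x + coef w x.
Proof. by []. Qed.

Lemma coef_sum n (c : 'I_n -> B) (w : 'I_n -> free_module) x :
  coef (\sum_i c i *: w i) x = \sum_i c i * coef (w i) x.
Proof.
elim/big_rec2: _ => // i y u _ <-.
by rewrite coefP.
Qed.

Definition supp (w : free_module) : seq X := undup (sval (cid (submP_valP w))).

Lemma suppP (w : free_module) x : x \notin supp w -> coef w x = 0.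
Proof. by rewrite mem_undup; apply: (svalP (cid (submP_valP w))). Qed.

Definition free_eval (w : free_module) : X := \sum_(x <- supp w) coef w x *: x.

Lemma free_evalE (w : free_module) (s : seq X) : uniq s -> {subset supp w <= s} ->
  free_eval w = \sum_(x <- s) coef w x *: x.
Proof.
move=> us ws; rewrite (bigID (mem (supp w))) /= [X in _ + X]big1 ?addr0.
  rewrite -big_filter; apply: perm_big; apply: uniq_perm.
  - exact: undup_uniq.
  - exact: filter_uniq.
  - by move=> x; rewrite mem_filter andb_idr //; apply: ws.
by move=> x /suppP ->; rewrite scale0r.
Qed.

Fact free_eval_linear : linear free_eval.
Proof.
move=> a v w; set s := undup (supp (a *: v + w) ++ supp v ++ supp w).
rewrite !(@free_evalE _ s) ?undup_uniq //.
- rewrite scaler_sumr -big_split; apply: eq_bigr => x _.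
  by rewrite coefP scalerDl scalerA.
- by move=> x xw; rewrite mem_undup !mem_cat xw !orbT.
- by move=> x xv; rewrite mem_undup !mem_cat xv !orbT.
- by move=> x xvw; rewrite mem_undup !mem_cat xvw.
Qed.

Definition free_map : {linear free_module -> X} := linear_of free_eval_linear.

Lemma free_map_surj x : exists w, free_map w = x.
Proof.
have fs : finsupp (fun y => if y == x then 1 else 0).
  by exists [:: x] => y; rewrite inE => /negPf ->.
have [w wE] := submP_sur finsupp_submod fs.
have wx y : coef w y = if y == x then 1 else 0 by rewrite /coef wE.
exists w; rewrite /free_map /= /linear_of.
rewrite (@free_evalE _ (undup (x :: supp w))) ?undup_uniq //.
  rewrite (bigD1_seq x) ?undup_uniq ?mem_undup ?mem_head //= wx eqxx scale1r.
  by rewrite big1 ?addr0 // => y /negPf yx; rewrite wx yx scale0r.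
by move=> y yw; rewrite mem_undup in_cons yw orbT.
Qed.

Lemma free_tor_vanish : tor_vanish 0 (fun _ : free_module => True).
Proof.
move=> m n k D D' _ [DD' Dgen] x _ Dx.
have sol z : exists w : 'cV_k, \col_j coef (x j) z = D' *m w.
  apply: Dgen; apply/matrixP => i j; rewrite mxE ord1 [RHS]mxE.
  transitivity (coef (mxact D x i) z); last by rewrite Dx.
  by rewrite coef_sum; apply: eq_bigr => l _; rewrite mxE.
have [u uP] := choice sol.
pose supps := flatten [seq supp (x j) | j : 'I_n].
(* The coordinatewise solutions are cut off outside the supports of the x j, to be finitely
   supported. *)
pose v l (z : X) : B^o := if z \in supps then u z l 0 else 0.
have vfs l : finsupp (v l).
  by exists supps => z; rewrite /v => /negPf ->.
have /choice[y yP] := fun l => submP_sur finsupp_submod (vfs l).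
exists y => // j; apply: (submP_val_inj (hP := finsupp_submod)).
apply/funext => z; rewrite -/(coef _) -/(coef _) coef_sum.
have ycoef l : coef (y l) z = v l z by rewrite /coef yP.
transitivity (\sum_l D' j l * v l z); last first.
  by apply: eq_bigr => l _; rewrite ycoef.
have [zs|zs] := boolP (z \in supps); last first.
  rewrite big1 => [|l _]; last by rewrite /v (negPf zs) mulr0.
  apply: suppP; apply: contra zs => zx; apply/flattenP; exists (supp (x j)) => //.
  by apply/mapP; exists j => //; rewrite mem_enum.
transitivity (\sum_l D' j l * u z l 0); last first.
  by apply: eq_bigr => l _; rewrite /v zs.
by have /matrixP/(_ j 0) := uP z; rewrite !mxE.
Qed.

End FreeModule.

(** * Flat dimension as Tor-vanishing *)

Section FlatDimension.
Variable B : pzRingType.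
Hypothesis nB : left_noetherian B^c.

Lemma flat_resolution_tor_vanish (X : lmodType B) d :
  has_flat_resolution X d -> tor_vanish d (fun _ : X => True).
Proof.
move=> [P [flatP P0]].
have tvP j : tor_vanish 0 (fun _ : P j => True) by apply/flat_tor_vanish.
(* Each step down the resolution raises the Tor index by one, whence i + k + 1 = d. The start is k =
   0 at the last differential, which is injective; for d = 0 the augmentation itself is. *)
have boundary k i : (i + k).+1 = d ->
    tor_vanish k (fun x : P i => exists y, lres_d P i y = x) ->
    tor_vanish d (fun y => exists x, lres_aug P x = y).
  elim: i k => [|i ih] k kd tv.
    rewrite -kd; apply/tor_vanish_shift => //; apply: tor_vanish_ext tv => x.
    by split=> /lres_exact0.
  apply: (ih k.+1); first by rewrite addnS -addSn.
  apply/tor_vanish_shift => //; apply: tor_vanish_ext tv => x.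
  by split=> /lres_exact.
have top : tor_vanish d (fun y => exists x, lres_aug P x = y).
  have image0 (F Y : lmodType B) (f : {linear F -> Y}) :
      (forall x, f x = 0 -> x = 0) -> tor_vanish 0 (fun _ : F => True) ->
      tor_vanish 0 (fun y => exists x, f x = y).
    move=> f0 tvF; apply: (tor_vanish_ext _ (tor_vanish_image (linear_inj0 f0) tvF)).
    by move=> y; split=> [[x _]|[x]]; exists x.
  case: d P0 boundary => [|d] P0 boundary.
    apply: image0 (tvP 0) => x /lres_exact0[y <-].
    by rewrite [y](P0 1%N) ?linear0.
  apply: (boundary 0 d); first by rewrite addn0.
  apply: image0 (tvP d.+1) => x /lres_exact[y <-].
  by rewrite [y](P0 d.+2) ?linear0.
apply: tor_vanish_ext top => x; split=> // _; exact: lres_aug_surj.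
Qed.

Lemma has_flat_resolution0 (X : lmodType B) : flat X -> has_flat_resolution X 0.
Proof.
move=> flatX; pose Z : lmodType B := 'rV[B]_0.
pose P i : lmodType B := if i is 0 then X else Z.
have flatZ : flat Z.
  apply/flat_tor_vanish => // m n k D D' _ _ x _ _; exists (fun=> 0) => // j.
  by rewrite mxact_cst0 // [x j]thinmx0.
have zl i : linear (fun _ : P i.+1 => 0 : P i).
  by move=> a x y; rewrite scaler0 addr0.
have ex0 x : (idfun : {linear P 0 -> X}) x = 0 <->
    exists y, linear_of (@zl 0) y = x.
  by split=> [x0|[y <-] //]; exists 0; symmetry.
have exS i x : linear_of (@zl i) x = 0 <-> exists y, linear_of (@zl i.+1) y = x.
  by split=> [_|[y <-]] //; exists 0; rewrite [x]thinmx0.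
have sur (y : X) : exists x, (idfun : {linear P 0 -> X}) x = y by exists y.
exists (@LeftResolution B X P (fun i => linear_of (@zl i)) idfun sur ex0 exS).
split=> [[|j] //|[|j] // _ x].
exact: thinmx0.
Qed.

Lemma has_flat_resolutionS (F X : lmodType B) (f : {linear F -> X}) d :
  flat F -> (forall y, exists x, f x = y) ->
  has_flat_resolution (submP (submodP_ker f)) d -> has_flat_resolution X d.+1.
Proof.
move=> flatF surf [Q [flatQ Q0]].
pose P i : lmodType B := if i is j.+1 then Q j else F.
pose dP i : {linear P i.+1 -> P i} :=
  match i return {linear P i.+1 -> P i} with
  | 0 => (submP_val (submodP_ker f) \o lres_aug Q : Q 0 -> F)
  | j.+1 => lres_d Q j
  end.
have ex0 (x : P 0) : f x = 0 <-> exists y, dP 0 y = x.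
  split=> [/(submP_sur (submodP_ker f))[y yx]|[y <-]].
    by have [z zy] := lres_aug_surj Q y; exists z; rewrite /= zy.
  exact: (submP_valP (lres_aug Q y)).
have exS i x : dP i x = 0 <-> exists y, dP i.+1 y = x.
  case: i x => [|i] x; last exact: lres_exact.
  rewrite -[X in _ <-> X]/(exists y, lres_d Q 0 y = x) -lres_exact0.
  split=> [x0|/= ->]; last by [].
  by apply: (submP_val_inj (hP := submodP_ker f)); rewrite linear0.
exists (@LeftResolution B X P dP f surf ex0 exS).
by split=> [[|j]|[|j] // jd x]; [exact: flatF|exact: flatQ|exact: Q0].
Qed.

Lemma tor_vanish_flat_resolution (X : lmodType B) d :
  tor_vanish d (fun _ : X => True) -> has_flat_resolution X d.
Proof.
elim: d X => [|d ih] X tv.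
  by apply/has_flat_resolution0/flat_tor_vanish.
apply: (has_flat_resolutionS (f := free_map X)).
- by apply/flat_tor_vanish => //; apply: free_tor_vanish.
- exact: free_map_surj.
apply/ih/tor_vanish_subtype/tor_vanish_shift => //; first exact: free_tor_vanish.
apply: tor_vanish_ext tv => x; split=> // _; exact: free_map_surj.
Qed.

Lemma tor_vanishS (X : lmodType B) d :
  tor_vanish d (fun _ : X => True) -> tor_vanish d.+1 (fun _ : X => True).
Proof.
elim: d X => [|d ih] X tv.
  have tvf : tor_vanish 1 (fun y => exists x, (idfun : {linear X -> X}) x = y).
    apply/tor_vanish_shift => //.
    move=> m n k D D' _ _ x x0 _; exists (fun=> 0) => // j.
    by rewrite mxact_cst0 //; apply: x0.
  by apply: tor_vanish_ext tvf => x; split=> // _; exists x.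
have tvf : tor_vanish d.+2 (fun y => exists x, free_map X x = y).
  apply/tor_vanish_shift; rewrite //; first exact: free_tor_vanish.
  apply/(tor_vanish_subtype _ (submodP_ker (free_map X)))/ih/tor_vanish_subtype.
  apply/tor_vanish_shift; rewrite //; first exact: free_tor_vanish.
  apply: tor_vanish_ext tv => x; split=> // _; exact: free_map_surj.
by apply: tor_vanish_ext tvf => x; split=> // _; exact: free_map_surj.
Qed.

Lemma fdim_leP (X : lmodType B) d :
  (fdim X <= (d%:Z)%:E)%E <-> tor_vanish d (fun _ : X => True).
Proof.
rewrite inf_nat_leP; split=> [[k kd /flat_resolution_tor_vanish tv]|tv].
  elim: d kd => [|d ih]; first by rewrite leqn0 => /eqP <-.
  by rewrite leq_eqVlt ltnS => /orP[/eqP <- //|/ih/tor_vanishS].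
by exists d => //; apply: tor_vanish_flat_resolution.
Qed.

End FlatDimension.

(** * Ext through injective coresolutions *)

Section ExtComparison.
Variables (B : pzRingType) (S N : lmodType B).
Variables (P : left_resolution S) (J : right_resolution N).
Hypothesis projP : forall i, projective (P i).
Hypothesis injJ : forall j, injective_module (J j).

Lemma projective_lift (X Y Q : lmodType B) (g : {linear X -> Y})
    (h : {linear Q -> Y}) : projective Q -> (forall z, exists x, g x = h z) ->
  exists k : {linear Q -> X}, forall z, g (k z) = h z.
Proof.
move=> projQ gh; have hI := submodP_im g.
have gI x : exists x', g x' = g x by exists x.
have [|k kP] := projQ _ _ (submP_corestr hI gI) (submP_corestr hI gh).
  move=> y; have [x xy] := submP_valP y; exists x.
  by apply: (submP_val_inj (hP := hI)); rewrite submP_corestrE.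
exists k => z; rewrite -(submP_corestrE hI gI) kP submP_corestrE.
by [].
Qed.

(** Let Z^j be the kernel of J^j -> J^(j+1). Cocycles modulo boundaries form Ext^i(S, Z^j), so
    dimension shift along i + j = l joins Ext^l(S, N), at j = 0, to Hom(S, Z^l), at i = 0. *)
Definition cocycle i j (f : {linear P i -> J j}) : Prop :=
  (forall x, f (lres_d P i x) = 0) /\ (forall x, rres_d J j (f x) = 0).

Definition boundary i j (f : {linear P i -> J j}) : Prop :=
  match i return {linear P i -> J j} -> Prop with
  | 0 => fun f => forall x, f x = 0
  | i'.+1 => fun f => exists g : {linear P i' -> J j},
      (forall x, rres_d J j (g x) = 0) /\ forall x, f x = g (lres_d P i' x)
  end f.

Lemma extend_resolution i j (f : {linear P i.+1 -> J j}) :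
  (forall x, f (lres_d P i.+1 x) = 0) ->
  exists g : {linear P i -> J j}, forall x, g (lres_d P i x) = f x.
Proof.
move=> fd; have [|g gP] := @injective_graph_extends _ _ _ _ (@injJ j)
    (linear_graph_functional (g := lres_d P i) (h := f) _).
  by move=> x /lres_exact[y <-].
by exists g => x; apply: gP; exists x.
Qed.

Lemma extend_augmentation j (f : {linear P 0 -> J j}) :
  (forall x, f (lres_d P 0 x) = 0) ->
  exists g : {linear S -> J j}, forall x, g (lres_aug P x) = f x.
Proof.
move=> fd; have [|g gP] := @injective_graph_extends _ _ _ _ (@injJ j)
    (linear_graph_functional (g := lres_aug P) (h := f) _).
  by move=> x /lres_exact0[y <-].
by exists g => x; apply: gP; exists x.
Qed.

Lemma lift_cocycle i j (h : {linear P i -> J j.+1}) :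
  (forall x, rres_d J j.+1 (h x) = 0) ->
  exists k : {linear P i -> J j}, forall x, rres_d J j (k x) = h x.
Proof. by move=> dh; apply: projective_lift => // z; apply/rres_exact. Qed.

(** Induction on i: a cocycle of bidegree (i+1, j) extends to some g on P_i, as J_j is injective,
    and d g is a cocycle of bidegree (i, j+1). For i = 0 a cocycle comes from a map S -> J_l, which
    is zero. *)
Lemma zero_boundary l : (forall h : {linear S -> J l}, forall x, h x = 0) ->
  forall i j, (i + j)%N = l -> forall f : {linear P i -> J j},
  cocycle f -> boundary f.
Proof.
move=> h0; elim=> [|i ih] j ijl f [fd df] /=.
  move=> x; rewrite add0n in ijl; subst j.
  by have [g gf] := extend_augmentation fd; rewrite -gf h0.
have [g gf] := extend_resolution fd.
pose dg : {linear P i -> J j.+1} := (rres_d J j \o g : _ -> _).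
have dgc : cocycle dg.
  split=> x; first by rewrite /= gf df.
  by apply/rres_exact; exists (g x).
have := ih _ _ dg dgc; rewrite addnS -addSn => /(_ ijl).
have dgE x : dg x = rres_d J j (g x) by [].
case: i ih f g gf fd df ijl dg dgc dgE => [|i] ih f g gf fd df ijl dg dgc dgE /=.
  by move=> dg0; exists g; split=> x; rewrite ?gf // -dgE.
move=> [h [dh hE]]; have [k kh] := lift_cocycle dh.
exists (g \- (k \o lres_d P i) : {linear _ -> _}); split=> x /=.
  by rewrite linearB kh -hE dgE subrr.
rewrite gf (_ : lres_d P i (lres_d P i.+1 x) = 0); first by rewrite !linear0 addr0.
by apply/lres_exact; exists x.
Qed.

Lemma all_coboundary l : (forall h : {linear S -> J l}, forall x, h x = 0) ->
  forall f : {linear P l -> N}, Hom_cocycle f -> Hom_coboundary f.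
Proof.
move=> h0 f fd; pose af : {linear P l -> J 0} := (rres_aug J \o f : _ -> _).
have afc : cocycle af.
  split=> x; first by rewrite /af /= fd linear0.
  by apply/rres_exact0; exists (f x).
have afE x : af x = rres_aug J (f x) by [].
have := zero_boundary h0 (addn0 l) afc.
case: l h0 f fd af afc afE => [|l] h0 f fd af afc afE /=.
  by move=> af0 x; apply: (@rres_aug_inj _ _ J); rewrite linear0 -afE.
move=> [g [dg gE]]; have /choice[k kg] := fun x => (rres_exact0 (g x)).1 (dg x).
have kl : linear k.
  by move=> a x y; apply: (@rres_aug_inj _ _ J); rewrite linearP !kg linearP.
exists (linear_of kl) => x; apply: (@rres_aug_inj _ _ J).
by rewrite [RHS]kg -gE afE.
Qed.

(* Minimality of J and simplicity of S enter through the first hypothesis, see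
   [simple_minimal_differential]. *)
Lemma vanishing_hom l :
  (forall j (h : {linear S -> J j}) x, rres_d J j (h x) = 0) ->
  (forall f : {linear P l -> N}, Hom_cocycle f -> Hom_coboundary f) ->
  forall h : {linear S -> J l}, forall x, h x = 0.
Proof.
move=> Hd cob.
(* The same shift, now by induction on j; at j = 0 the cocycles take values in N, where [cob]
   applies. *)
have ind j i : (i + j)%N = l -> forall f : {linear P i -> J j},
    cocycle f -> boundary f.
  elim: j i => [|j ih] i ijl f [fd df].
    rewrite addn0 in ijl; subst l.
    have /choice[k kf] := fun x => (rres_exact0 (f x)).1 (df x).
    have kl : linear k.
      by move=> a x y; apply: (@rres_aug_inj _ _ J); rewrite linearP !kf linearP.
    have := cob (linear_of kl).
    have kc : Hom_cocycle (linear_of kl).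
      by move=> x; apply: (@rres_aug_inj _ _ J); rewrite linear0 [LHS]kf fd.
    move=> /(_ kc).
    case: i f fd df k kf kl kc {cob} => [|i] f fd df k kf kl kc /=.
      by move=> k0 x; rewrite -kf -[k x]/(linear_of kl x) k0 linear0.
    move=> [g gE]; exists (rres_aug J \o g : {linear _ -> _}); split=> x /=.
      by apply/rres_exact0; exists (g x).
    by rewrite -kf -gE.
  have [k kf] := lift_cocycle df.
  pose kd : {linear P i.+1 -> J j} := (k \o lres_d P i : _ -> _).
  have kdc : cocycle kd.
    split=> x /=; last by rewrite kf fd.
    by rewrite (_ : lres_d P i _ = 0) ?linear0 //; apply/lres_exact; exists x.
  have [|h [dh hE]] := ih i.+1 _ kd kdc; first by rewrite addSnnS.
  pose q : {linear P i -> J j} := (k \- h : {linear _ -> _}).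
  have qd x : q (lres_d P i x) = 0.
    by rewrite /q /= -hE /kd /= subrr.
  have dq x : rres_d J j (q x) = f x by rewrite /q /= linearB kf dh subr0.
  case: i ijl f fd df k kf kd kdc h dh hE q qd dq
    => [|i] ijl f fd df k kf kd kdc h dh hE q qd dq /=.
    (* For i = 0 the map q factors through S, so [Hd] kills f = d q. *)
    have [g gq] := extend_augmentation qd.
    by move=> x; rewrite -dq -gq Hd.
  have [g gq] := extend_resolution qd.
  exists (rres_d J j \o g : {linear _ -> _}); split=> x /=.
    by apply/rres_exact; exists (g x).
  by rewrite gq dq.
move=> h x; have [y <-] := lres_aug_surj P x.
have hc : cocycle (h \o lres_aug P : {linear P 0 -> J l}).
  split=> z /=; last exact: Hd.
  by rewrite (_ : lres_aug P _ = 0) ?linear0 //; apply/lres_exact0; exists z.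
exact: (ind l 0 (add0n l) _ hc).
Qed.

End ExtComparison.

(** By simplicity d h is zero or injective. If it is injective, h(S) meets the kernel of d in 0;
    this kernel contains an essential submodule, so h = 0. *)
Lemma simple_minimal_differential (B : pzRingType) (S N : lmodType B)
    (J : right_resolution N) :
  simple_module S -> minimal_injective J ->
  forall j (h : {linear S -> J j}) x, rres_d J j (h x) = 0.
Proof.
move=> [_ simS] [_ ess0 essS].
have key (X Y Z : lmodType B) (f : {linear X -> Y}) (g : {linear Y -> Z})
    (h : {linear S -> Y}) : (forall x, g (f x) = 0) -> essential_image f ->
    forall x, g (h x) = 0.
  move=> gf ess x; have hK := submodP_ker (g \o h : {linear S -> Z}).
  have [K0|KT] := simS _ (submodP_closed hK); last first.
    by have := KT x; rewrite to_predE => /asboolP.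
  have h0 y : h y = 0.
    have hI := submodP_im h.
    apply: (ess _ (submodP_closed hI)); last by apply/asboolP; exists y.
    move=> z /asboolP[s sz].
    have : s \in to_pred (fun s => (g \o h : {linear S -> Z}) s = 0).
      by apply/asboolP; rewrite /= sz gf.
    by rewrite K0 inE => /eqP s0; rewrite -sz s0 linear0.
  by rewrite h0 linear0.
case=> [|j] h x.
  apply: (key _ _ _ (rres_aug J) (rres_d J 0)) => // y.
  by apply/rres_exact0; exists y.
apply: (key _ _ _ (rres_d J j) (rres_d J j.+1)) => // y.
by apply/rres_exact; exists y.
Qed.

(** * Finite free resolutions and grade *)

Section FiniteFreeResolution.
Variables (B : pzRingType) (S : lmodType B).
Hypothesis nB : left_noetherian B.

Lemma projective_rows n : projective ('rV[B]_n : lmodType B).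
Proof.
move=> X Y g h surg; have /choice[x xP] := fun j : 'I_n => surg (h (delta_mx 0 j)).
have kl : linear (fun v : 'rV[B]_n => \sum_j v 0 j *: x j).
  move=> a u v; rewrite scaler_sumr -big_split; apply: eq_bigr => j _.
  by rewrite !mxE scalerDl scalerA.
exists (linear_of kl) => v; rewrite linear_sumZ [in RHS](row_sum_delta v) linear_sumZ.
by apply: eq_bigr => j _; rewrite xP.
Qed.

(** The sizes are bundled with the matrix, so that taking syzygies can be iterated. *)
Record rect_matrix := RectMatrix {
  rm_rows : nat; rm_cols : nat; rm_mx : 'M[B]_(rm_rows, rm_cols) }.

Definition row_exact k m n (E : 'M[B]_(k, m)) (D : 'M[B]_(m, n)) : Prop :=
  E *m D = 0 /\ forall v : 'rV_m, v *m D = 0 -> exists w : 'rV_k, v = w *m E.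

Fact syzygy_ex (D : rect_matrix) : exists E : {k : nat & 'M[B]_(k, rm_rows D)},
  row_exact (projT2 E) (rm_mx D).
Proof. by have [k [E exE]] := row_syzygy (rm_mx D) nB; exists (existT _ k E). Qed.

Definition next_syzygy (D : rect_matrix) : rect_matrix :=
  RectMatrix (projT2 (sval (cid (syzygy_ex D)))).

Lemma next_syzygyP D : row_exact (rm_mx (next_syzygy D)) (rm_mx D).
Proof. exact: (svalP (cid (syzygy_ex D))). Qed.

Lemma finite_free_resolution : fgP (fun _ : S => True) ->
  exists (n : nat -> nat) (D : forall i, 'M[B]_(n i.+1, n i))
    (aug : {linear 'rV[B]_(n 0%N) -> S}),
    [/\ forall x, exists v, aug v = x,
        forall v, aug v = 0 <-> exists w, v = w *m D 0%N &
        forall i, row_exact (D i.+1) (D i)].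
Proof.
move=> [n0 [x [_ xgen]]].
have al : linear (fun v : 'rV[B]_n0 => \sum_i v 0 i *: x i).
  move=> a u v; rewrite scaler_sumr -big_split; apply: eq_bigr => j _.
  by rewrite !mxE scalerDl scalerA.
pose aug : {linear 'rV[B]_n0 -> S} := linear_of al.
have [k [v [vaug vgen]]] := fgP_rows nB (submodP_ker aug).
pose D0 := RectMatrix (\matrix_i v i).
pose st i := iter i next_syzygy D0.
exists (fun i => rm_cols (st i)), (fun i => rm_mx (st i)), aug; split.
- move=> y; have [//|c ->] := xgen y; exists (\row_i c i).
  by apply: eq_bigr => i _; rewrite mxE.
- move=> w; split=> [/vgen[c ->]|[u ->]].
    exists (\row_i c i); rewrite mulmx_sum_row.
    by apply: eq_bigr => i _; rewrite rowK mxE.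
  rewrite mulmx_sum_row linear_sumZ big1 // => i _.
  by rewrite rowK vaug scaler0.
- by move=> i; apply: next_syzygyP.
Qed.

Section Resolution.
Variables (n : nat -> nat) (D : forall i, 'M[B]_(n i.+1, n i)).
Variable aug : {linear 'rV[B]_(n 0%N) -> S}.
Hypothesis augP : forall x, exists v, aug v = x.
Hypothesis aug0 : forall v, aug v = 0 <-> exists w, v = w *m D 0%N.
Hypothesis exD : forall i, row_exact (D i.+1) (D i).

(** Transparent, because the proofs below compute with its terms as row vectors and with its
    differentials as multiplication by [D i]. *)
Definition matrix_resolution : left_resolution S.
Proof.
refine (@LeftResolution B S (fun i => 'rV[B]_(n i))
  (fun i => (mulmxr (D i) : {linear 'rV[B]_(n i.+1) -> 'rV[B]_(n i)})) aug augP _ _).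
- by move=> v; rewrite aug0; split=> -[w wv]; exists w.
- move=> i v /=; split=> [/((exD i).2)[w ->]|[w <-]]; first by exists w.
  by rewrite -mulmxA (exD i).1 mulmx0.
Defined.

Lemma matrix_resolution_projective i : projective (matrix_resolution i).
Proof. exact: projective_rows. Qed.

Fact mulmx_col_linear i (c : 'cV[B]_(n i)) :
  linear (fun v : 'rV[B]_(n i) => (v *m c) 0 0 : B^o).
Proof. by move=> a u v; rewrite mulmxDl -scalemxAl !mxE. Qed.

Lemma linear_rowE m (f : {linear 'rV[B]_m -> B^o}) v :
  f v = (v *m \col_j (f (delta_mx 0 j) : B)) 0 0.
Proof.
rewrite {1}(row_sum_delta v) linear_sumZ mxE.
by apply: eq_bigr => j _; rewrite mxE.
Qed.

(** Linear forms on rows are columns, so Hom of the resolution into B is the complex of columns on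
    which the [D i] act from the left, and the vanishing of Ext is its exactness. *)
Lemma Ext_column_exact d : (forall i, (i <= d)%N -> ~ Ext_neq0 i S B^o) ->
  (forall c : 'cV_(n 0%N), D 0 *m c = 0 -> c = 0) /\
  forall i, (i < d)%N -> col_exact (D i) (D i.+1).
Proof.
move=> noExt.
have cob i (f : {linear matrix_resolution i -> B^o}) : (i <= d)%N ->
    Hom_cocycle f -> Hom_coboundary f.
  move=> id fc; apply: contrapT => nf; apply: (noExt i id).
  exists matrix_resolution; split; first exact: matrix_resolution_projective.
  by exists f.
have cocyc i (c : 'cV_(n i)) : D i *m c = 0 ->
    @Hom_cocycle _ _ matrix_resolution B^o i (linear_of (mulmx_col_linear c)).
  move=> Dc x; rewrite -[LHS]/((x *m D i *m c) 0 0).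
  by rewrite -mulmxA Dc mulmx0 mxE.
split=> [c /cocyc/(cob 0%N _ (leq0n d)) /= c0|i id].
  apply/matrixP => a b; rewrite ord1 [RHS]mxE.
  have := c0 (delta_mx 0 a); rewrite -[X in X = _]/((delta_mx 0 a *m c) 0 0).
  by rewrite -rowE mxE.
split=> [|c /cocyc/(cob _ _ id) /= [g gE]]; first by rewrite (exD i).1.
exists (\col_j (g (delta_mx 0 j) : B)); apply/matrixP => a b; rewrite ord1.
have := gE (delta_mx 0 a); rewrite -[X in X = _]/((delta_mx 0 a *m c) 0 0).
rewrite -rowE mxE => ->; rewrite linear_rowE.
by rewrite -mulmxA -rowE mxE.
Qed.

End Resolution.

(* If Ext^i(S, B) = 0 for all i <= d, the transposed finite free resolution of S
   exhibits its presentation matrix as a d-th syzygy, so Tor-vanishing of E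
   forces Hom(S, E) = 0. *)
Lemma Ext_neq0_of_hom (E : lmodType B) (h : {linear S -> E}) d :
  fgP (fun _ : S => True) -> tor_vanish d (fun _ : E => True) ->
  (exists x, h x <> 0) -> exists2 i, (i <= d)%N & Ext_neq0 i S B^o.
Proof.
move=> /finite_free_resolution[n [D [aug [augP aug0 exD]]]] tvE [x hx0].
apply: contrapT => noExt.
have [|D0 colD] := Ext_column_exact augP aug0 exD (d := d).
  by move=> i id exti; apply: noExt; exists i.
(* The dual complex is read backwards: [D d] counts as a 0-th syzygy and [D 0] as a d-th one. *)
have syzD j i : (i + j)%N = d -> syz j (D i).
  elim: j i => [//|j ih] i ijd; exists _, (D i.+1); split.
    by apply: ih; rewrite addSnnS.
  by apply: colD; rewrite -ijd addnS ltnS leq_addr.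
have syzD0 := syzD d 0%N (add0n d).
(* [D 0] is injective on columns, hence exact against a matrix with no column; Tor-vanishing then
   makes the tuple of the h (aug e_j) zero. *)
have ex0 : col_exact (0 : 'M[B]_(n 0%N, 0)) (D 0%N).
  split=> [|c /D0 ->]; first by rewrite mulmx0.
  by exists 0; rewrite mul0mx.
have [//|i|y _ ey] := tvE _ _ _ _ _ syzD0 ex0 (fun j => h (aug (delta_mx 0 j))).
  rewrite -(mxact_linear (h \o aug : {linear _ -> _})) /mxact /=.
  have -> : \sum_j D 0%N i j *: delta_mx 0 j = row i (D 0%N).
    rewrite [RHS]row_sum_delta; apply: eq_bigr => j _.
    by rewrite mxE.
  rewrite (_ : aug _ = 0) ?linear0 //; apply/aug0.
  by exists (delta_mx 0 i); rewrite -rowE.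
apply: hx0; have [v <-] := augP x; rewrite (row_sum_delta v).
rewrite (linear_sumZ aug) (linear_sumZ h) big1 // => j _.
by rewrite ey mxact0 scaler0.
Qed.

Lemma projective_resolution_exists : fgP (fun _ : S => True) ->
  exists P : left_resolution S, forall i, projective (P i).
Proof.
move=> /finite_free_resolution[n [D [aug [augP aug0 exD]]]].
exists (matrix_resolution augP aug0 exD).
exact: matrix_resolution_projective.
Qed.

Lemma simple_fg : simple_module S -> fgP (fun _ : S => True).
Proof.
move=> [[x x0] simS].
have hx : submodP (fun y => exists b : B, y = b *: x).
  split=> [|a _ _ [b ->] [b' ->]]; first by exists 0; rewrite scale0r.
  by exists (a * b + b'); rewrite scalerDl scalerA.
exists 1%N, (fun=> x); split=> // y _.
have [S0|ST] := simS _ (submodP_closed hx).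
  have := S0 x; rewrite to_predE inE (negPf x0) => /asboolPn[].
  by exists 1; rewrite scale1r.
have := ST y; rewrite to_predE => /asboolP[b ->]; exists (fun=> b).
by rewrite big_ord1.
Qed.

End FiniteFreeResolution.

(** * Central localization of modules *)

Section Restriction.
Variables (A B : pzRingType) (phi : {rmorphism A -> B}) (M : lmodType B).

(** The carrier stays M, so that elements pass between the two structures by conversion; the ring
    morphism is a phantom argument that selects the action. *)
Definition restr (_ : {rmorphism A -> B}) : Type := M.
Local Notation rM := (restr phi).
HB.instance Definition _ := GRing.Zmodule.on rM.

Definition restr_scale (a : A) (x : rM) : rM := phi a *: (x : M).

Fact restr_scaleA a b x : restr_scale a (restr_scale b x) = restr_scale (a * b) x.
Proof. by rewrite /restr_scale scalerA rmorphM. Qed.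
Fact restr_scale1 : left_id 1 restr_scale.
Proof. by move=> x; rewrite /restr_scale rmorph1 scale1r. Qed.
Fact restr_scaleDr : right_distributive restr_scale +%R.
Proof. by move=> a x y; rewrite /restr_scale scalerDr. Qed.
Fact restr_scaleDl x : {morph restr_scale^~ x : a b / a + b}.
Proof. by move=> a b; rewrite /restr_scale rmorphD scalerDl. Qed.
HB.instance Definition _ := GRing.Zmodule_isLmodule.Build A rM
  restr_scaleA restr_scale1 restr_scaleDr restr_scaleDl.

Lemma restrZ a (x : rM) : a *: x = phi a *: (x : M). Proof. by []. Qed.

End Restriction.

Section Localization.
Variables (R : comPzRingType) (A : centralAlg R) (p : primeSpec R).
Local Notation Ap := (central_loc A p).

Definition loc_iota (a : A) : Ap := cfrac a (denom1 p).

Fact loc_iota_zmod : zmod_morphism loc_iota.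
Proof.
move=> a b; rewrite /loc_iota -[- cfrac b _]/(loc_opp _) loc_oppE fracD.
by apply: frac_ext; rewrite dvalM dval1 rmorph1 !mul1r rmorph1 !mul1r.
Qed.
HB.instance Definition _ := GRing.isZmodMorphism.Build A Ap loc_iota loc_iota_zmod.

Fact loc_iota_monoid : monoid_morphism loc_iota.
Proof.
split=> // a b; rewrite /loc_iota fracM.
by apply: frac_ext; rewrite dvalM dval1 !rmorph1 !mul1r rmorph1 mul1r.
Qed.
HB.instance Definition _ :=
  GRing.isMonoidMorphism.Build A Ap loc_iota loc_iota_monoid.

Local Notation iota := (loc_iota : {rmorphism A -> Ap}).

Definition den (s : denom p) : A := alg_map A (dval s).
Definition inv_den (s : denom p) : Ap := cfrac 1 s.

Lemma den_comm s a : den s * a = a * den s.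
Proof. exact: alg_mapC. Qed.

Lemma denM s t : den (denomM s t) = den s * den t.
Proof. by rewrite /den dvalM rmorphM. Qed.

Lemma den1 : den (denom1 p) = 1.
Proof. by rewrite /den dval1 rmorph1. Qed.

Lemma inv_denK s : inv_den s * iota (den s) = 1.
Proof.
rewrite /inv_den /= /loc_iota fracM -[RHS]/(cfrac 1 (denom1 p)).
by apply: frac_ext; rewrite dvalM dval1 rmorph1 mulr1 mul1r mulr1 mul1r.
Qed.

Lemma iota_den_comm s (b : Ap) : iota (den s) * b = b * iota (den s).
Proof.
have [a [t ->]] := fracP b; rewrite /= /loc_iota !fracM.
by apply: frac_ext; rewrite !dvalM dval1 mulr1 mul1r den_comm.
Qed.

Lemma iota_den_swap s t (b : Ap) :
  iota (den s) * (iota (den t) * b) = b * (iota (den t) * iota (den s)).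
Proof. by rewrite iota_den_comm (iota_den_comm t) -mulrA. Qed.

Lemma den_invK s : iota (den s) * inv_den s = 1.
Proof. by rewrite iota_den_comm inv_denK. Qed.

Lemma inv_den_comm s (b : Ap) : inv_den s * b = b * inv_den s.
Proof.
rewrite -[LHS]mulr1 -[in LHS](den_invK s) !mulrA -[_ * b * _]mulrA.
by rewrite -iota_den_comm mulrA inv_denK mul1r.
Qed.

Lemma fracE a s : cfrac a s = inv_den s * iota a :> Ap.
Proof.
rewrite /inv_den /= /loc_iota fracM mul1r; apply: frac_ext.
by rewrite dvalM dval1 mulr1.
Qed.

Lemma loc_clear (b : Ap) : exists s a, iota (den s) * b = iota a.
Proof.
have [a [s ->]] := fracP b; exists s, a.
by rewrite fracE mulrA den_invK mul1r.
Qed.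

Lemma iota_eq0 a : iota a = 0 -> exists s, den s * a = 0.
Proof. by move=> /frac_eq0. Qed.

Section DenominatorsOnModules.
Variable L : lmodType Ap.

Lemma den_inj s (x y : L) : iota (den s) *: x = iota (den s) *: y -> x = y.
Proof.
move=> xy; rewrite -[x]scale1r -(inv_denK s) -scalerA xy scalerA inv_denK.
exact: scale1r.
Qed.

Lemma den_scaleC s (b : Ap) (x : L) :
  iota (den s) *: (b *: x) = b *: (iota (den s) *: x).
Proof. by rewrite !scalerA iota_den_comm. Qed.

End DenominatorsOnModules.

Lemma common_denominator (I : finType) (s : I -> denom p) :
  exists t : denom p, forall i, exists r : R, dval t = r * dval (s i).
Proof.
suff ord n (s' : 'I_n -> denom p) :
    exists t : denom p, forall i, exists r : R, dval t = r * dval (s' i).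
  have [t tP] := ord _ (fun k : 'I_#|I| => s (enum_val k)); exists t => i.
  by have [r rE] := tP (enum_rank i); exists r; rewrite enum_rankK in rE.
elim: n s' => [|n ih] s'; first by exists (denom1 p) => -[].
have [t tP] := ih (fun i => s' (lift ord0 i)).
exists (denomM t (s' ord0)) => i; case: (unliftP ord0 i) => [j ->|->].
  have [r rE] := tP j; exists (r * dval (s' ord0)).
  by rewrite dvalM rE -!mulrA; congr (_ * _); rewrite mulrC.
by exists (dval t); rewrite dvalM.
Qed.

(* A characterization instead of a construction, so that it covers both
   A -> A_p and the modules of fractions [locmod]. *)
Definition is_loc (M : lmodType A) (L : lmodType Ap)
    (lam : {linear M -> restr L iota}) : Prop :=
  (forall x, lam x = 0 -> exists s, den s *: x = 0) /\
  forall y : L, exists s x, iota (den s) *: y = lam x :> L.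

Lemma loc_linearZ (M : lmodType A) (L : lmodType Ap)
    (lam : {linear M -> restr L iota}) a x :
  (lam (a *: x) : L) = iota a *: (lam x : L).
Proof. by rewrite linearZ. Qed.

(** A fraction for b y + y' is computed from fractions for b, y and y'. This serves both the
    linearity of localized maps and the closure of localized submodules. *)
Lemma loc_combination (M : lmodType A) (L : lmodType Ap)
    (lam : {linear M -> restr L iota}) (b : Ap) t a s s' (y y' : L) x x' :
  iota (den t) * b = iota a ->
  iota (den s) *: y = lam x -> iota (den s') *: y' = lam x' ->
  iota (den (denomM t (denomM s s'))) *: (b *: y + y') =
    lam ((a * den s') *: x + (den t * den s) *: x') :> L.
Proof.
move=> ea e e'; have swap : iota (den t) * (iota (den s) * iota (den s')) * b =
    iota (den t) * b * iota (den s') * iota (den s).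
  by rewrite -!mulrA (iota_den_swap s s').
rewrite scalerDr linearD !loc_linearZ !denM !rmorphM -e -e' -ea !scalerA.
by rewrite swap (mulrA (iota (den t))).
Qed.

Lemma loc_clear_family (M : lmodType A) (L : lmodType Ap)
    (lam : {linear M -> restr L iota}) (I : finType) (y : I -> L) : is_loc lam ->
  exists s (x : I -> M), forall i, iota (den s) *: y i = lam (x i) :> L.
Proof.
move=> [_ sur]; have /choice[s /choice[x xP]] := fun i => sur (y i).
have [t /choice[r rP]] := common_denominator s.
exists t, (fun i => alg_map A (r i) *: x i) => i.
rewrite loc_linearZ -xP scalerA -rmorphM; congr (iota _ *: _).
by rewrite /den (rP i) rmorphM.
Qed.

Lemma loc_kill_family (M : lmodType A) (L : lmodType Ap)
    (lam : {linear M -> restr L iota}) (I : finType) (x : I -> M) : is_loc lam ->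
  (forall i, lam (x i) = 0) -> exists s, forall i, den s *: x i = 0.
Proof.
move=> [ker _] x0; have /choice[s sP] := fun i => ker _ (x0 i).
have [t tP] := common_denominator s; exists t => i.
have [r rE] := tP i; rewrite /den rE rmorphM -scalerA.
by rewrite [alg_map A (dval _) *: _](sP i) scaler0.
Qed.

Fact regular_loc_linear : linear (iota : A^o -> restr Ap^o iota).
Proof. by move=> a x y; rewrite [LHS]rmorphD [iota (a *: x)]rmorphM. Qed.

Definition regular_loc : {linear A^o -> restr Ap^o iota} :=
  linear_of regular_loc_linear.

Lemma regular_is_loc : is_loc regular_loc.
Proof.
split=> [x|y]; first exact: iota_eq0.
by have [s [a e]] := loc_clear y; exists s, a.
Qed.

Lemma clear_family (I : finType) (b : I -> Ap) :
  exists s (a : I -> A), forall i, iota (den s) * b i = iota (a i).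
Proof. exact: (loc_clear_family (b : I -> Ap^o) regular_is_loc). Qed.

Lemma kill_family (I : finType) (a : I -> A) : (forall i, iota (a i) = 0) ->
  exists s, forall i, den s * a i = 0.
Proof. exact: (loc_kill_family (x := a : I -> A^o) regular_is_loc). Qed.

Section LocMap.
Variables (M N : lmodType A) (L K : lmodType Ap).
Variables (lam : {linear M -> restr L iota}) (kap : {linear N -> restr K iota}).
Hypotheses (locM : is_loc lam) (locN : is_loc kap).
Variable f : {linear M -> N}.

(** The value at y is characterized by all fractions x/s that represent y at once, so that linearity
    reduces to a computation with numerators. *)
Lemma loc_map_exists : exists g : {linear L -> K}, forall x, g (lam x) = kap (f x).
Proof.
have ex y : exists z : K, forall s x, iota (den s) *: y = lam x :> L ->
    iota (den s) *: z = kap (f x) :> K.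
  have [s0 [x0 e0]] := locM.2 y.
  exists (inv_den s0 *: (kap (f x0) : K)) => s x e.
  apply: (@den_inj _ s0); rewrite den_scaleC (scalerA (iota (den s0))) den_invK scale1r.
  have : lam (den s0 *: x - den s *: x0) = 0.
    rewrite linearB; apply/eqP; rewrite subr_eq0; apply/eqP.
    by rewrite (loc_linearZ lam (den s0)) (loc_linearZ lam (den s)) -e -e0; apply: den_scaleC.
  move=> /locM.1[u]; rewrite scalerBr => /eqP; rewrite subr_eq0 => /eqP.
  move=> /(congr1 (fun z => kap (f z) : K)).
  by rewrite !(linearZ_LR f) !loc_linearZ => /den_inj/esym.
have [g gP] := choice ex.
have gl : linear g.
  move=> b y y'; have [s [x e]] := locM.2 y; have [s' [x' e']] := locM.2 y'.
  have [t [a ea]] := loc_clear b.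
  apply: (@den_inj _ (denomM t (denomM s s'))).
  rewrite (gP _ _ _ (loc_combination ea e e')) !(linearP f) (linearZ_LR f).
  by rewrite -(loc_combination ea (gP _ _ _ e) (gP _ _ _ e')).
exists (linear_of gl) => x; have := gP (lam x : L) (denom1 p) x.
by rewrite den1 rmorph1 !scale1r; apply.
Qed.

Lemma loc_map_inj (g : {linear L -> K}) : (forall x, g (lam x) = kap (f x)) ->
  injective f -> injective g.
Proof.
move=> gP injf; apply: linear_inj0 => y gy0.
have [s [x e]] := locM.2 y.
have : kap (f x) = 0 by rewrite -gP -e linearZ_LR gy0 scaler0.
move=> /locN.1[u]; rewrite -linearZ_LR -[RHS](linear0 f) => /injf ux0.
have ulx : iota (den u) *: (lam x : L) = 0 by rewrite -loc_linearZ ux0 linear0.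
by apply: (@den_inj _ s); apply: (@den_inj _ u); rewrite e ulx !scaler0.
Qed.

Lemma loc_map_surj (g : {linear L -> K}) : (forall x, g (lam x) = kap (f x)) ->
  (forall y, exists x, f x = y) -> forall z, exists y, g y = z.
Proof.
move=> gP surf z; have [s [y e]] := locN.2 z; have [x fx] := surf y.
exists (inv_den s *: (lam x : L)).
by rewrite linearZ_LR gP fx -e scalerA inv_denK scale1r.
Qed.

End LocMap.

Lemma loc_map_exact (M1 M2 M3 : lmodType A) (L1 L2 L3 : lmodType Ap)
    (l1 : {linear M1 -> restr L1 iota}) (l2 : {linear M2 -> restr L2 iota})
    (l3 : {linear M3 -> restr L3 iota}) (f1 : {linear M1 -> M2})
    (f2 : {linear M2 -> M3}) (g1 : {linear L1 -> L2}) (g2 : {linear L2 -> L3}) :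
  is_loc l1 -> is_loc l2 -> is_loc l3 ->
  (forall x, g1 (l1 x) = l2 (f1 x)) -> (forall x, g2 (l2 x) = l3 (f2 x)) ->
  (forall x, f2 x = 0 <-> exists y, f1 y = x) ->
  forall x, g2 x = 0 <-> exists y, g1 y = x.
Proof.
move=> loc1 loc2 loc3 g1P g2P ex y; split=> [g2y0|[z <-]]; last first.
  have [s [x e]] := loc1.2 z; apply: (@den_inj _ s).
  rewrite -!linearZ_LR e g1P g2P (_ : f2 (f1 x) = 0) ?linear0 ?scaler0 //.
  by apply/ex; exists x.
have [s [x e]] := loc2.2 y.
have : l3 (f2 x) = 0 by rewrite -g2P -e linearZ_LR g2y0 scaler0.
move=> /loc3.1[u]; rewrite -linearZ_LR => /ex[z f1z].
exists (inv_den s *: (inv_den u *: (l1 z : L1))).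
rewrite !linearZ_LR g1P f1z loc_linearZ (scalerA (inv_den u)) inv_denK scale1r -e.
by rewrite scalerA inv_denK scale1r.
Qed.

End Localization.

Arguments den {R A p} s.
Arguments inv_den {R A p} s.

(** * Modules of fractions *)

Section LocalizedModule.
Variables (R : comPzRingType) (A : centralAlg R) (p : primeSpec R).
Variable M : lmodType A.
Local Notation Ap := (central_loc A p).
Local Open Scope quotient_scope.

Definition ract_mod (r : R) (x : M) : M := alg_map A r *: x.
Local Notation "r .* x" := (ract_mod r x) (at level 40).

Lemma ract_modA r s x : r .* (s .* x) = (r * s) .* x.
Proof. by rewrite /ract_mod scalerA rmorphM. Qed.

Lemma ract_modD r x y : r .* (x + y) = r .* x + r .* y.
Proof. exact: scalerDr. Qed.

Lemma ract_modZ r a x : r .* (a *: x) = a *: (r .* x).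
Proof. by rewrite /ract_mod !scalerA alg_mapC. Qed.

Lemma ract_mod1 x : 1 .* x = x.
Proof. by rewrite /ract_mod rmorph1 scale1r. Qed.

Definition mfracs : Type := M * denom p.
HB.instance Definition _ := Choice.on mfracs.

Definition mfrac_equiv (x y : mfracs) : bool :=
  `[< exists u : denom p,
        (dval u * dval y.2) .* x.1 = (dval u * dval x.2) .* y.1 >].

Lemma mfrac_equiv_refl : reflexive mfrac_equiv.
Proof. by move=> x; apply/asboolP; exists (denom1 p). Qed.

Lemma mfrac_equiv_sym : symmetric mfrac_equiv.
Proof. by move=> x y; apply/asboolP/asboolP => -[u e]; exists u; rewrite e. Qed.

Lemma mfrac_equiv_trans : transitive mfrac_equiv.
Proof.
move=> y x z /asboolP[u xy] /asboolP[v yz]; apply/asboolP.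
exists (denomM (denomM u v) y.2); rewrite !dvalM.
have -> : dval u * dval v * dval y.2 * dval z.2
  = (dval v * dval z.2) * (dval u * dval y.2) by ring.
rewrite -ract_modA xy ract_modA.
have -> : dval v * dval z.2 * (dval u * dval x.2)
  = (dval u * dval x.2) * (dval v * dval z.2) by ring.
by rewrite -ract_modA yz ract_modA; congr (_ .* _); ring.
Qed.

Canonical mfrac_equiv_equiv :=
  EquivRel mfrac_equiv mfrac_equiv_refl mfrac_equiv_sym mfrac_equiv_trans.

Definition locmod : Type := {eq_quot mfrac_equiv}.
HB.instance Definition _ : EqQuotient _ mfrac_equiv locmod :=
  EqQuotient.on locmod.
HB.instance Definition _ := Choice.on locmod.

Definition mfrac (x : M) (s : denom p) : locmod :=
  \pi_locmod ((x, s) : mfracs).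

Lemma mfrac_eqP x y s t : mfrac x s = mfrac y t <->
  exists u : denom p, (dval u * dval t) .* x = (dval u * dval s) .* y.
Proof.
by split=> [/eqmodP/asboolP[u e]|[u e]]; [exists u|apply/eqmodP/asboolP; exists u].
Qed.

Lemma mfrac_ext x y s t : dval t .* x = dval s .* y -> mfrac x s = mfrac y t.
Proof.
by move=> e; apply/mfrac_eqP; exists (denom1 p); rewrite dval1 !mul1r.
Qed.

Lemma mfracP (z : locmod) : exists x s, z = mfrac x s.
Proof.
by exists (repr z).1, (repr z).2; rewrite /mfrac -surjective_pairing reprK.
Qed.

Lemma repr_mfrac x s : exists u : denom p,
  (dval u * dval s) .* (repr (mfrac x s)).1 = (dval u * dval (repr (mfrac x s)).2) .* x.
Proof.
by apply/mfrac_eqP; rewrite /mfrac -surjective_pairing reprK.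
Qed.

Definition locmod_add (y z : locmod) : locmod :=
  mfrac (dval (repr z).2 .* (repr y).1 + dval (repr y).2 .* (repr z).1)
    (denomM (repr y).2 (repr z).2).
Definition locmod_opp (z : locmod) : locmod := mfrac (- (repr z).1) (repr z).2.
Definition locmod_scale (b : Ap) (z : locmod) : locmod :=
  mfrac ((repr b).1 *: (repr z).1) (denomM (repr b).2 (repr z).2).

Lemma locmod_addE x y s t : locmod_add (mfrac x s) (mfrac y t) =
  mfrac (dval t .* x + dval s .* y) (denomM s t).
Proof.
rewrite /locmod_add; have [u eu] := repr_mfrac x s; have [v ev] := repr_mfrac y t.
move: (repr (mfrac x s)) (repr (mfrac y t)) eu ev => [x' s'] [y' t'] /= eu ev.
apply/mfrac_eqP; exists (denomM u v).
rewrite !dvalM !ract_modD !ract_modA; congr (_ + _).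
  have -> : dval u * dval v * (dval s * dval t) * dval t'
    = (dval v * dval t * dval t') * (dval u * dval s) by ring.
  by rewrite -ract_modA eu ract_modA; congr (_ .* _); ring.
have -> : dval u * dval v * (dval s * dval t) * dval s'
  = (dval u * dval s * dval s') * (dval v * dval t) by ring.
by rewrite -ract_modA ev ract_modA; congr (_ .* _); ring.
Qed.

Lemma locmod_oppE x s : locmod_opp (mfrac x s) = mfrac (- x) s.
Proof.
rewrite /locmod_opp; have [u eu] := repr_mfrac x s.
apply/mfrac_eqP; exists u; rewrite /ract_mod !scalerN.
by congr (- _).
Qed.

Lemma locmod_scaleE a s x t :
  locmod_scale (cfrac a s) (mfrac x t) = mfrac (a *: x) (denomM s t).
Proof.
rewrite /locmod_scale; have [v ev] := repr_mfrac x t.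
have /frac_eqP[u eu] := repr_frac (cfrac a s : Ap).
move: (repr (cfrac a s)) (repr (mfrac x t)) eu ev => [a' s'] [x' t'] /= eu ev.
apply/mfrac_eqP; exists (denomM u v); rewrite !dvalM.
have split_scale q r b y : (q * r) .* (b *: y) = (alg_map A q * b) *: (r .* y).
  by rewrite -ract_modA ract_modZ /ract_mod !scalerA.
have -> : dval u * dval v * (dval s * dval t)
  = (dval u * dval s) * (dval v * dval t) by ring.
rewrite split_scale eu ev -split_scale.
by congr (_ .* _); ring.
Qed.

Lemma locmod_addA : associative locmod_add.
Proof.
move=> x y z; have [a [s ->]] := mfracP x; have [b [t ->]] := mfracP y.
have [c [u ->]] := mfracP z; rewrite !locmod_addE; apply: mfrac_ext.
rewrite !dvalM !ract_modD !ract_modA -addrA.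
by congr (_ .* _ + (_ .* _ + _ .* _)); ring.
Qed.

Lemma locmod_addC : commutative locmod_add.
Proof.
move=> x y; have [a [s ->]] := mfracP x; have [b [t ->]] := mfracP y.
rewrite !locmod_addE; apply: mfrac_ext; rewrite addrC !dvalM.
by congr (_ .* _); rewrite mulrC.
Qed.

Lemma locmod_add0 : left_id (mfrac 0 (denom1 p)) locmod_add.
Proof.
move=> x; have [a [s ->]] := mfracP x; rewrite locmod_addE; apply: mfrac_ext.
by rewrite /ract_mod scaler0 add0r dvalM dval1 mul1r rmorph1 scale1r.
Qed.

Lemma locmod_addN : left_inverse (mfrac 0 (denom1 p)) locmod_opp locmod_add.
Proof.
move=> x; have [a [s ->]] := mfracP x; rewrite locmod_oppE locmod_addE.
by apply: mfrac_ext; rewrite /ract_mod scalerN addNr !scaler0.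
Qed.

HB.instance Definition _ :=
  GRing.isZmodule.Build locmod locmod_addA locmod_addC locmod_add0 locmod_addN.

Lemma mfracD x y s t :
  mfrac x s + mfrac y t = mfrac (dval t .* x + dval s .* y) (denomM s t).
Proof. exact: locmod_addE. Qed.

Fact locmod_scaleA b c z :
  locmod_scale b (locmod_scale c z) = locmod_scale (b * c) z.
Proof.
have [x [s ->]] := mfracP z; have [a [t ->]] := fracP b; have [a' [u ->]] := fracP c.
rewrite fracM !locmod_scaleE scalerA; apply: mfrac_ext.
by rewrite !dvalM mulrA.
Qed.

Fact locmod_scale1 : left_id 1 locmod_scale.
Proof.
move=> z; have [x [s ->]] := mfracP z.
rewrite -[1]/(cfrac 1 (denom1 p) : Ap) locmod_scaleE scale1r; apply: mfrac_ext.
by rewrite dvalM dval1 mul1r.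
Qed.

Fact locmod_scaleDr : right_distributive locmod_scale +%R.
Proof.
move=> b y z; have [x [s ->]] := mfracP y; have [x' [t ->]] := mfracP z.
have [a [u ->]] := fracP b; rewrite mfracD !locmod_scaleE mfracD; apply: mfrac_ext.
rewrite !dvalM scalerDr -!ract_modZ !ract_modD !ract_modA.
by congr (_ .* _ + _ .* _); ring.
Qed.

Fact locmod_scaleDl z : {morph locmod_scale^~ z : b c / b + c}.
Proof.
move=> b c; have [x [s ->]] := mfracP z; have [a [t ->]] := fracP b.
have [a' [u ->]] := fracP c; rewrite fracD !locmod_scaleE mfracD; apply: mfrac_ext.
rewrite !dvalM scalerDl -!scalerA -[X in _ .* (X + _)]/(_ .* _).
rewrite -[X in _ .* (_ + X)]/(_ .* _) !ract_modD !ract_modA.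
by congr (_ .* _ + _ .* _); ring.
Qed.

HB.instance Definition _ := GRing.Zmodule_isLmodule.Build Ap locmod
  locmod_scaleA locmod_scale1 locmod_scaleDr locmod_scaleDl.

Lemma mfracZ a s x t : cfrac a s *: mfrac x t = mfrac (a *: x) (denomM s t).
Proof. exact: locmod_scaleE. Qed.

Local Notation iota := (@loc_iota R A p : {rmorphism A -> Ap}).

Fact mfrac1_linear : linear (fun x => mfrac x (denom1 p) : restr locmod iota).
Proof.
move=> a x y; rewrite -[_ *: _ in RHS]/(cfrac a (denom1 p) *: mfrac x (denom1 p)).
rewrite mfracZ -[_ + _ in RHS]/(mfrac _ _ + mfrac y _) mfracD; apply: mfrac_ext.
by rewrite !dvalM dval1 !mul1r !ract_mod1.
Qed.

Definition to_locmod : {linear M -> restr locmod iota} := linear_of mfrac1_linear.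

Lemma to_locmod_is_loc : is_loc to_locmod.
Proof.
split=> [x|y].
  rewrite -[X in _ = X]/(mfrac 0 (denom1 p)) => /mfrac_eqP[u].
  by rewrite !dval1 !mulr1 /ract_mod scaler0 => e; exists u.
have [x [s ->]] := mfracP y; exists s, x.
rewrite -[LHS]/(cfrac (den s) (denom1 p) *: mfrac x s) mfracZ; apply: mfrac_ext.
by rewrite dvalM dval1 mul1r ract_mod1.
Qed.

End LocalizedModule.

(** * Transfer between A and its localizations *)

Lemma central_scale_mulmx (B : pzRingType) m n k (z : B) (D : 'M[B]_(m, n))
    (w : 'M[B]_(n, k)) : (forall b, z * b = b * z) ->
  D *m (z *: w) = z *: (D *m w).
Proof.
move=> zC; apply/matrixP => i j; rewrite !mxE mulr_sumr; apply: eq_bigr => l _.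
by rewrite !mxE mulrA -zC mulrA.
Qed.

Lemma col_exact_factor (B : pzRingType) k n m l (D' : 'M[B]_(n, k))
    (D : 'M[B]_(m, n)) (F : 'M[B]_(n, l)) :
  col_exact D' D -> D *m F = 0 -> exists W, F = D' *m W.
Proof.
move=> [_ Dgen] DF; have /choice[w wP] : forall j, exists w, col j F = D' *m w.
  by move=> j; apply: Dgen; rewrite colE mulmxA DF mul0mx.
exists (\matrix_(i, j) w j i 0); apply/matrixP => i j.
have /matrixP/(_ i 0) := wP j; rewrite !mxE => ->.
by apply: eq_bigr => a _; rewrite mxE.
Qed.

Section LocalTransfer.
Variables (R : comPzRingType) (A : centralAlg R) (p : primeSpec R).
Local Notation Ap := (central_loc A p).
Local Notation iota := (@loc_iota R A p : {rmorphism A -> Ap}).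

(** An ideal is generated by generators of its contraction to A, as every fraction is a unit times a
    numerator. *)
Lemma loc_lnoeth : left_noetherian A -> left_noetherian Ap.
Proof.
move=> nA I hI; have hI' := closed_submodP hI.
have [|n [a [aI agen]]] := @left_noetherianP _ nA (fun a => (iota a : Ap^o) \in I).
  split=> [|a x y xI yI]; first by rewrite [iota _]rmorph0; apply: submod0 hI'.
  rewrite -[iota _]/(iota ((a : A) * (x : A) + (y : A))) rmorphD rmorphM.
  exact: (submodZD hI' (iota a) xI yI).
exists n, (fun i => iota (a i)); split=> // b bI.
have [s [a0 a0E]] := loc_clear b.
have [|c a0c] := agen a0; first by rewrite -a0E; apply: (submodZ hI').
exists (fun i => inv_den s * iota (c i)).
rewrite -[LHS]mul1r -(inv_denK A s) -mulrA a0E a0c [iota _]rmorph_sum mulr_sumr.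
apply: eq_bigr => i _; rewrite -[RHS]/(inv_den s * iota (c i) * iota (a i)).
by rewrite -mulrA -rmorphM.
Qed.

Lemma loc_rnoeth : left_noetherian A^c -> left_noetherian Ap^c.
Proof.
move=> nA I hI; have hI' := closed_submodP hI.
have [|n [a [aI agen]]] := @left_noetherianP _ nA (fun a => (iota a : (Ap^c)^o) \in I).
  split=> [|a x y xI yI]; first by rewrite [iota _]rmorph0; apply: submod0 hI'.
  rewrite -[iota _]/(iota ((x : A) * (a : A) + (y : A))) rmorphD rmorphM.
  exact: (submodZD hI' (iota a : Ap^c) xI yI).
exists n, (fun i => iota (a i)); split=> // b bI.
have [s [a0 a0E]] := loc_clear (b : Ap).
have [|c a0c] := agen a0.
  by rewrite -a0E iota_den_comm; apply: (submodZ hI' (iota (den s) : Ap^c) bI).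
exists (fun i => inv_den s * iota (c i) : Ap).
rewrite -[LHS](mul1r (b : Ap)) -(inv_denK A s) -mulrA a0E a0c [iota _]rmorph_sum.
rewrite mulr_sumr; apply: eq_bigr => i _.
rewrite -[RHS]/(iota (a i) * (inv_den s * iota (c i)) : Ap).
have -> : iota (c i *: a i) = iota (a i : A) * iota (c i : A).
  exact: (rmorphM iota (a i : A) (c i : A)).
by rewrite [RHS]mulrA -(inv_den_comm s (iota (a i : A))) -mulrA.
Qed.

(** The relations among the numerators a_i are generated by the rows of a finite matrix E. The
    entries of E x vanish in L, hence one denominator u kills them all, and Baer's criterion in M
    applies to the family u x_j. *)
Lemma loc_injective (M : lmodType A) (L : lmodType Ap)
    (lam : {linear M -> restr L iota}) : left_noetherian A -> is_loc lam ->
  injective_module M -> injective_module L.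
Proof.
move=> nA locM /injective_baer_fg bM.
apply: (baer_fg_injective (loc_lnoeth nA)) => n b y _ by0.
have [s [a ba]] := clear_family b; have [t [x yx]] := loc_clear_family y locM.
have [k [E [Ea Egen]]] := row_syzygy (\col_i a i) nA.
have Ey i : lam (\sum_j E i j *: x j) = 0.
  rewrite linear_sum -[RHS](scaler0 L (iota (den t))).
  rewrite -[in RHS](by0 (fun j => iota (E i j))).
    rewrite scaler_sumr; apply: eq_bigr => j _.
    by rewrite [LHS]loc_linearZ -yx den_scaleC.
  rewrite -[LHS]mul1r -(inv_denK A s) -mulrA mulr_sumr.
  rewrite (eq_bigr (fun j => iota (E i j * a j))); last first.
    by move=> j _; rewrite mulrA iota_den_comm -mulrA ba rmorphM.
  rewrite -rmorph_sum; have /matrixP/(_ i 0) := Ea; rewrite !mxE => Ea0.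
  rewrite (_ : \sum_j _ = 0) ?rmorph0 ?mulr0 // -[RHS]Ea0.
  by apply: eq_bigr => j _; rewrite mxE.
have [u uP] := loc_kill_family locM Ey.
have [//|c ca0|z _ xz] := bM n a (fun j => den u *: x j).
  have [|w cw] := Egen (\row_j c j).
    apply/matrixP => i j; rewrite mxE [RHS]mxE -[RHS]ca0.
    by apply: eq_bigr => l _; rewrite !mxE.
  transitivity (\sum_i w 0 i *: (den u *: \sum_j E i j *: x j)); last first.
    by rewrite big1 // => i _; rewrite uP scaler0.
  rewrite (eq_bigr (fun j => \sum_i (w 0 i * E i j) *: (den u *: x j))); last first.
    move=> j _; have /matrixP/(_ 0 j) := cw; rewrite !mxE => ->.
    by rewrite scaler_suml.
  rewrite exchange_big; apply: eq_bigr => i _; rewrite !scaler_sumr.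
  by apply: eq_bigr => j _; rewrite !scalerA -!mulrA den_comm.
(* From b_i = a_i/s, y_i = x_i/t and u x_i = a_i z it follows that y_i = b_i (s z)/(t u). *)
exists (inv_den u *: (inv_den t *: (iota (den s) *: (lam z : L)))) => // i.
apply: (@den_inj _ _ _ _ t); apply: (@den_inj _ _ _ _ u).
rewrite yx -loc_linearZ xz loc_linearZ -ba.
rewrite !(den_scaleC _ (b i)) (den_scaleC t (inv_den u)).
rewrite (scalerA _ (inv_den u)) den_invK scale1r.
by rewrite (scalerA _ (inv_den t)) den_invK scale1r scalerA iota_den_comm.
Qed.

(** The numerator n0 of y is multiplied by a denominator t for which the annihilator of n1 = t n0 is
    maximal, so that further denominators do not enlarge it. The ideal of all a with a n1 in the
    image of f is generated by finitely many a_i. If all a_i n1 became 0 in K, one denominator u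
    would kill them, and every multiple c u n1 in the image of f would vanish, against
    essentiality. *)
Lemma loc_essential (M N : lmodType A) (L K : lmodType Ap)
    (lam : {linear M -> restr L iota}) (kap : {linear N -> restr K iota})
    (f : {linear M -> N}) (g : {linear L -> K}) :
  left_noetherian A -> is_loc lam -> is_loc kap -> (forall x, g (lam x) = kap (f x)) ->
  essential_image f -> essential_image g.
Proof.
move=> nA locM locN gP /essential_imageP ess; apply/essential_imageP => y y0.
have [s [n0 yn]] := locN.2 y.
pose annih (t : denom p) := fun a : A^o => (a : A) *: (den t *: n0) = 0.
have hann (x : N) : submodP (fun a : A^o => (a : A) *: x = 0).
  split=> [|a b c b0 c0]; first exact: scale0r.
  by rewrite scalerDl -[a *: b]/(a * b) -scalerA b0 c0 scaler0 addr0.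
have [||_ [t ->] tmax] := @max_submod A A^o
    (fun P => exists t, P = annih t) (left_noetherianP nA).
- by move=> _ [t ->]; apply: hann.
- by exists (annih (denom1 p)), (denom1 p).
pose n1 := den t *: n0.
have kap_neq0 (u : denom p) : kap (den u *: n1) <> 0.
  move=> /eqP kn0; apply: y0; apply: (@den_inj _ _ _ _ s); rewrite scaler0 yn.
  apply: (@den_inj _ _ _ _ t); rewrite scaler0 -loc_linearZ.
  by apply: (@den_inj _ _ _ _ u); rewrite scaler0 -loc_linearZ; apply/eqP.
have annU (u : denom p) a : a *: (den u *: n1) = 0 -> a *: n1 = 0.
  move=> a0; have aU : annih (denomM u t) a by rewrite /annih denM -scalerA.
  suff e : annih (denomM u t) = annih t by rewrite e in aU.
  apply: tmax; first by exists (denomM u t).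
  move=> b; rewrite /annih denM -scalerA => b0.
  by rewrite scalerA -den_comm -scalerA b0 scaler0.
have [|k [a [aP agen]]] := left_noetherianP nA (P := fun a : A^o => exists m, f m = (a : A) *: n1).
  split=> [|b c c' [m mE] [m' mE']]; first by exists 0; rewrite linear0 scale0r.
  exists (b *: m + m'); rewrite linearP mE mE' scalerDl.
  by rewrite -[b *: c]/(b * c) scalerA.
have [i ai0] : exists i, kap (a i *: n1) <> 0.
  apply: contrapT => none.
  have [|u uP] := loc_kill_family (x := fun i => a i *: n1) locN.
    by move=> i; apply: contrapT => ai0; apply: none; exists i.
  have [|c [m [fm fm0]]] := ess (den u *: n1).
    by move=> un0; apply: (kap_neq0 u); rewrite un0 linear0.
  apply: fm0; have [|d cd] := agen (c * den u); first by exists m; rewrite fm scalerA.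
  have cu0 : c *: (den (denomM u u) *: n1) = 0.
    rewrite denM scalerA mulrA -den_comm -scalerA cd scaler_suml scaler_sumr.
    apply: big1 => i _; rewrite -[d i *: a i]/(d i * a i) -scalerA scalerA den_comm.
    by rewrite -scalerA uP scaler0.
  have c0 := annU _ _ cu0.
  by rewrite scalerA -den_comm -scalerA c0 scaler0.
have [m fm] := aP i.
exists (iota (a i) * iota (den t) * iota (den s)), (lam m : L).
have e : (iota (a i) * iota (den t) * iota (den s)) *: y = kap (a i *: n1).
  by rewrite -!scalerA yn /n1 !loc_linearZ.
by rewrite gP fm e.
Qed.

(** Clearing denominators leaves E (u x) = 0 over A, so u x = E' z for a syzygy E' of E. Over A_p
    the columns of E' are killed by D, so they come from D'. *)
Lemma tor_vanish0_loc (M : lmodType A) (L : lmodType Ap)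
    (lam : {linear M -> restr L iota}) : left_noetherian A^c -> is_loc lam ->
  tor_vanish 0 (fun _ : M => True) -> tor_vanish 0 (fun _ : L => True).
Proof.
move=> nA locM tvM m n k D D' _ exD y _ Dy.
have [s [E0 DE]] := clear_family (fun z : 'I_m * 'I_n => D z.1 z.2).
pose E := \matrix_(i, j) E0 (i, j).
have DEij i j : iota (den s) * D i j = iota (E i j) by rewrite mxE -(DE (i, j)).
have [t [x yx]] := loc_clear_family y locM.
have Ex i : lam (mxact E x i) = 0.
  rewrite mxact_linear -[RHS](scaler0 L (iota (den s) * iota (den t))).
  rewrite -[in RHS](Dy i) scaler_sumr; apply: eq_bigr => j _.
  rewrite -[LHS]/(iota (E i j) *: (lam (x j) : L)) -yx -DEij !scalerA.
  by rewrite -!mulrA (iota_den_comm t).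
have [u uP] := loc_kill_family locM Ex.
have [l [E' [EE' Egen]]] := col_syzygy E nA.
have [//|i|z _ xz] := tvM _ _ _ E E' I (conj EE' Egen) (fun j => den u *: x j).
  rewrite -[RHS](uP i) scaler_sumr; apply: eq_bigr => j _.
  by rewrite !scalerA den_comm.
have [W E'W] : exists W, map_mx iota E' = D' *m W.
  apply: (col_exact_factor exD); apply/matrixP => i j; rewrite [RHS]mxE.
  rewrite -[LHS]mul1r -(inv_denK A s) -mulrA mxE mulr_sumr.
  rewrite (eq_bigr (fun h => iota (E i h * E' h j))); last first.
    by move=> h _; rewrite !mxE mulrA DEij mxE -rmorphM.
  rewrite -rmorph_sum; have /matrixP/(_ i j) := EE'; rewrite !mxE => ->.
  by rewrite rmorph0 mulr0.
pose lz j : L := lam (z j).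
exists (fun j => inv_den t *: (inv_den u *: mxact W lz j)) => // j.
apply: (@den_inj _ _ _ _ t); apply: (@den_inj _ _ _ _ u).
rewrite yx -loc_linearZ xz.
transitivity (mxact D' (mxact W lz) j).
  rewrite -mxact_mul -E'W mxact_linear; apply: eq_bigr => h _.
  by rewrite mxE.
rewrite !scaler_sumr; apply: eq_bigr => h _.
rewrite !(den_scaleC _ (D' j h)) (scalerA (iota (den t))) den_invK scale1r.
by rewrite (scalerA (iota (den u))) den_invK scale1r.
Qed.

(** Dimension shift along a localized free presentation; thus no chain of syzygies has to be lifted
    from A_p to A. *)
Lemma tor_vanish_loc (M : lmodType A) (L : lmodType Ap)
    (lam : {linear M -> restr L iota}) d : left_noetherian A^c -> is_loc lam ->
  tor_vanish d (fun _ : M => True) -> tor_vanish d (fun _ : L => True).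
Proof.
move=> nA; elim: d M L lam => [|d ih] M L lam locM tvM.
  exact: tor_vanish0_loc locM tvM.
pose f := free_map M; pose K := submP (submodP_ker f).
have tvF := @free_tor_vanish A M.
have locF := to_locmod_is_loc p (free_module M); have locK := to_locmod_is_loc p K.
have [g gP] := loc_map_exists lam locF f.
have [i iP] := loc_map_exists (to_locmod p (free_module M)) locK (submP_val (submodP_ker f)).
have tvK : tor_vanish d (fun _ : locmod p K => True).
  apply: (ih _ _ _ locK); apply/tor_vanish_subtype/tor_vanish_shift => //.
  apply: tor_vanish_ext tvM => x; split=> // _; exact: free_map_surj.
have ker_g x : g x = 0 <-> exists y, i y = x.
  apply: (loc_map_exact locK locF locM iP gP) => z.
  split=> [/(submP_sur (submodP_ker f))//|[w <-]].
  exact: (submP_valP w).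
have tvL : tor_vanish d.+1 (fun y => exists x, g x = y).
  apply/tor_vanish_shift; first exact: loc_rnoeth.
    exact: tor_vanish0_loc locF tvF.
  have injI := loc_map_inj locK locF iP (submP_val_inj (hP := submodP_ker f)).
  apply: (tor_vanish_ext _ (tor_vanish_image injI tvK)) => x.
  by rewrite ker_g; split=> [[y _]|[y]]; exists y.
apply: tor_vanish_ext tvL => y; split=> // _.
by apply: (loc_map_surj locM gP); apply: free_map_surj.
Qed.

Lemma col_exact_loc k n m (D' : 'M[A]_(n, k)) (D : 'M[A]_(m, n)) :
  col_exact D' D -> col_exact (map_mx iota D') (map_mx iota D).
Proof.
move=> [DD' Dgen]; split=> [|c Dc].
  by rewrite -map_mxM DD' map_mx0.
have [s [a ca]] := clear_family (fun i => c i 0).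
have [|u uP] := kill_family (a := fun i => (D *m \col_j a j) i 0) (p := p).
  move=> i; rewrite mxE rmorph_sum -[RHS](mulr0 (iota (den s))).
  have /matrixP/(_ i 0) := Dc; rewrite [RHS]mxE => e.
  rewrite -[in RHS]e [X in _ = _ * X]mxE mulr_sumr; apply: eq_bigr => j _.
  by rewrite !mxE rmorphM -ca mulrA -iota_den_comm mulrA.
have [|w wP] := Dgen (den u *: \col_j a j).
  rewrite central_scale_mulmx; last by move=> b; rewrite den_comm.
  by apply/matrixP => i j; rewrite ord1 mxE uP mxE.
exists (inv_den s *: (inv_den u *: map_mx iota w)).
rewrite !central_scale_mulmx; try exact: inv_den_comm.
rewrite -map_mxM -wP; apply/matrixP => i j; rewrite ord1 !mxE rmorphM.
by rewrite (mulrA (inv_den u)) inv_denK mul1r -ca mulrA inv_denK mul1r.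
Qed.

Lemma syz_loc d m n (D : 'M[A]_(m, n)) : syz d D -> syz d (map_mx iota D).
Proof.
elim: d m n D => [//|d ih] n k D' [m [D [syzD exD]]].
by exists m, (map_mx iota D); split; [apply: ih|apply: col_exact_loc].
Qed.

(** Syzygies over A localize to syzygies over A_p, so flat dimension does not grow under restriction
    to A. *)
Lemma tor_vanish_restr (E : lmodType Ap) d :
  tor_vanish d (fun _ : E => True) -> tor_vanish d (fun _ : restr E iota => True).
Proof.
move=> tvE m n k D D' /syz_loc syzD /col_exact_loc exD x _ Dx.
have [//|i|y _ xy] := tvE _ _ _ _ _ syzD exD (x : 'I_n -> E).
  by rewrite -[RHS](Dx i); apply: eq_bigr => j _; rewrite mxE.
by exists y => // j; rewrite [LHS]xy; apply: eq_bigr => i _; rewrite mxE.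
Qed.

(** A denominator turns a relation with coefficients in A_p into one over A, and denominators act
    injectively on E. *)
Lemma baer_fg_restr (E : lmodType Ap) :
  baer_fg (fun _ : E => True) -> baer_fg (fun _ : restr E iota => True).
Proof.
move=> bE n a m _ am; have [//|c ca0|x _ mx] := bE n (fun i => iota (a i)) m; last first.
  by exists x.
have [s [c' cc']] := clear_family c.
have [|u uP] := kill_family (a := fun _ : 'I_1 => \sum_i c' i * a i) (p := p).
  move=> _; rewrite rmorph_sum -[RHS](mulr0 (iota (den s))) -[in RHS]ca0 mulr_sumr.
  by apply: eq_bigr => i _; rewrite rmorphM -cc' mulrA.
have um : \sum_i (den u * c' i) *: (m i : restr E iota) = 0.
  by apply: am; rewrite -[RHS](uP ord0) mulr_sumr; apply: eq_bigr => i _; rewrite mulrA.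
apply: (@den_inj _ _ _ _ s); apply: (@den_inj _ _ _ _ u).
rewrite !scaler0 -[RHS]um !scaler_sumr; apply: eq_bigr => i _.
by rewrite restrZ !scalerA rmorphM -cc' mulrA.
Qed.

Lemma localized_resolution (I : right_resolution A^o) : left_noetherian A ->
  minimal_injective I ->
  exists I' : right_resolution Ap^o, minimal_injective I' /\
    forall i, exists lam : {linear I i -> restr (I' i) iota}, is_loc lam.
Proof.
move=> nA [injI ess0 essS].
have locI i := to_locmod_is_loc p (I i); have locA := regular_is_loc A p.
have [aug augP] := loc_map_exists (to_locmod p (I 0)) locA (rres_aug I).
pose d i := cid (loc_map_exists (to_locmod p (I i.+1)) (locI i) (rres_d I i)).
have dP i x : sval (d i) (to_locmod p (I i) x) = to_locmod p (I i.+1) (rres_d I i x).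
  by case: (d i).
have aug_inj := loc_map_inj locA (locI 0) augP (@rres_aug_inj _ _ I).
have ex0 := loc_map_exact locA (locI 0) (locI 1) augP (dP 0) (@rres_exact0 _ _ I).
have exS i := loc_map_exact (locI i) (locI i.+1) (locI i.+2) (dP i) (dP i.+1)
  (@rres_exact _ _ I i).
exists (@RightResolution Ap Ap^o (fun i => locmod p (I i)) (fun i => sval (d i))
  aug aug_inj ex0 exS); split=> [|i]; last by exists (to_locmod p (I i)).
split=> [l| |l].
- exact: loc_injective nA (locI l) (injI l).
- exact: loc_essential nA locA (locI 0) augP ess0.
- exact: loc_essential nA (locI l) (locI l.+1) (dP l) (essS l).
Qed.

End LocalTransfer.

(** * Simple submodules of localizations *)

Section SpanDimension.
Variables (R : comPzRingType) (p : primeSpec R) (V : lmodType R).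

Definition spans m (y : 'I_m -> V) (T : V -> Prop) : Prop :=
  (forall i, T (y i)) /\ forall z, T z ->
    exists (s : denom p) (r : 'I_m -> R), dval s *: z = \sum_i r i *: y i.

(* Subspaces of a finite-dimensional vector space over the residue field at p,
   phrased without constructing that field: a proper subspace is spanned by
   fewer vectors. *)
Lemma proper_subspace_spans m (y : 'I_m -> V) (T T' : V -> Prop) :
  submodP T -> submodP T' -> (forall z, T' z -> T z) ->
  (forall (s : denom p) z, T z -> T' (dval s *: z) -> T' z) ->
  (forall r z, r \in p -> T z -> r *: z = 0) -> spans y T ->
  exists k (y' : 'I_k -> V),
    [/\ (k <= m)%N, spans y' T' & (k < m)%N \/ forall z, T z -> T' z].
Proof.
elim: m y T T' => [|m ih] y T T' hT hT' T'T closedT' killT [Ty Tgen].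
  have TT' z : T z -> T' z.
    move=> Tz; have [s [r sz]] := Tgen z Tz; apply: (closedT' s) => //.
    by rewrite sz big_ord0; apply: submod0 hT'.
  exists 0, y; split=> //; last by right.
  by split=> [[]//|z /T'T/Tgen].
pose yr i := y (lift ord0 i).
(* The part of T spanned by all vectors but the first; the induction applies to its intersection
   with T'. *)
pose U z := T z /\ exists (s : denom p) (r : 'I_m -> R), dval s *: z = \sum_i r i *: yr i.
have hU : submodP U.
  split.
    split; first exact: submod0 hT.
    exists (denom1 p), (fun=> 0); rewrite scaler0 big1 // => i _.
    exact: scale0r.
  move=> a u v [Tu [s [r su]]] [Tv [s' [r' sv]]]; split; first exact: submodZD.
  exists (denomM s s'), (fun i => dval s' * a * r i + dval s * r' i).
  rewrite dvalM scalerDr.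
  have -> : (dval s * dval s') *: (a *: u) = (dval s' * a) *: (dval s *: u).
    by rewrite !scalerA; congr (_ *: _); ring.
  rewrite -[X in _ + X]scalerA su sv !scaler_sumr -big_split; apply: eq_bigr => i _.
  by rewrite scalerDl !scalerA.
have UT z : U z -> T z by case.
have yrU i : U (yr i).
  split; first exact: Ty.
  exists (denom1 p), (fun j => (j == i)%:R).
  rewrite dval1 scale1r (bigD1 i) //= eqxx scale1r big1 ?addr0 // => j /negPf ->.
  exact: scale0r.
have [|||||k [y' [km [T'y' T'gen] kU]]] := ih yr U (fun z => T' z /\ U z) hU.
- exact: submodP_I.
- by move=> z [].
- by move=> s z Uz [T'sz _]; split=> //; apply: (closedT' s) => //; apply: UT.
- by move=> r z rp /UT; apply: killT.
- by split=> // z [].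
have [T'U|] := pselect (forall z, T' z -> U z).
  exists k, y'; split; [exact: leqW| |by left].
  by split=> [i|z T'z]; [case: (T'y' i)|apply: T'gen; split=> //; apply: T'U].
move=> /existsNP[t /not_implyP[T't nUt]].
have [s [r st]] := Tgen t (T'T t T't).
(* As t is outside U and p kills T, the coefficient of t at the first vector is a unit at p. A
   spanning family of the intersection of T' and U, together with t, then spans T'. *)
have c_notp : r ord0 \notin p.
  apply/negP => cp; apply: nUt; split; first exact: T'T.
  exists s, (fun i => r (lift ord0 i)).
  by rewrite st big_ord_recl (killT _ _ cp) ?add0r.
pose c : denom p := exist (fun x => is_true (x \notin p)) (r ord0) c_notp.
pose y1 (i : 'I_k.+1) := if unlift ord0 i is Some j then y' j else t.
have y10 : y1 ord0 = t by rewrite /y1 unlift_none.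
have y1S j : y1 (lift ord0 j) = y' j by rewrite /y1 liftK.
exists k.+1, y1; split=> //.
  split=> [i|z T'z].
    case: (unliftP ord0 i) => [j ->|->]; rewrite ?y10 ?y1S //.
    by case: (T'y' j).
  have [s' [r' s'z]] := Tgen z (T'T z T'z).
  (* Cross-multiplication cancels the first vector, so that w lies in U. *)
  pose w := (dval c * dval s') *: z - (r' ord0 * dval s) *: t.
  have T'w : T' w by apply: (submodB hT'); apply: submodZ.
  have Uw : U w.
    split; first exact: T'T.
    exists (denom1 p), (fun i => dval c * r' (lift ord0 i) - r' ord0 * r (lift ord0 i)).
    rewrite dval1 scale1r /w -!scalerA s'z st !big_ord_recl !scalerDr !scalerA.
    rewrite opprD addrACA [dval c * _]mulrC subrr add0r !scaler_sumr -sumrB.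
    by apply: eq_bigr => i _; rewrite scalerBl !scalerA.
  have [s2 [q s2w]] := T'gen w (conj T'w Uw).
  exists (denomM s2 (denomM c s')),
    (fun i => if unlift ord0 i is Some j then q j else dval s2 * (r' ord0 * dval s)).
  rewrite big_ord_recl unlift_none y10 !dvalM -scalerA.
  rewrite -[X in _ *: X](subrK ((r' ord0 * dval s) *: t)) -/w scalerDr s2w addrC.
  rewrite scalerA; congr (_ + _); apply: eq_bigr => i _.
  by rewrite liftK y1S.
(* In the second case U lies in T'. Up to the unit c the first vector is a combination of t and
   elements of U, so it is in T' too, and T' is all of T. *)
case: kU => [km1|UT']; [by left|right] => z Tz.
have T'y0 : T' (y ord0).
  apply: (closedT' c) => //.
  have -> : dval c *: y ord0 = dval s *: t - \sum_i r (lift ord0 i) *: yr i.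
    by rewrite st big_ord_recl addrK.
  apply: (submodB hT'); first exact: submodZ.
  by apply: (submod_sumZ hT') => i; case: (UT' _ (yrU i)).
have [s' [r' s'z]] := Tgen z Tz; apply: (closedT' s') => //.
rewrite s'z big_ord_recl; apply: (submodD hT'); first exact: submodZ.
by apply: (submod_sumZ hT') => i; case: (UT' _ (yrU i)).
Qed.

End SpanDimension.

(** * Minimal submodules over a localization *)

Section MinimalSubmodule.
Variables (R : comPzRingType) (A : centralAlg R) (p : primeSpec R).
Local Notation Ap := (central_loc A p).
Local Notation iota := (@loc_iota R A p : {rmorphism A -> Ap}).
Local Notation iotaR := (iota \o alg_map A : {rmorphism R -> Ap}).
Variable L : lmodType Ap.

Definition minimal_submod (T : L -> Prop) : Prop :=
  [/\ submodP T, exists2 z, T z & z <> 0 & forall Q : L -> Prop, submodP Q ->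
      (forall z, Q z -> T z) -> (exists2 z, Q z & z <> 0) -> forall z, T z -> Q z].

Lemma minimal_submod_simple (T : L -> Prop) (hT : submodP T) :
  minimal_submod T -> simple_module (submP hT).
Proof.
move=> [_ [z Tz z0] Tmin]; split.
  have [x xz] := submP_sur hT Tz; exists x; apply/eqP => x0.
  by apply: z0; rewrite -xz x0 linear0.
move=> S hS; have hI := submodP_imP (submP_val hT) (closed_submodP hS).
have [[x xS x0]|S0] := pselect (exists2 x, x \in S & x <> 0).
  right=> y; rewrite [RHS]inE.
  have [||y' y'S] := Tmin _ hI _ _ (submP_val hT y) (submP_valP y).
  - by move=> _ [y' _ <-]; apply: submP_valP.
  - exists (submP_val hT x); first by exists x.
    by move=> vx0; apply: x0; apply: (submP_val_inj (hP := hT)); rewrite linear0.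
  by move=> /submP_val_inj <-.
left=> x; rewrite inE; apply/idP/eqP => [xS|->].
  by apply: contrapT => x0; apply: S0; exists x.
by case: hS.
Qed.

Lemma submodP_restr (B C : pzRingType) (phi : {rmorphism B -> C})
    (M : lmodType C) (T : M -> Prop) :
  submodP T -> submodP (T : restr M phi -> Prop).
Proof. by move=> [T0 TZD]; split=> // a x y; apply: TZD. Qed.

(** Descent on the number of vectors that span T over the residue field: a proper submodule is
    spanned by fewer vectors. *)
Lemma minimal_submod_exists m (y : 'I_m -> restr L iotaR) (T : L -> Prop) :
  submodP T -> (exists2 z, T z & z <> 0) ->
  (forall r z, r \in p -> T z -> iotaR r *: z = 0) -> spans p y T ->
  exists T0, minimal_submod T0 /\ forall z, T0 z -> T z.
Proof.
have [N] := ubnP m; elim: N m y T => // N ih m y T; rewrite ltnS => mN.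
move=> hT T0 killT spanT.
have [[Q [hQ QT Q0 nTQ]]|noQ] := pselect (exists Q : L -> Prop,
    [/\ submodP Q, forall z, Q z -> T z, exists2 z, Q z & z <> 0 &
        ~ forall z, T z -> Q z]); last first.
  exists T; split=> //; split=> // Q hQ QT Q0; apply: contrapT => nTQ.
  by apply: noQ; exists Q.
have [|k [y' [_ spanQ [km|//]]]] := proper_subspace_spans
    (submodP_restr iotaR hT) (submodP_restr iotaR hQ) QT _ killT spanT.
  move=> s z _ Qsz.
  have -> : z = (inv_den s *: (iota (den s) *: (z : L)) : L).
    by rewrite scalerA inv_denK scale1r.
  exact: submodZ.
have [||T1 [minT1 T1Q]] := ih k y' Q _ hQ Q0 _ spanQ.
- exact: leq_trans km mN.
- by move=> r z rp /QT; apply: killT.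
by exists T1; split=> // z /T1Q/QT.
Qed.

End MinimalSubmodule.

Section AssociatedPrime.
Variables (R : comPzRingType) (A : centralAlg R).
Hypotheses (nR : noetherian R) (fA : module_finite A).

(* p is an annihilator in R, maximal among those of nonzero elements x of P; the
   elements outside p then act injectively on A x, and the localization of A x
   is a finite-dimensional module over the residue field at p. *)
Lemma local_socle (J : lmodType A) (P : J -> Prop) : submodP P ->
  (exists2 x, P x & x <> 0) ->
  exists p : primeSpec R, forall (L : lmodType (central_loc A p))
    (lam : {linear J -> restr L (@loc_iota R A p : {rmorphism A -> _})}), is_loc lam ->
  exists (T0 : L -> Prop) (P0 : J -> Prop),
    [/\ minimal_submod T0, forall z, P0 z -> P z, submodP P0,
        forall z, P0 z -> lam z = 0 -> z = 0 &
        forall w, T0 w -> exists (s : denom p) z,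
          P0 z /\ loc_iota p (den s) *: w = lam z].
Proof.
move=> hP [x0 Px0 x00].
pose annR (x : J) := fun r : R^o => alg_map A r *: x = 0.
have hann x : submodP (annR x).
  split=> [|a b c b0 c0]; rewrite /annR; first by rewrite rmorph0 scale0r.
  by rewrite rmorphD scalerDl rmorphM -scalerA b0 c0 scaler0 addr0.
have [||_ [x [Px xn0 ->]] xmax] := @max_submod R R^o
    (fun Q => exists x, [/\ P x, x <> 0 & Q = annR x]) (left_noetherianP nR).
- by move=> _ [x [_ _ ->]]; apply: hann.
- by exists (annR x0), x0.
have annE z : P z -> z <> 0 -> (forall r, annR x r -> annR z r) ->
    forall r, annR z r -> annR x r.
  move=> Pz z0 xz r; suff -> : annR z = annR x by [].
  by apply: xmax => //; exists z.
have p0 : (0 : R) \in to_pred (annR x) by apply/asboolP; apply: submod0 (hann x).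
have pD r s : r \in to_pred (annR x) -> s \in to_pred (annR x) -> r + s \in to_pred (annR x).
  by move=> /asboolP rx /asboolP sx; apply/asboolP; apply: (submodD (hann x)).
have pM r s : s \in to_pred (annR x) -> r * s \in to_pred (annR x).
  by move=> /asboolP sx; apply/asboolP; apply: (submodZ (hann x) r sx).
have p1 : (1 : R) \notin to_pred (annR x).
  by apply/asboolPn; rewrite /annR rmorph1 scale1r.
(* If s x is nonzero, its annihilator contains that of x, hence equals it by maximality, and r lies
   in it. *)
have pprime r s : r * s \in to_pred (annR x) -> r \in to_pred (annR x) \/ s \in to_pred (annR x).
  move=> /asboolP; rewrite /annR rmorphM -scalerA => rsx.
  have [sx|sx] := pselect (alg_map A s *: x = 0); first by right; apply/asboolP.
  left; apply/asboolP; apply: (annE (alg_map A s *: x)) => //.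
    exact: (submodZ hP).
  move=> q qx; rewrite /annR scalerA alg_mapC -scalerA.
  by rewrite [alg_map A q *: x]qx scaler0.
pose p := PrimeSpec p0 pD pM p1 pprime.
exists p => L lam locL.
pose P0 z := exists a : A, z = a *: x.
have hP0 : submodP P0.
  split=> [|a _ _ [b ->] [c ->]]; first by exists 0; rewrite scale0r.
  by exists (a * b + c); rewrite scalerDl scalerA.
have P0P z : P0 z -> P z by move=> [a ->]; apply: submodZ.
have killP0 r z : r \in p -> P0 z -> alg_map A r *: z = 0.
  move=> /asboolP rx [a ->].
  by rewrite scalerA alg_mapC -scalerA [alg_map A r *: x]rx scaler0.
have P0lam z : P0 z -> lam z = 0 -> z = 0.
  move=> P0z /locL.1[s sz0]; apply: contrapT => z0.
  have /negP := valP s; apply; apply/asboolP; apply: (annE z) => //; first exact: P0P.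
  by move=> r rx; apply: killP0 => //; apply/asboolP.
(* The localization of A x inside L; the images of the g_i x span it, for g_i generating A over
   R. *)
pose T (w : L) := exists (s : denom p) z, P0 z /\ loc_iota p (den s) *: w = lam z.
have Tlam z : P0 z -> T (lam z).
  by move=> P0z; exists (denom1 p), z; rewrite den1 [loc_iota p 1]rmorph1 scale1r.
have hT : submodP T.
  split=> [|b u v [s [z [P0z e]]] [s' [z' [P0z' e']]]].
    by exists (denom1 p), 0; rewrite linear0 scaler0; split=> //; apply: submod0 hP0.
  have [t [a ea]] := loc_clear b.
  exists (denomM t (denomM s s')), ((a * den s') *: z + (den t * den s) *: z').
  split; first by apply: (submodD hP0); apply: submodZ.
  exact: loc_combination ea e e'.
have [m [g ggen]] := fA.
have [|||T0 [minT0 T0T]] := @minimal_submod_exists R A p L m (fun i => lam (g i *: x)) T hT.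
- exists (lam x); first by apply: Tlam; exists 1; rewrite scale1r.
  by move=> lx0; apply: xn0; apply: P0lam => //; exists 1; rewrite scale1r.
- move=> r w rp [s [z [P0z e]]]; apply: (@den_inj _ _ _ _ s).
  rewrite scaler0 den_scaleC e -[LHS]loc_linearZ killP0 //.
  exact: linear0.
- split=> [i|w [s [_ [[a ->] e]]]]; first by apply: Tlam; exists (g i).
  have [c ac] := ggen a; exists s, c.
  rewrite -[LHS]/(loc_iota p (den s) *: (w : L)) e ac scaler_suml linear_sum.
  by apply: eq_bigr => i _; rewrite -scalerA loc_linearZ.
exists T0, P0; split=> // w /T0T; exact.
Qed.

End AssociatedPrime.

(** * The local-global principle *)

Section LocalGlobal.
Variables (R : comPzRingType) (A : centralAlg R).
Hypotheses (nR : noetherian R) (fA : module_finite A).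
Let nA : left_noetherian A := alg_lnoeth nR fA.
Let nAc : left_noetherian A^c := alg_rnoeth nR fA.

Lemma tor_vanish_chain (J : lmodType A) d (F : set (set J)) :
  (F !=set0)%classic -> total_on F subset ->
  (forall X, F X -> tor_vanish d X) -> tor_vanish d (\bigcup_(X in F) X)%classic.
Proof.
move=> F0 Ftot Ftv m n k D D' syzD exD x xF Dx.
have [X FX Xx] := chain_finite F0 Ftot xF.
have [y Xy xy] := Ftv X FX _ _ _ _ _ syzD exD x Xx Dx.
by exists y => // j; exists X.
Qed.

Lemma baer_fg_chain (J : lmodType A) (F : set (set J)) :
  (F !=set0)%classic -> total_on F subset ->
  (forall X, F X -> baer_fg X) -> baer_fg (\bigcup_(X in F) X)%classic.
Proof.
move=> F0 Ftot Fb n a m mF am.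
have [X FX Xm] := chain_finite F0 Ftot mF.
have [x Xx mx] := Fb X FX n a m Xm am.
by exists x => //; exists X.
Qed.

Lemma baer_fg_subtype (J : lmodType A) (K : J -> Prop) (hK : submodP K) :
  baer_fg K -> baer_fg (fun _ : submP hK => True).
Proof.
move=> bK n a m _ am.
have [i|c ca0|x Kx mx] := bK n a (fun i => submP_val hK (m i)).
- exact: submP_valP.
- by rewrite -linear_sumZ am ?linear0.
have [y yx] := submP_sur hK Kx; exists y => // i.
by apply: (submP_val_inj (hP := hK)); rewrite mx linearZ yx.
Qed.

(* A submodule of J maximal among the injective ones of flat dimension at most d
   is a direct summand of J; a nonzero complement would contain a copy of
   I_(A_p)(S) for some p and some simple S embedding in J_p. *)
Lemma tor_vanish_local (J : lmodType A) d : injective_module J ->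
  (forall p : primeSpec R, exists (L : lmodType (central_loc A p))
     (lam : {linear J -> restr L (@loc_iota R A p : {rmorphism A -> _})}),
     is_loc lam /\
     forall (S : lmodType (central_loc A p)) (h : {linear S -> L}),
       simple_module S -> (exists x, h x <> 0) ->
       forall (E : lmodType (central_loc A p)) (f : {linear S -> E}),
         injective_envelope f -> tor_vanish d (fun _ : E => True)) ->
  tor_vanish d (fun _ : J => True).
Proof.
move=> injJ locJ.
pose good (K : set J) := [/\ submodP K, baer_fg K & tor_vanish d K].
have [||K [[hK bK tvK] _ Kmax]] := @Zorn_above J good (set1 0) 0 erefl.
- split.
  + by split=> // a x y -> ->; rewrite scaler0 addr0.
  + by move=> n a m m0 _; exists 0 => // i; rewrite (m0 i) scaler0.
  + move=> m n k D D' _ _ x x0 _; exists (fun=> 0) => // j.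
    by rewrite mxact_cst0 //; apply: x0.
- move=> F Fgood F0 Ftot; split.
  + by apply: submodP_chain => // X /Fgood[].
  + by apply: baer_fg_chain => // X /Fgood[].
  + by apply: tor_vanish_chain => // X /Fgood[].
have injK : injective_module (submP hK).
  by apply: baer_fg_injective => //; apply: baer_fg_subtype.
have [r rK] := injective_retraction injK (submP_val_inj (hP := hK)).
(* The projection onto the summand K, as an endomorphism of J. *)
have [psi [psiK Kpsi]] : exists psi : {linear J -> J},
    (forall x, K x -> psi x = x) /\ forall x, K (psi x).
  exists (submP_val hK \o r : {linear J -> J}).
  split=> [x /(submP_sur hK)[y <-]|x]; last exact: submP_valP.
  by rewrite -[LHS]/(submP_val hK (r (submP_val hK y))) rK.
apply: tor_vanish_ext (tvK) => x; split=> // _; apply: contrapT => nKx.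
pose P z := psi z = 0; have hP : submodP P := submodP_ker psi.
have [|p soc] := @local_socle R A nR fA J P hP.
  exists (x - psi x); first by rewrite /P linearB (psiK _ (Kpsi x)) subrr.
  by move=> /eqP; rewrite subr_eq0 => /eqP xpsi; apply: nKx; rewrite xpsi.
have [L [lam [locL tvL]]] := locJ p.
have [T0 [P0 [minT0 P0P hP0 P0lam T0P0]]] := soc L lam locL.
have hT0 : submodP T0 by case: minT0.
have simS := minimal_submod_simple hT0 minT0.
have [w0 w00] : exists w0, submP_val hT0 w0 <> 0.
  by have [_ [z /(submP_sur hT0)[w wz] z0] _] := minT0; exists w; rewrite wz.
have [E [f envf]] := injective_envelope_exists (submP hT0).
have tvE := tvL _ (submP_val hT0) simS (ex_intro _ w0 w00) E f envf.
have [injE injf /essential_imageP essf] := envf.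
pose iota : {rmorphism A -> central_loc A p} := @loc_iota R A p.
have tvEA : tor_vanish d (fun _ : restr E iota => True) := tor_vanish_restr tvE.
have bEA : baer_fg (fun _ : restr E iota => True).
  exact/baer_fg_restr/injective_baer_fg.
(* f w goes to the z in [P0] that represents w; z is unique because [lam] is injective on [P0]. *)
pose G (z : restr E iota * J) := exists w, [/\ P0 z.2, f w = z.1 &
  submP_val hT0 w = lam z.2].
have [|g0 g0G] := @injective_graph_extends A (restr E iota) J G injJ.
  split; first split.
  - by exists 0; split; rewrite ?linear0 //; apply: submod0 hP0.
  - move=> a [e1 z1] [e2 z2] [w1 [Pz1 fw1 lw1]] [w2 [Pz2 fw2 lw2]].
    exists (iota a *: w1 + w2); split; first exact: submodZD.
      by rewrite linearP fw1 fw2.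
    by rewrite [LHS]linearP lw1 lw2 [RHS]linearP.
  - move=> z [w [/= Pz fw0 lw]]; apply: P0lam => //; rewrite -lw.
    by rewrite (injf w 0) ?linear0.
(* Subtracting the component in K moves the image into the complement ker psi. Values in [P0] do not
   change, as [P0] already lies there. *)
have [g gE] : exists g : {linear restr E iota -> J},
    forall e, g e = g0 e - psi (g0 e).
  by exists (g0 \- (psi \o g0) : {linear restr E iota -> J}).
have psig e : psi (g e) = 0.
  by rewrite gE linearB (psiK _ (Kpsi _)) subrr.
(* By essentiality a nonzero e in the kernel has a nonzero multiple of the form f w; up to
   denominators g sends it to the element of [P0] representing w. *)
have g_inj : injective g.
  apply: linear_inj0 => e ge0; apply: contrapT => e0.
  have [b [w [fw be0]]] := essf e e0.
  have [s [a ea]] := loc_clear b.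
  have [u [z [P0z uz]]] := T0P0 _ (submP_valP (iota (den s) *: w)).
  have zE : g (iota (den u * a) *: e) = z.
    rewrite gE (g0G _ z) ?[psi z](P0P _ P0z) ?subr0 //.
    exists (iota (den u) *: (iota (den s) *: w)); split=> //.
    rewrite -[RHS]/(iota (den u * a) *: (e : E)) !linearZ_LR fw rmorphM -scalerA.
    by rewrite -[iota a]ea -scalerA.
  have z0 : z = 0.
    by rewrite -zE -[iota _ *: e]/((den u * a) *: (e : restr E iota)) linearZ_LR ge0 scaler0.
  apply: be0; rewrite -fw; apply: (@den_inj _ _ _ _ s); apply: (@den_inj _ _ _ _ u).
  have ws0 : iota (den u) *: (iota (den s) *: w) = 0.
    apply: (submP_val_inj (hP := hT0)); rewrite linear0 linearZ_LR [LHS]uz z0.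
    exact: linear0.
  by rewrite !scaler0 -!linearZ_LR ws0 linear0.
(* K + g(E) is again [good], so it equals K by maximality. As g(E) lies in ker psi, which meets K in
   0, this forces g = 0, although g is injective and E is nonzero. *)
pose K' (y : J) := exists k e, K k /\ y = k + g e.
have psiK' k e : K k -> psi (k + g e) = k.
  by move=> Kk; rewrite linearD psig addr0 psiK.
have K'E : K' = K.
  apply: Kmax => [|y Ky]; last by exists y, 0; rewrite linear0 addr0.
  split.
  - split=> [|a _ _ [k [e [Kk ->]]] [k' [e' [Kk' ->]]]].
      by exists 0, 0; rewrite linear0 addr0; split=> //; apply: submod0 hK.
    exists (a *: k + k'), (a *: e + e'); split; first exact: submodZD.
    by rewrite scalerDr linearP addrACA.
  - move=> n a m K'm am; have /choice[k /choice[e ke]] := K'm.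
    have kE i : psi (m i) = k i by case: (ke i) => Kk ->; apply: psiK'.
    have ak c : \sum_i c i * a i = 0 -> \sum_i c i *: k i = 0.
      move=> /am/(congr1 psi); rewrite linear_sumZ linear0 => e0.
      by rewrite -[RHS]e0; apply: eq_bigr => i _; rewrite kE.
    have [i|//|k0 Kk0 kk0] := bK n a k; first by case: (ke i).
    have [//|c ca0|e0 _ ee0] := bEA n a e.
      apply: g_inj; rewrite linear0 linear_sumZ -[RHS](am c ca0).
      transitivity (\sum_i c i *: k i + \sum_i c i *: g (e i)).
        by rewrite (ak c ca0) add0r.
      rewrite -big_split; apply: eq_bigr => i _.
      by case: (ke i) => _ ->; rewrite scalerDr.
    exists (k0 + g e0) => [|i]; first by exists k0, e0.
    by case: (ke i) => _ ->; rewrite kk0 ee0 linearZ_LR scalerDr.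
  - move=> m n l D D' syzD exD y K'y Dy; have /choice[k /choice[e ke]] := K'y.
    have kE j : psi (y j) = k j by case: (ke j) => Kk ->; apply: psiK'.
    have Dk i : mxact D k i = 0.
      rewrite -[RHS](linear0 psi) -(Dy i) mxact_linear.
      by apply: mxact_eq => j; rewrite kE.
    have [j|//|k0 Kk0 kk0] := tvK _ _ _ D D' syzD exD k; first by case: (ke j).
    have [//|i|e0 _ ee0] := tvEA _ _ _ D D' syzD exD e.
      apply: g_inj; rewrite linear0 mxact_linear -[RHS](Dy i).
      transitivity (mxact D k i + mxact D (fun j => g (e j)) i).
        by rewrite Dk add0r.
      rewrite -big_split; apply: eq_bigr => j _.
      by case: (ke j) => _ ->; rewrite scalerDr.
    exists (fun j => k0 j + g (e0 j)) => j; first by exists (k0 j), (e0 j).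
    case: (ke j) => _ ->; rewrite kk0 ee0 mxact_linear -big_split.
    by apply: eq_bigr => i _; rewrite scalerDr.
have Kg e : K (g e).
  by rewrite -K'E; exists 0, e; rewrite add0r; split=> //; apply: submod0 hK.
have ge0 e : g e = 0 by rewrite -(psiK _ (Kg e)) psig.
have /injf w0E : f w0 = f 0 by rewrite linear0; apply: g_inj; rewrite !ge0.
by apply: w00; rewrite w0E linear0.
Qed.

(** Nonzero Ext^l gives a nonzero map from S to the l-th term of the localized coresolution. It is
    injective by simplicity and extends to an injective map on E, so E is a direct summand of that
    term. *)
Lemma Ext_neq0_fdim (I : right_resolution A^o) n : minimal_injective I ->
  (forall l, (l < n)%N -> (fdim (I l) <= (l%:Z)%:E)%E) ->
  forall (p : primeSpec R) (S : lmodType (central_loc A p)), simple_module S ->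
  forall (E : lmodType (central_loc A p)) (f : {linear S -> E}),
    injective_envelope f ->
  forall l, (l < n)%N -> Ext_neq0 l S (central_loc A p)^o ->
    (fdim E <= (l%:Z)%:E)%E.
Proof.
move=> minI fdimI p S [[x0 _] simS] E f [injE injf /essential_imageP essf] l ln.
have [I' [[injI' _ _] locI']] := localized_resolution p nA minI.
have [lam locl] := locI' l.
have nApc := @loc_rnoeth _ _ p nAc.
have tvI' : tor_vanish l (fun _ : I' l => True).
  by apply: (tor_vanish_loc nAc locl); apply/fdim_leP => //; apply: fdimI.
move=> [P [projP [c [cocyc ncob]]]].
have [h [x hx0]] : exists (h : {linear S -> I' l}) x, h x <> 0.
  apply: contrapT => noh; apply: ncob; apply: (all_coboundary projP injI') cocyc.
  by move=> h x; apply: contrapT => hx0; apply: noh; exists h, x.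
have h_ker z : h z = 0 -> z = 0.
  move=> hz0; have hK := submodP_ker h.
  have [K0|KT] := simS _ (submodP_closed hK).
    by have := K0 z; rewrite to_predE inE asboolT // => /esym/eqP.
  by have := KT x; rewrite to_predE => /asboolP.
have [k kf] := injI' l _ _ f h injf.
have k_inj : injective k.
  apply: linear_inj0 => y ky0; apply: contrapT => y0.
  have [b [z [fz bz0]]] := essf y y0; apply: bz0.
  by rewrite -fz (h_ker z) ?linear0 // -kf fz linearZ_LR ky0 scaler0.
have [r rk] := injective_retraction injE k_inj.
by apply/fdim_leP => //; apply: (tor_vanish_retract rk).
Qed.

(** For the converse, [tor_vanish_local] asks only about simple modules with a nonzero map to the
    localized l-th term, and by minimality these have nonzero Ext^l. *)
Lemma Gorenstein_local n : Gorenstein n A <->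
  forall (p : primeSpec R) (S : lmodType (central_loc A p)), simple_module S ->
  forall (E : lmodType (central_loc A p)) (f : {linear S -> E}),
    injective_envelope f ->
  forall l, (l < n)%N -> Ext_neq0 l S (central_loc A p)^o ->
    (fdim E <= (l%:Z)%:E)%E.
Proof.
split=> [[I [minI fdimI]]|H]; first exact: Ext_neq0_fdim minI fdimI.
have [I minI] := minimal_resolution_exists A^o; exists I; split=> // l ln.
have [injI _ _] := minI.
apply/fdim_leP => //; apply: tor_vanish_local => // p.
have [I' [minI' locI']] := localized_resolution p nA minI.
have [lam locl] := locI' l; exists (I' l), lam; split=> // S h simS [x hx0] E f envf.
apply/fdim_leP; first exact: loc_rnoeth.
apply: (H p S simS E f envf l ln); apply: contrapT => noExt; apply: hx0.
have [P projP] := projective_resolution_exists (@loc_lnoeth _ _ p nA) (simple_fg simS).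
have [injI' _ _] := minI'.
apply: (vanishing_hom projP injI' (simple_minimal_differential simS minI')) => c cc.
by apply: contrapT => nc; apply: noExt; exists P; split=> //; exists c.
Qed.

(** When fdim E = d is finite, f itself is the nonzero map from S to E that forces Ext^i to be
    nonzero for some i <= d. *)
Lemma grade_le_fdim (p : primeSpec R) (S : lmodType (central_loc A p))
    (E : lmodType (central_loc A p)) (f : {linear S -> E}) :
  simple_module S -> injective f -> (grade S <= fdim E)%E.
Proof.
move=> simS injf; rewrite /fdim /inf_nat; case: pselect => [exd|_]; last exact: leey.
case: ex_minnP => d /asboolP fd _.
have [|i id exti] := Ext_neq0_of_hom (@loc_lnoeth _ _ p nA) (simple_fg simS)
    (flat_resolution_tor_vanish (@loc_rnoeth _ _ p nAc) fd) (h := f).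
  have [[x /eqP x0] _] := simS; exists x => fx0; apply: x0.
  by apply: injf; rewrite fx0 linear0.
by apply/inf_nat_leP; exists i.
Qed.

End LocalGlobal.

(** * Grade and the two equivalences *)

Lemma grade_attained (B : pzRingType) (S : lmodType B) (n : nat) :
  (grade S < (n%:Z)%:E)%E ->
  exists2 l, (l < n)%N & grade S = (l%:Z)%:E /\ Ext_neq0 l S B^o.
Proof.
rewrite /grade /inf_nat; case: pselect => [exP|//].
by case: ex_minnP => l /asboolP extl _; rewrite lte_fin ltz_nat => ln; exists l.
Qed.

Theorem theorem1p1 (R : comPzRingType) (R_noetherian : noetherian R)
    (A : centralAlg R) (A_finite : module_finite A) (n : nat) :
  (Gorenstein n A <->
   forall (p : primeSpec R) (S : lmodType (central_loc A p)),
     simple_module S ->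
     forall (I : lmodType (central_loc A p)) (f : {linear S -> I}),
       injective_envelope f ->
       (Order.min ((n%:Z)%:E) (fdim I) <= grade S)%E)
  /\
  (Gorenstein n A <->
   forall (p : primeSpec R) (S : lmodType (central_loc A p)),
     simple_module S -> (grade S < (n%:Z)%:E)%E ->
     forall (I : lmodType (central_loc A p)) (f : {linear S -> I}),
       injective_envelope f ->
       fdim I = grade S).
Proof.
have GL := Gorenstein_local R_noetherian A_finite n.
(* The local criterion [GL] speaks of every l with nonzero Ext^l, conditions (2) and (3) only of the
   least one; this inequality passes between them. *)
have grade_le l (p : primeSpec R) (S : lmodType (central_loc A p)) :
    Ext_neq0 l S (central_loc A p)^o -> (grade S <= (l%:Z)%:E)%E.
  by move=> extl; apply/inf_nat_leP; exists l.
split; (split=> [/GL H p S simS|H]; last apply/GL => p S simS I f envf l ln extl).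
- move=> I f envf; rewrite ge_min.
  (* Below n the grade is attained at some l, and the criterion bounds fdim by that very l. *)
  have [ng|/grade_attained[l ln [-> extl]]] := leP (n%:Z)%:E (grade S); first by [].
  by rewrite (H p S simS I f envf l ln extl) orbT.
- have := H p S simS I f envf; rewrite ge_min => /orP[ng|fg].
    have := le_trans ng (grade_le l p S extl).
    by rewrite lee_fin lez_nat leqNgt ln.
  exact: le_trans fg (grade_le l p S extl).
- move=> /grade_attained[l ln [gl extl]] I f envf; apply/le_anti/andP; split.
    by rewrite gl; apply: (H p S simS I f envf l ln extl).
  have [_ injf _] := envf.
  exact: (grade_le_fdim R_noetherian A_finite simS injf).
- have gl := grade_le l p S extl; rewrite (H p S simS _ I f envf) //.
  by apply: le_lt_trans gl _; rewrite lte_fin ltz_nat.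
Qed.
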